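(* Let $k$ be a field. For any finite poset $P$ in which the poset $D_{1,2}$ or the poset $D_{0,3}$ is embedded as a convex full subposet, the following pairs of invariants on $\mathrm{rep}\,P$ are incomparable: (i) $\mathrm{dgm}^{\mathrm{Int}}$ and $\chi^{\mathrm{Int}}$; (ii) $\mathrm{dgm}^{\mathrm{Int}}$ and $\beta_0^{\mathrm{Int}}$. For any finite poset $P$ such that there exists at least one indecomposable representation of $P$ that is not isomorphic to an interval representation, the following pairs of invariants on $\mathrm{rep}\,P$ are incomparable: (iii) $\pi^{\mathrm{Int}}$ and $\mathrm{dgm}^{\mathrm{Int}}$; (iv) $\pi^{\mathrm{Int}}$ and $\chi^{\mathrm{Int}}$; (v) $\pi^{\mathrm{Int}}$ and $\beta_0^{\mathrm{Int}}$; (vi) $\chi^{\mathrm{Int}}$ and $\beta_0^{\mathrm{Int}}$.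
   Context: The posets: $D_{1,2}$ is the poset on $\{1,2,3,4\}$ generated by the relations $1<3$, $3<2$, $3<4$; $D_{0,3}$ is the poset on $\{1,2,3,4\}$ generated by $3<1$, $3<2$, $3<4$. Representations: for a finite poset $P$, $\mathrm{rep}\,P$ is the (Krull-Schmidt, abelian) category of functors from $P$ (viewed as a category with a unique morphism $x\to y$ iff $x\le y$) to finite-dimensional $k$-vector spaces; its objects are the representations considered. A full subposet $I\subseteq P$ is convex if $x\le y\le z$ with $x,z\in I$ implies $y\in I$; it is connected if it is nonempty and any two of its points are joined by a sequence of points of $I$ in which consecutive points are comparable; an interval is a connected convex full subposet. $\mathrm{Int}(P)$ is the set of intervals of $P$. For $I\in\mathrm{Int}(P)$ the interval representation $k_I$ has $k_I(x)=k$ if $x\in I$ and $0$ otherwise, with identity maps between points $x\le y$ of $I$ and zero maps otherwise; it is indecomposable. A representation is interval decomposable if it is isomorphic to a finite direct sum of interval representations (including zero). Invariants: $K_0^{sp}(\mathrm{rep}\,P)$ is the split Grothendieck group (free abelian group on isomorphism classes $[M]$ modulo $[M\oplus N]=[M]+[N]$), free on the isomorphism classes of indecomposables. An additive invariant is a group homomorphism from $K_0^{sp}(\mathrm{rep}\,P)$ to an abelian group; write $f\gtrsim g$ if $\ker f\subseteq\ker g$; $f$ and $g$ are incomparable if neither $f\gtrsim g$ nor $g\gtrsim f$. The following are additive invariants $K_0^{sp}(\mathrm{rep}\,P)\to\mathbb{Z}^{\mathrm{Int}(P)}$, determined by their values on classes $[M]$: - $\pi^{\mathrm{Int}}([M])(I)$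 is the multiplicity of $k_I$ as a direct summand of $M$. - $\mathrm{rk}^{\mathrm{Int}}([M])(I)$ (generalized rank invariant) is the rank of the canonical linear map $\varprojlim M|_I\to\varinjlim M|_I$, and $\mathrm{dgm}^{\mathrm{Int}}$ (generalized persistence diagram) is its M\''obius inversion over $(\mathrm{Int}(P),\supseteq)$, i.e. $\mathrm{dgm}^{\mathrm{Int}}([M])$ is the unique function $\mathrm{Int}(P)\to\mathbb{Z}$ with $\mathrm{rk}^{\mathrm{Int}}([M])(I)=\sum_{J\in\mathrm{Int}(P),\,J\supseteq I}\mathrm{dgm}^{\mathrm{Int}}([M])(J)$ for all $I\in\mathrm{Int}(P)$. - An interval cover of $M$ is a morphism $f:C\to M$ with $C$ interval decomposable such that every morphism $C'\to M$ with $C'$ interval decomposable factors through $f$, and every endomorphism $h$ of $C$ with $fh=f$ is an automorphism. Interval covers exist and are surjective. The minimal interval resolution $\cdots\to I_1\to I_0\to M\to 0$ is obtained by setting $\Omega^0(M)=M$, letting $I_i\to\Omega^i(M)$ be an interval cover and $\Omega^{i+1}(M)$ its kernel; it is known to have finite length for finite $P$. $\beta_i^{\mathrm{Int}}([M])(J)$ is the number of summands of $I_i$ isomorphic to $k_J$, and $\chi^{\mathrm{Int}}=\sum_{i\ge0}(-1)^i\beta_i^{\mathrm{Int}}$ (interval Euler characteristic). *)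

(* Defs.v *)
From HB Require Import structures.
From mathcomp Require Import all_boot all_order all_algebra.
From mathcomp Require Import generic_quotient ring_quotient.
From mathcomp.classical Require Import boolp classical_sets fsbigop.
From mathcomp.multinomials Require Import freeg.

Set Implicit Arguments.
Unset Strict Implicit.
Unset Printing Implicit Defensive.

Import Order.TTheory GRing.Theory.

Local Open Scope ring_scope.
Local Open Scope quotient_scope.

(* Definite description: the element satisfying p when there is one, and the
   default x0 otherwise. *)
Definition the (T : Type) (x0 : T) (p : T -> Prop) : T :=
  match pselect (exists x, p x) with
  | left h => projT1 (cid h)
  | right _ => x0
  end.

Lemma theP (T : Type) (x0 : T) (p : T -> Prop) :
  (exists x, p x) -> p (the x0 p).
Proof. by move=> h; rewrite /the; case: pselect => // h'; case: (cid h'). Qed.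

Section Representations.
Variables (k : fieldType) (d : Order.disp_t) (P : finPOrderType d).

Record rep := Rep {
  rsp :> P -> vectType k;
  rmap : forall x y : P, (x <= y)%O -> 'Hom(rsp x, rsp y);
  rmap_id : forall (x : P) (h : (x <= x)%O), rmap h = \1%VF;
  rmap_comp : forall (x y z : P) (h : (x <= y)%O) (h' : (y <= z)%O)
    (h'' : (x <= z)%O), rmap h'' = (rmap h' \o rmap h)%VF }.

Record hom (M N : rep) := Hom {
  happ :> forall x : P, 'Hom(M x, N x);
  hom_natural : forall (x y : P) (h : (x <= y)%O),
    (happ y \o rmap M h)%VF = (rmap N h \o happ x)%VF }.

Lemma hom_ext (M N : rep) (f g : hom M N) : (forall x, f x = g x) -> f = g.
Proof.
case: f g => [f nf] [g ng] /= e.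
have {}e : f = g by apply/functional_extensionality_dep.
by rewrite e in nf *; congr Hom; apply: Prop_irrelevance.
Qed.

Lemma idhom_natural (M : rep) (x y : P) (h : (x <= y)%O) :
  (\1 \o rmap M h)%VF = (rmap M h \o \1)%VF.
Proof. by rewrite comp_lfun1l comp_lfun1r. Qed.
Definition idhom (M : rep) : hom M M := Hom (@idhom_natural M).

Lemma comphom_natural (L M N : rep) (g : hom M N) (f : hom L M) (x y : P)
  (h : (x <= y)%O) :
  ((g y \o f y) \o rmap L h)%VF = (rmap N h \o (g x \o f x))%VF.
Proof.
by rewrite -comp_lfunA hom_natural comp_lfunA hom_natural comp_lfunA.
Qed.
Definition comphom (L M N : rep) (g : hom M N) (f : hom L M) : hom L N :=
  Hom (comphom_natural g f).

Definition is_iso (M N : rep) (f : hom M N) : Prop :=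
  exists g : hom N M, comphom g f = idhom M /\ comphom f g = idhom N.

Definition iso (M N : rep) : Prop := exists f : hom M N, is_iso f.

Lemma iso_refl M : iso M M.
Proof.
by exists (idhom M), (idhom M); split; apply: hom_ext => x /=;
  rewrite comp_lfun1l.
Qed.

Lemma iso_sym M N : iso M N -> iso N M.
Proof. by move=> [f [g [gf fg]]]; exists g, f. Qed.

Lemma iso_trans L M N : iso L M -> iso M N -> iso L N.
Proof.
move=> [f [f' [f'f ff']]] [g [g' [g'g gg']]].
have comp_id A B (u : hom A B) (v : hom B A) x :
    comphom v u = idhom A -> (v x \o u x)%VF = \1%VF.
  by move=> /(congr1 (fun w : hom A A => w x)).
exists (comphom g f), (comphom f' g').
split; apply: hom_ext => x /=.
- rewrite -comp_lfunA (comp_lfunA (g' x)) (comp_id _ _ _ _ x g'g).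
  by rewrite comp_lfun1l comp_id.
- rewrite -comp_lfunA (comp_lfunA (f x)) (comp_id _ _ _ _ x ff').
  by rewrite comp_lfun1l comp_id.
Qed.

Definition is_zero (M : rep) : Prop := forall x : P, \dim {: M x} = 0%N.

Definition rep0 : rep.
Proof.
by refine (@Rep (fun=> 'rV[k]_0) (fun _ _ _ => \1%VF) _ _) => *;
  rewrite ?comp_lfun1l.
Defined.

Lemma hom0_natural (M N : rep) (x y : P) (h : (x <= y)%O) :
  (0 \o rmap M h)%VF = (rmap N h \o (0 : 'Hom(M x, N x)))%VF.
Proof. by rewrite comp_lfun0l comp_lfun0r. Qed.
Definition hom0 (M N : rep) : hom M N := Hom (@hom0_natural M N).

Section DirectSum.
Variables M N : rep.

Definition dsum_fun (x y : P) (h : (x <= y)%O) (p : M x * N x) : M y * N y :=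
  (rmap M h p.1, rmap N h p.2).

Lemma dsum_fun_linear x y (h : (x <= y)%O) : linear (dsum_fun h).
Proof. by move=> a u v; rewrite /dsum_fun !linearP. Qed.

HB.instance Definition _ x y (h : (x <= y)%O) :=
  GRing.isLinear.Build k (M x * N x)%type (M y * N y)%type _ (dsum_fun h)
    (dsum_fun_linear h).

Definition dsum : rep.
Proof.
refine (@Rep (fun x => (M x * N x)%type : vectType k)
             (fun x y h => linfun (dsum_fun h)) _ _).
- by move=> x h; apply/lfunP => -[u v]; rewrite lfunE /= /dsum_fun /= !rmap_id
    !id_lfunE.
- move=> x y z h h' h''; apply/lfunP => -[u v].
  rewrite comp_lfunE !lfunE /= /dsum_fun /=.
  by rewrite !(rmap_comp _ h h' h'') !comp_lfunE.
Defined.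

End DirectSum.

Definition rpow (M : rep) (n : nat) : rep := iter n (dsum M) rep0.

Definition indecomposable (M : rep) : Prop :=
  ~ is_zero M /\ forall A B, iso M (dsum A B) -> is_zero A \/ is_zero B.

Definition direct_summand (A M : rep) : Prop := exists B, iso M (dsum A B).

Section Kernel.
Variables (M N : rep) (f : hom M N).

Lemma ker_stable x y (h : (x <= y)%O) (u : subvs_of (lker (f x))) :
  rmap M h (vsval u) \in lker (f y).
Proof.
rewrite memv_ker -comp_lfunE hom_natural comp_lfunE.
by have /[!memv_ker] /eqP-> := subvsP u; rewrite linear0.
Qed.

Definition ker : rep.
Proof.
refine (@Rep (fun x => subvs_of (lker (f x)) : vectType k)
  (fun x y h =>
    linfun (vsproj (lker (f y))) \o rmap M h \o linfun vsval)%VF _ _).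
- move=> x h; apply/lfunP => u.
  by rewrite !comp_lfunE !lfunE /= rmap_id id_lfunE vsvalK.
- move=> x y z h h' h''; apply/lfunP => u; apply: val_inj.
  rewrite !comp_lfunE !lfunE /= (rmap_comp _ h h' h'') comp_lfunE /=.
  by congr (vsval (vsproj _ (rmap _ _ _))); rewrite vsprojK ?ker_stable.
Defined.

End Kernel.

Section Limits.
Variable M : rep.

Record cone := Cone {
  cone_apex :> vectType k;
  cone_leg : forall x : P, 'Hom(cone_apex, M x);
  cone_compat : forall (x y : P) (h : (x <= y)%O),
    (rmap M h \o cone_leg x)%VF = cone_leg y }.

Record cocone := Cocone {
  cocone_apex :> vectType k;
  cocone_leg : forall x : P, 'Hom(M x, cocone_apex);
  cocone_compat : forall (x y : P) (h : (x <= y)%O),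
    (cocone_leg y \o rmap M h)%VF = cocone_leg x }.

Definition is_limit (L : cone) : Prop :=
  forall L' : cone, exists! u : 'Hom(L', L),
    forall x, (cone_leg L x \o u)%VF = cone_leg L' x.

Definition is_colimit (C : cocone) : Prop :=
  forall C' : cocone, exists! u : 'Hom(C, C'),
    forall x, (u \o cocone_leg C x)%VF = cocone_leg C' x.

(* The canonical map from the limit to the colimit is the composite
   lim M -> M x -> colim M, which does not depend on x when the indexing poset
   is connected. *)
Definition is_canonical_rank (r : nat) : Prop :=
  exists (L : cone) (C : cocone) (phi : 'Hom(L, C)),
    [/\ is_limit L, is_colimit C,
        forall x : P, phi = (cocone_leg C x \o cone_leg L x)%VF
      & r = \dim (limg phi)].

End Limits.

End Representations.

Arguments rep k {d} P.
Arguments rep0 {k d P}.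

Section Intervals.
Variables (d : Order.disp_t) (P : finPOrderType d).

Definition convex (I : {set P}) : bool :=
  [forall x in I, forall z in I, forall y, (x <= y <= z)%O ==> (y \in I)].

Definition connected (I : {set P}) : bool :=
  (I != finset.set0) &&
  [forall x in I, forall y in I,
     connect (fun a b => [&& a \in I, b \in I & (a >=< b)%O]) x y].

Definition is_interval (I : {set P}) : bool := convex I && connected I.

Definition Int := {I : {set P} | is_interval I}.
HB.instance Definition _ := Finite.on Int.
HB.instance Definition _ := SubType.on Int.

Definition subposet (I : {set P}) := {x : P | x \in I}.
HB.instance Definition _ (I : {set P}) := SubChoice.on (subposet I).
HB.instance Definition _ (I : {set P}) := Finite.on (subposet I).
HB.instance Definition _ (I : {set P}) :=
  [SubChoice_isSubPOrder of (subposet I) by <: with d].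

End Intervals.

Section IntervalRepresentations.
Variables (k : fieldType) (d : Order.disp_t) (P : finPOrderType d).

(* The space at x is the row vectors of length 1 if x \in I and 0 otherwise;
   the map x -> y is multiplication by the all-ones matrix, i.e. the identity
   of k when x and y both lie in I, and the zero map between spaces one of
   which is zero otherwise. *)
Definition interval_map (I : {set P}) (x y : P) :
    'Hom('rV[k]_(x \in I), 'rV[k]_(y \in I)) :=
  linfun (mulmxr (const_mx 1 : 'M[k]_(x \in I, y \in I))).

Lemma const_mx1 (b : bool) : (const_mx 1 : 'M[k]_b) = 1%:M.
Proof. by case: b; apply/matrixP => i j; rewrite ?ord1 ?mxE //; case: i. Qed.

Lemma const_mx1M (a b c : bool) : (a -> c -> b) ->
  (const_mx 1 : 'M[k]_(a, b)) *m (const_mx 1 : 'M[k]_(b, c)) = const_mx 1.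
Proof.
move=> h; apply/matrixP => i j.
have ha : a by case: (a) i => // -[].
have hc : c by case: (c) j => // -[].
by rewrite !mxE; move: (h ha hc) => -> /=; rewrite big_ord1 !mxE mulr1.
Qed.

Lemma convexP (I : {set P}) (x y z : P) : convex I ->
  (x <= y)%O -> (y <= z)%O -> x \in I -> z \in I -> y \in I.
Proof.
move=> /forall_inP c xy yz xI zI; move: (c x xI) => /forall_inP /(_ z zI).
by move=> /forallP/(_ y); rewrite xy yz.
Qed.

Definition interval_rep (I : Int P) : rep k P.
Proof.
refine (@Rep k d P (fun x => 'rV[k]_(x \in val I))
  (fun x y _ => interval_map (val I) x y) _ _).
- move=> x h; apply/lfunP => v.
  by rewrite lfunE /= const_mx1 mulmx1 id_lfunE.
- move=> x y z h h' h''; apply/lfunP => v.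
  rewrite comp_lfunE !lfunE /= -mulmxA const_mx1M // => xI zI.
  by case/andP: (valP I) => c _; apply: (convexP c h h').
Defined.

Definition interval_decomposable (M : rep k P) : Prop :=
  exists s : seq (Int P),
    iso M (foldr (fun I N => dsum (interval_rep I) N) rep0 s).

Section Restriction.
Variables (M : rep k P) (I : {set P}).

Definition restrict : rep k (subposet I).
Proof.
refine (@Rep k d (subposet I) (fun x => M (val x))
  (fun x y h => rmap M (h : (val x <= val y)%O)) _ _).
- by move=> x h; apply: rmap_id.
- by move=> x y z h h' h''; apply: rmap_comp.
Defined.

End Restriction.

Definition multiplicity (M : rep k P) (I : Int P) : nat :=
  the 0%N (fun n => exists N,
    iso M (dsum (rpow (interval_rep I) n) N)
    /\ ~ direct_summand (interval_rep I) N).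

Definition generalized_rank (M : rep k P) (I : Int P) : nat :=
  the 0%N (is_canonical_rank (restrict M (val I))).

Definition generalized_diagram (M : rep k P) : {ffun Int P -> int} :=
  the 0 (fun g : {ffun Int P -> int} => forall I : Int P,
    (generalized_rank M I)%:Z = \sum_(J : Int P | val I \subset val J) g J).

Definition is_interval_cover (M C : rep k P) (f : hom C M) : Prop :=
  [/\ interval_decomposable C,
      forall (C' : rep k P) (g : hom C' M), interval_decomposable C' ->
        exists h : hom C' C, comphom f h = g
    & forall h : hom C C, comphom f h = f -> is_iso h].

Definition interval_cover (M : rep k P) : {C : rep k P & hom C M} :=
  the (existT _ rep0 (hom0 rep0 M))
      (fun Cf => is_interval_cover (projT2 Cf)).

Definition syzygy (i : nat) (M : rep k P) : rep k P :=
  iter i (fun N => ker (projT2 (interval_cover N))) M.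

Definition betti (i : nat) (M : rep k P) : {ffun Int P -> int} :=
  [ffun J => (multiplicity (projT1 (interval_cover (syzygy i M))) J)%:Z].

(* A sum with finite support: almost all Betti numbers vanish. *)
Definition euler (M : rep k P) : {ffun Int P -> int} :=
  [ffun J => \sum_(i \in [set: nat]) (-1) ^+ i * betti i M J].

End IntervalRepresentations.

Section GrothendieckGroup.
Variables (k : fieldType) (d : Order.disp_t) (P : finPOrderType d).

(* The representations whose spaces are the k^n.  Every representation is
   isomorphic to one of them (exists_coord), so that they account for all
   isomorphism classes.  Unlike [rep k P], which lives in the universe of the
   type of all vector spaces, they form a small type, over which the free
   abelian group can be taken. *)
Record coord_rep := CoordRep {
  cdim : P -> nat;
  cmap : forall x y : P, (x <= y)%O -> 'Hom('rV[k]_(cdim x), 'rV[k]_(cdim y));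
  cmap_id : forall (x : P) (h : (x <= x)%O), cmap h = \1%VF;
  cmap_comp : forall (x y z : P) (h : (x <= y)%O) (h' : (y <= z)%O)
    (h'' : (x <= z)%O), cmap h'' = (cmap h' \o cmap h)%VF }.

Definition rep_of_coord (C : coord_rep) : rep k P :=
  @Rep k d P (fun x => 'rV[k]_(cdim C x) : vectType k) (@cmap C)
    (@cmap_id C) (@cmap_comp C).

Import VectorInternalTheory.

Lemma v2rK_lfun (V : vectType k) :
  (linfun (@r2v k V) \o linfun (@v2r k V))%VF = \1%VF.
Proof. by apply/lfunP => u; rewrite comp_lfunE !lfunE /= v2rK. Qed.

Lemma r2vK_lfun (V : vectType k) :
  (linfun (@v2r k V) \o linfun (@r2v k V))%VF = \1%VF.
Proof. by apply/lfunP => u; rewrite comp_lfunE !lfunE /= r2vK. Qed.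

Lemma exists_coord (M : rep k P) : exists C, iso M (rep_of_coord C).
Proof.
pose v x := linfun (@v2r k (M x)); pose r x := linfun (@r2v k (M x)).
have vK x : (r x \o v x)%VF = \1%VF by apply: v2rK_lfun.
have rK x : (v x \o r x)%VF = \1%VF by apply: r2vK_lfun.
have id_C (x : P) (h : (x <= x)%O) :
    (v x \o rmap M h \o r x)%VF = \1%VF.
  by rewrite rmap_id comp_lfun1r rK.
have comp_C (x y z : P) (h : (x <= y)%O) (h' : (y <= z)%O) (h'' : (x <= z)%O) :
    (v z \o rmap M h'' \o r x)%VF =
    ((v z \o rmap M h' \o r y) \o (v y \o rmap M h \o r x))%VF.
  rewrite (rmap_comp _ h h' h'') -!comp_lfunA.
  by rewrite (comp_lfunA (r y)) vK comp_lfun1l.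
pose C := CoordRep id_C comp_C; exists C.
have v_nat (x y : P) (h : (x <= y)%O) :
    (v y \o rmap M h)%VF = (rmap (rep_of_coord C) h \o v x)%VF.
  by rewrite /= -!comp_lfunA vK comp_lfun1r.
have r_nat (x y : P) (h : (x <= y)%O) :
    (r y \o rmap (rep_of_coord C) h)%VF = (rmap M h \o r x)%VF.
  by rewrite /= !comp_lfunA vK comp_lfun1l.
exists (@Hom _ _ _ M (rep_of_coord C) v v_nat).
exists (@Hom _ _ _ (rep_of_coord C) M r r_nat).
by split; apply: hom_ext => x /=; rewrite ?vK ?rK.
Qed.

Definition coord (M : rep k P) : coord_rep := projT1 (cid (exists_coord M)).

Definition coord_iso_rel : rel {classic coord_rep} :=
  fun C D => `[< iso (rep_of_coord C) (rep_of_coord D) >].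

Lemma coord_iso_rel_equiv : equiv_class_of coord_iso_rel.
Proof.
split=> [C|C D|C D E].
- exact/asboolP/iso_refl.
- by apply/asboolP/asboolP; apply: iso_sym.
- by move=> /asboolP h /asboolP h'; apply/asboolP/(iso_trans h h').
Qed.
Canonical coord_iso_equiv := EquivRelPack coord_iso_rel_equiv.
Canonical coord_iso_encModRel := defaultEncModRel coord_iso_rel.

Definition isoclass := {eq_quot coord_iso_rel}.
HB.instance Definition _ := Choice.on isoclass.
HB.instance Definition _ := EqQuotient.on isoclass.

Definition isoclass_of (M : rep k P) : isoclass :=
  \pi_isoclass (coord M : {classic coord_rep}).

Lemma isoclassP (M N : rep k P) :
  isoclass_of M = isoclass_of N <-> iso M N.
Proof.
have cM := projT2 (cid (exists_coord M)).
have cN := projT2 (cid (exists_coord N)).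
split=> [/eqmodP/asboolP h|h]; last first.
  apply/eqmodP/asboolP.
  exact: iso_trans (iso_sym cM) (iso_trans h cN).
exact: iso_trans (iso_trans cM h) (iso_sym cN).
Qed.

(* The subgroup of the free abelian group on isomorphism classes generated by
   the elements [M (+) N] - [M] - [N]. *)
Definition split_relation (x : {freeg isoclass / int}) : Prop :=
  forall H : {freeg isoclass / int} -> Prop,
    H 0 -> (forall u v, H u -> H v -> H (u - v)) ->
    (forall M N : rep k P, H (<< isoclass_of (dsum M N) >>
       - << isoclass_of M >> - << isoclass_of N >>)) ->
    H x.

Definition split_relations : {pred {freeg isoclass / int}} :=
  fun x => `[< split_relation x >].

Lemma split_relations_closed : zmod_closed split_relations.
Proof.
split=> [|u v /asboolP hu /asboolP hv]; apply/asboolP => H H0 HB Hs //.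
move: (hu H H0 HB Hs) (hv H H0 HB Hs); exact: HB.
Qed.
HB.instance Definition _ :=
  GRing.isZmodClosed.Build {freeg isoclass / int} split_relations
    split_relations_closed.

Definition K0sp := Quotient.quot split_relations.
HB.instance Definition _ := GRing.Zmodule.on K0sp.

Definition K0class (M : rep k P) : K0sp :=
  \pi_(Quotient.quot split_relations) << isoclass_of M >>.

Definition finer (A B : zmodType) (f : {additive K0sp -> A})
    (g : {additive K0sp -> B}) : Prop :=
  forall x, f x = 0 -> g x = 0.

Definition incomparable (A B : zmodType) (f : {additive K0sp -> A})
    (g : {additive K0sp -> B}) : Prop :=
  ~ finer f g /\ ~ finer g f.

(* The homomorphism on the split Grothendieck group determined by its values
   on the classes [M].  It exists when v is invariant under isomorphism and
   additive on direct sums (K0liftE), and is then unique (K0hom_ext);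
   otherwise the zero homomorphism is returned. *)
Definition K0lift (A : zmodType) (v : rep k P -> A) : {additive K0sp -> A} :=
  the (\0 : {additive K0sp -> A})
      (fun f : {additive K0sp -> A} => forall M, f (K0class M) = v M).

Lemma K0class_dsum (M N : rep k P) :
  K0class (dsum M N) = K0class M + K0class N.
Proof.
rewrite /K0class -[RHS](raddfD (\pi_(Quotient.quot split_relations))).
apply/eqP; rewrite -Quotient.idealrBE; apply/asboolP => H _ _.
by rewrite opprD addrA.
Qed.

Local Notation F := {freeg isoclass / int}.
Local Notation pi := (\pi_(Quotient.quot split_relations)).

Lemma isoclass_of_repr (c : isoclass) : isoclass_of (rep_of_coord (repr c)) = c.
Proof.
rewrite -[RHS]reprK; apply/eqmodP/asboolP; apply: iso_sym.
exact: (projT2 (cid (exists_coord _))).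
Qed.

Lemma K0hom_ext (A : zmodType) (f g : {additive K0sp -> A}) :
  (forall M, f (K0class M) = g (K0class M)) -> f =1 g.
Proof.
move=> fg x; rewrite -[x]reprK -(freeg_sumE (repr x)) !raddf_sum /=.
apply: eq_bigr => c _.
have -> : << coeff c (repr x) *g c >> = (<< c >> : F) *~ coeff c (repr x).
  by rewrite freegU_mulz intz.
rewrite !raddfMz; congr (_ *~ _); rewrite -(isoclass_of_repr c); exact: fg.
Qed.

Section Lift.
Variables (A : zmodType) (v : rep k P -> A)
  (v_iso : forall M N, iso M N -> v M = v N)
  (v_add : forall M N, v (dsum M N) = v M + v N).

Let lift_free : F -> A :=
  fglift (fun c : isoclass => v (rep_of_coord (repr c)) : zmodule A).

Let lift_freeB x y : lift_free (x - y) = lift_free x - lift_free y.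
Proof.
pose w := (fun c : isoclass => v (rep_of_coord (repr c)) : zmodule A).
exact: (@lift_is_additive _ _ _ w).
Qed.

Let lift_free_class M : lift_free << isoclass_of M >> = v M.
Proof.
rewrite /lift_free liftU scale1r; apply: v_iso.
by apply/isoclassP; rewrite isoclass_of_repr.
Qed.

Let lift_free_rel x : x \in split_relations -> lift_free x = 0.
Proof.
move/asboolP => h; apply: (h (fun y => lift_free y = 0)) => [|y z hy hz|M N].
- by have := lift_freeB 0 0; rewrite !subrr.
- by rewrite lift_freeB hy hz subrr.
- by rewrite !lift_freeB !lift_free_class v_add -addrA -opprD subrr.
Qed.

Let lift_K0 : K0sp -> A := fun x => lift_free (repr x).

Let lift_K0pi y : lift_K0 (pi y) = lift_free y.
Proof.
apply/eqP; rewrite -subr_eq0 -lift_freeB lift_free_rel //.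
by rewrite Quotient.idealrBE reprK.
Qed.

Let lift_K0B : zmod_morphism lift_K0.
Proof.
move=> x y; rewrite -[x]reprK -[y]reprK -raddfB !lift_K0pi.
exact: lift_freeB.
Qed.

Lemma K0liftE M : K0lift v (K0class M) = v M.
Proof.
rewrite /K0lift; move: M.
apply: (@theP _ _ (fun f : {additive K0sp -> A} => forall M, f (K0class M) = v M)).
pose m := GRing.isZmodMorphism.Build _ _ lift_K0 lift_K0B.
pose g : {additive K0sp -> A} := HB.pack lift_K0 m.
by exists g => M; rewrite /= lift_K0pi lift_free_class.
Qed.
End Lift.
End GrothendieckGroup.

Section Invariants.
Variables (k : fieldType) (d : Order.disp_t) (P : finPOrderType d).

Definition piInt : {additive K0sp k P -> {ffun Int P -> int}} :=
  K0lift (fun M => [ffun I => (multiplicity M I)%:Z]).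

Definition dgmInt : {additive K0sp k P -> {ffun Int P -> int}} :=
  K0lift (@generalized_diagram k d P).

Definition betaInt (i : nat) : {additive K0sp k P -> {ffun Int P -> int}} :=
  K0lift (@betti k d P i).

Definition chiInt : {additive K0sp k P -> {ffun Int P -> int}} :=
  K0lift (@euler k d P).

End Invariants.

Section Posets.

(* The element i of 'I_4 stands for the point i.+1 of {1, 2, 3, 4}. *)
Definition edge (s : seq (nat * nat)) : rel 'I_4 :=
  fun i j => (i.+1, j.+1) \in s.

Lemma connect_edge_anti (s : seq (nat * nat)) (h : nat -> nat) :
  all (fun e => h e.1 < h e.2)%N s -> antisymmetric (connect (edge s)).
Proof.
move=> /allP hs.
have up x y : connect (edge s) x y -> x = y \/ (h x.+1 < h y.+1)%N.
  move=> /connectP[p + ->]; elim: p x => [|z p ih] x /=; first by left.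
  move=> /andP[/hs /= xz /ih [<-|zy]]; right => //.
  exact: ltn_trans xz zy.
move=> x y /andP[/up[//|xy] /up[//|yx]].
by have := ltn_trans xy yx; rewrite ltnn.
Qed.

Definition D12_edges : seq (nat * nat) := [:: (1, 3); (3, 2); (3, 4)]%N.
Definition D03_edges : seq (nat * nat) := [:: (3, 1); (3, 2); (3, 4)]%N.

Definition D12 := 'I_4.
HB.instance Definition _ := Finite.on D12.
Definition D12_le : rel D12 := connect (edge D12_edges).
Lemma D12_anti : antisymmetric D12_le.
Proof. by apply: (@connect_edge_anti _ (nth 0 [:: 0; 0; 2; 1; 2])%N). Qed.
Fact D12_display : Order.disp_t. Proof. exact: Order.Disp tt tt. Qed.
HB.instance Definition _ := Order.Le_isPOrder.Build D12_display D12
  (@connect0 _ (edge D12_edges)) D12_anti (@connect_trans _ (edge D12_edges)).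

Definition D03 := 'I_4.
HB.instance Definition _ := Finite.on D03.
Definition D03_le : rel D03 := connect (edge D03_edges).
Lemma D03_anti : antisymmetric D03_le.
Proof. by apply: (@connect_edge_anti _ (nth 0 [:: 0; 1; 1; 0; 1])%N). Qed.
Fact D03_display : Order.disp_t. Proof. exact: Order.Disp tt tt. Qed.
HB.instance Definition _ := Order.Le_isPOrder.Build D03_display D03
  (@connect0 _ (edge D03_edges)) D03_anti (@connect_trans _ (edge D03_edges)).

Definition convex_embedded (dQ d : Order.disp_t) (Q : finPOrderType dQ)
    (P : finPOrderType d) : Prop :=
  exists f : Q -> P,
    (forall x y : Q, (f x <= f y)%O = (x <= y)%O) /\ convex (f @: [set: Q]).

End Posets.

(* Main.v *)
(*
All four invariants send [k_I] to the indicator function of I.  Hence, if two of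
them, f and g, differ on some class [M], then [M] - sum_I f([M])(I) [k_I] lies in
the kernel of f but not in that of g, and symmetrically, so f and g are
incomparable.

Minimal interval resolutions are finite: a summand k_J of a cover of M embeds
in M, since otherwise it could be replaced by its image, which is interval
decomposable.  Following a point x of J through the resolution therefore gives
a chain of nonzero non-isomorphisms between interval representations whose
composite is nonzero at x, and such a chain repeats no interval.  As covers are
surjective, chi then determines the dimension vector.  For M indecomposable and
not an interval representation, pi vanishes on M while dgm, chi and beta_0 do
not, and chi = beta_0 would force the cover of M to be an isomorphism.

For (i) and (ii), M is the indecomposable with dimension 2 at the central
vertex c of the star and 1 at the leaves, extended by zero.  The simple
representation at c does not embed in M, hence in no term of its minimal
interval resolution, so chi and beta_0 vanish at {c}; but dgm is 1 or -1 there.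
*)
From HB Require Import structures.
From mathcomp.classical Require Import boolp classical_sets fsbigop.
From mathcomp Require Import all_boot all_order all_algebra.
Require Import Defs.

Set Implicit Arguments.
Unset Strict Implicit.
Unset Printing Implicit Defensive.

Import Order.TTheory GRing.Theory.

Local Open Scope ring_scope.


(** * Morphisms of representations *)

(** Multiplicities, covers, ranks and diagrams are all picked by choice, so invariance under
    isomorphism and additivity have to be established before [K0liftE] applies. For multiplicities
    no uniqueness of decompositions is invoked: as End(k_I) = k, the multiplicity of k_I in M is the
    rank of the composition pairing between Hom(k_I, M) and Hom(M, k_I). For Betti numbers it is
    enough that a direct sum of covers is a cover. Ranks are handled as maxima over factorisations
    through cones and cocones. The obstacle with resolutions is that composites of nonzero maps
    between interval representations may vanish. Fixing a point x removes it: a map k_I -> k_J is a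
    scalar at x, and scalars multiply under composition. Being linked by a map that is nonzero at x
    is then a partial order on the intervals through x. Its finiteness gives both the nilpotency
    behind the existence of covers and the termination of resolutions. *)

Section HomAlgebra.
Variables (k : fieldType) (d : Order.disp_t) (P : finPOrderType d).
Implicit Types L M N : rep k P.

HB.instance Definition _ M N := gen_eqMixin (hom M N).
HB.instance Definition _ M N := gen_choiceMixin (hom M N).

Lemma addhom_natural M N (f g : hom M N) (x y : P) (h : (x <= y)%O) :
  ((f y + g y) \o rmap M h)%VF = (rmap N h \o (f x + g x))%VF.
Proof. by rewrite comp_lfunDl comp_lfunDr !hom_natural. Qed.
Definition addhom M N (f g : hom M N) : hom M N := Hom (addhom_natural f g).

Lemma opphom_natural M N (f : hom M N) (x y : P) (h : (x <= y)%O) :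
  ((- f y) \o rmap M h)%VF = (rmap N h \o (- f x))%VF.
Proof. by rewrite comp_lfunNl comp_lfunNr hom_natural. Qed.
Definition opphom M N (f : hom M N) : hom M N := Hom (opphom_natural f).

Lemma scalehom_natural M N (a : k) (f : hom M N) (x y : P) (h : (x <= y)%O) :
  ((a *: f y) \o rmap M h)%VF = (rmap N h \o (a *: f x))%VF.
Proof. by rewrite -comp_lfunZl -comp_lfunZr hom_natural. Qed.
Definition scalehom M N (a : k) (f : hom M N) : hom M N :=
  Hom (scalehom_natural a f).

Section Zmodule.
Variables M N : rep k P.

Lemma addhomA : associative (@addhom M N).
Proof. by move=> f g h; apply: hom_ext => x; apply: addrA. Qed.
Lemma addhomC : commutative (@addhom M N).
Proof. by move=> f g; apply: hom_ext => x; apply: addrC. Qed.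
Lemma add0hom : left_id (hom0 M N) (@addhom M N).
Proof. by move=> f; apply: hom_ext => x; apply: add0r. Qed.
Lemma addNhom : left_inverse (hom0 M N) (@opphom M N) (@addhom M N).
Proof. by move=> f; apply: hom_ext => x; apply: addNr. Qed.
HB.instance Definition _ :=
  GRing.isZmodule.Build (hom M N) addhomA addhomC add0hom addNhom.

Lemma scalehomA (a b : k) (f : hom M N) :
  scalehom a (scalehom b f) = scalehom (a * b) f.
Proof. by apply: hom_ext => x; apply: scalerA. Qed.
Lemma scale1hom : left_id 1 (@scalehom M N).
Proof. by move=> f; apply: hom_ext => x; apply: scale1r. Qed.
Lemma scalehomDr : right_distributive (@scalehom M N) +%R.
Proof. by move=> a f g; apply: hom_ext => x; apply: scalerDr. Qed.
Lemma scalehomDl (f : hom M N) : {morph (@scalehom M N)^~ f : a b / a + b}.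
Proof. by move=> a b; apply: hom_ext => x; apply: scalerDl. Qed.
HB.instance Definition _ := GRing.Zmodule_isLmodule.Build k (hom M N)
  scalehomA scale1hom scalehomDr scalehomDl.

Definition happ_at (x : P) (f : hom M N) : 'Hom(M x, N x) := f x.
Lemma happ_at_linear x : linear (happ_at x).
Proof. by []. Qed.
HB.instance Definition _ x :=
  GRing.isLinear.Build k (hom M N) 'Hom(M x, N x) _ (happ_at x)
    (happ_at_linear x).

Lemma hom_sumE (T : Type) (r : seq T) (Q : pred T) (F : T -> hom M N) x v :
  (\sum_(t <- r | Q t) F t) x v = \sum_(t <- r | Q t) F t x v.
Proof. by rewrite -[happ _ x]/(happ_at x _) raddf_sum sum_lfunE. Qed.

Lemma homP (f g : hom M N) : (forall x v, f x v = g x v) -> f = g.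
Proof. by move=> fg; apply: hom_ext => x; apply/lfunP => v; apply: fg. Qed.

Lemma hom_addE (f g : hom M N) x v : (f + g) x v = f x v + g x v.
Proof. exact: add_lfunE. Qed.
Lemma hom_oppE (f : hom M N) x v : (- f) x v = - f x v.
Proof. exact: opp_lfunE. Qed.
Lemma hom_subE (f g : hom M N) x v : (f - g) x v = f x v - g x v.
Proof. by rewrite hom_addE hom_oppE. Qed.
Lemma hom_scaleE a (f : hom M N) x v : (a *: f) x v = a *: f x v.
Proof. exact: scale_lfunE. Qed.
Lemma hom_zeroE x v : (0 : hom M N) x v = 0.
Proof. exact: zero_lfunE. Qed.
End Zmodule.

Lemma hom_idE M x v : idhom M x v = v.
Proof. exact: id_lfunE. Qed.
Lemma hom_compE L M N (g : hom M N) (f : hom L M) x v :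
  comphom g f x v = g x (f x v).
Proof. exact: comp_lfunE. Qed.

Lemma comphom_at L M N (g : hom M N) (f : hom L M) h x v :
  comphom g f = h -> g x (f x v) = h x v.
Proof. by move=> <-; rewrite hom_compE. Qed.

Lemma hom_nat M N (f : hom M N) (x y : P) (h : (x <= y)%O) v :
  f y (rmap M h v) = rmap N h (f x v).
Proof. by rewrite -!comp_lfunE hom_natural. Qed.

Definition homE :=
  (hom_addE, hom_oppE, hom_scaleE, hom_zeroE, hom_idE, hom_compE, hom_sumE).

Lemma comphomA L M N N' (h : hom N N') (g : hom M N) (f : hom L M) :
  comphom h (comphom g f) = comphom (comphom h g) f.
Proof. by apply: homP => x v; rewrite !homE. Qed.
Lemma comphom1l L M (f : hom L M) : comphom (idhom M) f = f.
Proof. by apply: homP => x v; rewrite !homE. Qed.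
Lemma comphom1r L M (f : hom L M) : comphom f (idhom L) = f.
Proof. by apply: homP => x v; rewrite !homE. Qed.
Lemma comphom0l L M N (f : hom L M) : comphom (0 : hom M N) f = 0.
Proof. by apply: homP => x v; rewrite !homE. Qed.
Lemma comphom0r L M N (g : hom M N) : comphom g (0 : hom L M) = 0.
Proof. by apply: homP => x v; rewrite !homE linear0. Qed.
Lemma comphomDl L M N (f g : hom M N) (h : hom L M) :
  comphom (f + g) h = comphom f h + comphom g h.
Proof. by apply: homP => x v; rewrite !homE. Qed.
Lemma comphomDr L M N (h : hom M N) (f g : hom L M) :
  comphom h (f + g) = comphom h f + comphom h g.
Proof. by apply: homP => x v; rewrite !homE linearD. Qed.
Lemma comphomNl L M N (f : hom M N) (h : hom L M) :
  comphom (- f) h = - comphom f h.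
Proof. by apply: homP => x v; rewrite !homE. Qed.
Lemma comphomNr L M N (h : hom M N) (f : hom L M) :
  comphom h (- f) = - comphom h f.
Proof. by apply: homP => x v; rewrite !homE linearN. Qed.
Lemma comphomBl L M N (f g : hom M N) (h : hom L M) :
  comphom (f - g) h = comphom f h - comphom g h.
Proof. by rewrite comphomDl comphomNl. Qed.
Lemma comphomBr L M N (h : hom M N) (f g : hom L M) :
  comphom h (f - g) = comphom h f - comphom h g.
Proof. by rewrite comphomDr comphomNr. Qed.
Lemma comphomZl L M N a (g : hom M N) (f : hom L M) :
  comphom (a *: g) f = a *: comphom g f.
Proof. by apply: homP => x v; rewrite !homE. Qed.
Lemma comphomZr L M N a (g : hom M N) (f : hom L M) :
  comphom g (a *: f) = a *: comphom g f.
Proof. by apply: homP => x v; rewrite !homE linearZ. Qed.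
Lemma comphom_suml L M N (T : Type) (r : seq T) (Q : pred T)
    (F : T -> hom M N) (h : hom L M) :
  comphom (\sum_(t <- r | Q t) F t) h = \sum_(t <- r | Q t) comphom (F t) h.
Proof.
by apply: homP => x v; rewrite !homE; apply: eq_bigr => t _; rewrite homE.
Qed.
Lemma comphom_sumr L M N (T : Type) (r : seq T) (Q : pred T)
    (F : T -> hom L M) (h : hom M N) :
  comphom h (\sum_(t <- r | Q t) F t) = \sum_(t <- r | Q t) comphom h (F t).
Proof.
apply: homP => x v; rewrite !homE linear_sum.
by apply: eq_bigr => t _; rewrite homE.
Qed.

Lemma iso_of_comps M N (f : hom M N) (g : hom N M) :
  is_iso (comphom g f) -> is_iso (comphom f g) -> is_iso f.
Proof.
move=> [a [agf _]] [b [_ fgb]]; exists (comphom a g).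
have e : comphom a g = comphom g b.
  rewrite -[LHS]comphom1r -fgb -[comphom f g]comphom1l.
  by rewrite comphom1l !comphomA -(comphomA a g f) agf comphom1l.
by split; [rewrite -comphomA | rewrite e comphomA].
Qed.

(* Locked, so that unification never identifies it with another linfun. *)
Fact lfun_key : unit. Proof. by []. Qed.
Definition lfun_of (V W : vectType k) (f : V -> W) (lin : linear f) :
    'Hom(V, W) :=
  locked_with lfun_key
    (linfun (HB.pack f (GRing.isLinear.Build k V W _ f lin) : {linear V -> W})).

Lemma lfun_ofE (V W : vectType k) (f : V -> W) (lin : linear f) v :
  lfun_of lin v = f v.
Proof. by rewrite /lfun_of locked_withE lfunE. Qed.

Lemma lfunD (V W : vectType k) (f : 'Hom(V, W)) u v : f (u + v) = f u + f v.
Proof. exact: linearD. Qed.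
Lemma lfunN (V W : vectType k) (f : 'Hom(V, W)) u : f (- u) = - f u.
Proof. exact: linearN. Qed.
Lemma lfunZ (V W : vectType k) (f : 'Hom(V, W)) a v : f (a *: v) = a *: f v.
Proof. exact: linearZ. Qed.
Lemma lfun0 (V W : vectType k) (f : 'Hom(V, W)) : f 0 = 0.
Proof. exact: linear0. Qed.
Lemma lfun_sum (V W : vectType k) (f : 'Hom(V, W)) (T : Type) (r : seq T)
    (Q : pred T) (F : T -> V) :
  f (\sum_(t <- r | Q t) F t) = \sum_(t <- r | Q t) f (F t).
Proof. exact: linear_sum. Qed.

Section Biproduct.
Variables M N : rep k P.

Lemma dsumE (x y : P) (h : (x <= y)%O) (v : dsum M N x) :
  rmap (dsum M N) h v = (rmap M h v.1, rmap N h v.2).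
Proof. by rewrite lfunE. Qed.

Lemma in1_linear (V W : vectType k) : linear (fun v : V => (v, 0 : W)).
Proof. by move=> a u v; congr pair; rewrite /= scaler0 addr0. Qed.
Lemma in2_linear (V W : vectType k) : linear (fun v : W => (0 : V, v)).
Proof. by move=> a u v; congr pair; rewrite /= scaler0 addr0. Qed.
Lemma pr1_linear (V W : vectType k) : linear (fun v : V * W => v.1).
Proof. by []. Qed.
Lemma pr2_linear (V W : vectType k) : linear (fun v : V * W => v.2).
Proof. by []. Qed.

Definition in1_at x : 'Hom(M x, dsum M N x) := lfun_of (@in1_linear (M x) (N x)).
Definition in2_at x : 'Hom(N x, dsum M N x) := lfun_of (@in2_linear (M x) (N x)).
Definition pr1_at x : 'Hom(dsum M N x, M x) := lfun_of (@pr1_linear (M x) (N x)).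
Definition pr2_at x : 'Hom(dsum M N x, N x) := lfun_of (@pr2_linear (M x) (N x)).
Lemma in1_atE x v : in1_at x v = (v, 0). Proof. exact: lfun_ofE. Qed.
Lemma in2_atE x v : in2_at x v = (0, v). Proof. exact: lfun_ofE. Qed.
Lemma pr1_atE x v : pr1_at x v = v.1. Proof. exact: lfun_ofE. Qed.
Lemma pr2_atE x v : pr2_at x v = v.2. Proof. exact: lfun_ofE. Qed.

Lemma in1_natural (x y : P) (h : (x <= y)%O) :
  (in1_at y \o rmap M h)%VF = (rmap (dsum M N) h \o in1_at x)%VF.
Proof.
by apply/lfunP => v; rewrite !comp_lfunE dsumE !in1_atE /= linear0.
Qed.
Lemma in2_natural (x y : P) (h : (x <= y)%O) :
  (in2_at y \o rmap N h)%VF = (rmap (dsum M N) h \o in2_at x)%VF.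
Proof.
by apply/lfunP => v; rewrite !comp_lfunE dsumE !in2_atE /= linear0.
Qed.
Lemma pr1_natural (x y : P) (h : (x <= y)%O) :
  (pr1_at y \o rmap (dsum M N) h)%VF = (rmap M h \o pr1_at x)%VF.
Proof. by apply/lfunP => v; rewrite !comp_lfunE !pr1_atE dsumE. Qed.
Lemma pr2_natural (x y : P) (h : (x <= y)%O) :
  (pr2_at y \o rmap (dsum M N) h)%VF = (rmap N h \o pr2_at x)%VF.
Proof. by apply/lfunP => v; rewrite !comp_lfunE !pr2_atE dsumE. Qed.

Definition in1 : hom M (dsum M N) := Hom in1_natural.
Definition in2 : hom N (dsum M N) := Hom in2_natural.
Definition pr1 : hom (dsum M N) M := Hom pr1_natural.
Definition pr2 : hom (dsum M N) N := Hom pr2_natural.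

Lemma in1E x v : in1 x v = (v, 0). Proof. exact: lfun_ofE. Qed.
Lemma in2E x v : in2 x v = (0, v). Proof. exact: lfun_ofE. Qed.
Lemma pr1E x v : pr1 x v = v.1. Proof. exact: lfun_ofE. Qed.
Lemma pr2E x v : pr2 x v = v.2. Proof. exact: lfun_ofE. Qed.

Lemma pr1_in1 : comphom pr1 in1 = idhom M.
Proof. by apply: homP => x v; rewrite !homE pr1E in1E. Qed.
Lemma pr2_in2 : comphom pr2 in2 = idhom N.
Proof. by apply: homP => x v; rewrite !homE pr2E in2E. Qed.
Lemma pr1_in2 : comphom pr1 in2 = 0.
Proof. by apply: homP => x v; rewrite !homE pr1E in2E. Qed.
Lemma pr2_in1 : comphom pr2 in1 = 0.
Proof. by apply: homP => x v; rewrite !homE pr2E in1E. Qed.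
Lemma in_pr : comphom in1 pr1 + comphom in2 pr2 = idhom (dsum M N).
Proof.
apply: homP => x [u v]; rewrite !homE pr1E pr2E in1E in2E /=.
by congr pair; rewrite /= ?addr0 ?add0r.
Qed.

Lemma pr1_pair L (f : hom L M) (g : hom L N) :
  comphom pr1 (comphom in1 f + comphom in2 g) = f.
Proof.
by rewrite comphomDr !comphomA pr1_in1 pr1_in2 comphom1l comphom0l addr0.
Qed.
Lemma pr2_pair L (f : hom L M) (g : hom L N) :
  comphom pr2 (comphom in1 f + comphom in2 g) = g.
Proof.
by rewrite comphomDr !comphomA pr2_in1 pr2_in2 comphom1l comphom0l add0r.
Qed.
End Biproduct.

Definition dsum_hom L L' M M' (f : hom L M) (g : hom L' M') :
    hom (dsum L L') (dsum M M') :=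
  comphom (in1 M M') (comphom f (pr1 L L')) +
  comphom (in2 M M') (comphom g (pr2 L L')).

Lemma dsum_homE L L' M M' (f : hom L M) (g : hom L' M') x v :
  dsum_hom f g x v = (f x v.1, g x v.2).
Proof.
rewrite !homE in1E in2E pr1E pr2E; congr pair; rewrite /= ?addr0 ?add0r //.
Qed.

Lemma dsum_hom_iso L L' M M' (f : hom L M) (g : hom L' M') :
  is_iso f -> is_iso g -> is_iso (dsum_hom f g).
Proof.
move=> [f' [f'f ff']] [g' [g'g gg']]; exists (dsum_hom f' g').
split; apply: homP => x [u v]; rewrite hom_compE !dsum_homE /=.
- by rewrite (comphom_at _ f'f) (comphom_at _ g'g) !hom_idE !id_lfunE.
- by rewrite (comphom_at _ ff') (comphom_at _ gg') !hom_idE !id_lfunE.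
Qed.

Lemma lker0_dim (V W : vectType k) (f : 'Hom(V, W)) :
  lker f == 0%VS -> (\dim {: V} <= \dim {: W})%N.
Proof.
move/eqP=> f0; rewrite -(@limg_dim_eq _ _ _ f fullv) ?f0 ?capv0 //.
exact/dimvS/subvf.
Qed.

Lemma iso_dim M N x : iso M N -> \dim {: M x} = \dim {: N x}.
Proof.
move=> [f [g [gf fg]]].
have inj (A B : rep k P) (a : hom A B) (b : hom B A) : comphom b a = idhom A ->
    (\dim {: A x} <= \dim {: B x})%N.
  move=> ba; apply: (@lker0_dim _ _ (a x)); apply/lker0P => u v e.
  by rewrite -[u]hom_idE -[v]hom_idE -ba !homE e.
by apply/eqP; rewrite eqn_leq (inj _ _ f g) // (inj _ _ g f).
Qed.
End HomAlgebra.

(** * Morphisms from interval representations *)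

Section IntervalHoms.
Variables (k : fieldType) (d : Order.disp_t) (P : finPOrderType d).
Implicit Types (M N : rep k P) (I J : Int P).
Local Notation K := (interval_rep k).

(** The space of k_I at x has dimension 0 or 1 according to a boolean. Summing coordinates reads off
    the scalar in both cases alike, and [row_sumK] recovers the vector, so later arguments need no
    case analysis on a dependent dimension. *)
Definition row_sum (b : bool) (v : 'rV[k]_b) : k := \sum_j v ord0 j.

Lemma row_sum_linear (b : bool) : linear (@row_sum b : 'rV[k]_b -> k^o).
Proof.
move=> a u v; rewrite /row_sum scaler_sumr -big_split.
by apply: eq_bigr => j _; rewrite !mxE.
Qed.

Lemma row_sum_const (b : bool) : row_sum (const_mx 1 : 'rV[k]_b) = b%:R.
Proof.
case: b; rewrite /row_sum; first by rewrite big_ord1 mxE.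
by rewrite big_ord0.
Qed.

Lemma row_sumK (b : bool) (v : 'rV[k]_b) : v = row_sum v *: const_mx 1.
Proof.
case: b v => v; apply/matrixP => i j; last by case: j.
by rewrite !mxE /row_sum big_ord1 !ord1 mulr1.
Qed.

Definition one I x : K I x := const_mx 1 : 'rV[k]_(x \in val I).

Definition coef I x (v : K I x) : k := row_sum v.

Lemma coef_one I x : coef (one I x) = (x \in val I)%:R.
Proof. exact: row_sum_const. Qed.

Lemma coefK I x (v : K I x) : v = coef v *: one I x.
Proof. exact: row_sumK. Qed.

Lemma coefD I x (u v : K I x) : coef (u + v) = coef u + coef v.
Proof. by have := row_sum_linear 1 u v; rewrite !scale1r. Qed.

Lemma coefZ I x a (v : K I x) : coef (a *: v) = a * coef v.
Proof.
have := row_sum_linear a v 0; rewrite !addr0 => e.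
rewrite /coef e -[RHS]addr0; congr (_ + _).
by rewrite /row_sum big1 // => j _; rewrite mxE.
Qed.

Lemma coef0 I x : coef (0 : K I x) = 0.
Proof. by rewrite -(scale0r (one I x)) coefZ mul0r. Qed.

Lemma one_notin I x : x \notin val I -> one I x = 0.
Proof.
rewrite /one /=; case: (x \in val I) => // _.
by apply/matrixP => i j; case: j.
Qed.

Lemma one_neq0 I x : x \in val I -> one I x != 0.
Proof.
move=> xI; apply/eqP => /(congr1 (@coef I x)).
by rewrite coef_one xI coef0; apply/eqP/oner_neq0.
Qed.

Lemma rmap_one I (x y : P) (h : (x <= y)%O) :
  x \in val I -> rmap (K I) h (one I x) = one I y.
Proof.
move=> xI; rewrite [LHS]lfunE.
by apply: (@const_mx1M k true (x \in val I) (y \in val I)).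
Qed.

Lemma rmapZ M (x y : P) (h : (x <= y)%O) a v :
  rmap M h (a *: v) = a *: rmap M h v.
Proof. exact: linearZ. Qed.

Section FromInterval.
Variables (I : Int P) (M : rep k P) (w : forall x, M x).
Hypotheses (w_out : forall x, x \notin val I -> w x = 0)
  (w_nat : forall (x y : P) (h : (x <= y)%O), x \in val I ->
    rmap M h (w x) = w y).

Lemma int_hom_linear x : linear (fun v : K I x => coef v *: w x).
Proof. by move=> a u v; rewrite coefD coefZ scalerDl scalerA. Qed.

Definition int_hom_at x : 'Hom(K I x, M x) := lfun_of (@int_hom_linear x).

Lemma int_hom_natural (x y : P) (h : (x <= y)%O) :
  (int_hom_at y \o rmap (K I) h)%VF = (rmap M h \o int_hom_at x)%VF.
Proof.
apply/lfunP => v; rewrite !comp_lfunE !lfun_ofE.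
have [xI|xI] := boolP (x \in val I).
  rewrite [v in LHS]coefK linearZ /= rmap_one // coefZ coef_one linearZ /=.
  rewrite w_nat //; have [yI|/w_out->] := boolP (y \in val I).
    by rewrite mulr1.
  by rewrite !scaler0.
by rewrite [v]coefK one_notin // scaler0 linear0 !coef0 !scale0r linear0.
Qed.

(** Maps out of k_I are the families w supported in I and compatible with the structure maps that
    start in I. The target y in [w_nat] ranges over all of P, so w x must die when the path leaves
    I. *)
Definition int_hom : hom (K I) M := Hom int_hom_natural.

Lemma int_homE x : int_hom x (one I x) = w x.
Proof.
rewrite [LHS]lfun_ofE coef_one.
by have [_|/w_out->] := boolP (x \in val I); rewrite ?scale1r ?scaler0.
Qed.
End FromInterval.

Lemma hom_coef I M (f : hom (K I) M) x v : f x v = coef v *: f x (one I x).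
Proof. by rewrite {1}[v]coefK linearZ. Qed.

Lemma int_hom_ext I M (f g : hom (K I) M) :
  (forall x, x \in val I -> f x (one I x) = g x (one I x)) -> f = g.
Proof.
move=> fg; apply: homP => x v; rewrite !(hom_coef _ v).
have [/fg->//|xI] := boolP (x \in val I).
by rewrite one_notin // !linear0.
Qed.

Lemma hom_one_out I M (f : hom (K I) M) x : x \notin val I -> f x (one I x) = 0.
Proof. by move=> xI; rewrite one_notin // linear0. Qed.

Lemma hom_one_nat I M (f : hom (K I) M) (x y : P) (h : (x <= y)%O) :
  x \in val I -> rmap M h (f x (one I x)) = f y (one I y).
Proof. by move=> xI; rewrite -hom_nat rmap_one. Qed.

(** The scalar by which a map k_I -> k_J acts at x, zero unless x lies in both intervals.
    Composition becomes multiplication of scalars at each point ([hcoef_comp]). *)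
Definition hcoef I J (f : hom (K I) (K J)) x : k := coef (f x (one I x)).

Lemma hcoefE I J (f : hom (K I) (K J)) x : f x (one I x) = hcoef f x *: one J x.
Proof. by rewrite {1}[f x _]coefK. Qed.

Lemma hcoef_outl I J (f : hom (K I) (K J)) x : x \notin val I -> hcoef f x = 0.
Proof.
by move=> xI; rewrite /hcoef hom_one_out // coef0.
Qed.

Lemma hcoef_outr I J (f : hom (K I) (K J)) x : x \notin val J -> hcoef f x = 0.
Proof.
by move=> xJ; rewrite /hcoef [f x _]coefK coefZ coef_one (negbTE xJ) mulr0.
Qed.

Lemma hcoef_neq0 I J (f : hom (K I) (K J)) x :
  hcoef f x != 0 -> x \in val I /\ x \in val J.
Proof.
move=> fx; split; apply: contraNT fx => ?; first by rewrite hcoef_outl.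
by rewrite hcoef_outr.
Qed.

Lemma hcoef_ext I J (f g : hom (K I) (K J)) :
  (forall x, x \in val I -> hcoef f x = hcoef g x) -> f = g.
Proof. by move=> fg; apply: int_hom_ext => x xI; rewrite !hcoefE fg. Qed.

Lemma hcoef0 I J x : hcoef (0 : hom (K I) (K J)) x = 0.
Proof. by rewrite /hcoef hom_zeroE coef0. Qed.

Lemma hcoefD I J (f g : hom (K I) (K J)) x :
  hcoef (f + g) x = hcoef f x + hcoef g x.
Proof. by rewrite /hcoef hom_addE coefD. Qed.

Lemma hcoef_sum I J (T : Type) (r : seq T) (Q : pred T)
    (F : T -> hom (K I) (K J)) x :
  hcoef (\sum_(t <- r | Q t) F t) x = \sum_(t <- r | Q t) hcoef (F t) x.
Proof.
by elim/big_rec2: _ => [|t a b _ e]; rewrite ?hcoef0 // hcoefD e.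
Qed.

Lemma hcoefZ I J a (f : hom (K I) (K J)) x : hcoef (a *: f) x = a * hcoef f x.
Proof. by rewrite /hcoef hom_scaleE coefZ. Qed.

Lemma hcoef_comp I J L (g : hom (K J) (K L)) (f : hom (K I) (K J)) x :
  hcoef (comphom g f) x = hcoef g x * hcoef f x.
Proof.
rewrite {1}/hcoef hom_compE hcoefE linearZ coefZ mulrC.
have [//|xJ] := boolP (x \in val J).
by rewrite (hcoef_outr f xJ) !mulr0.
Qed.

Lemma hcoef_id I x : hcoef (idhom (K I)) x = (x \in val I)%:R.
Proof. by rewrite /hcoef hom_idE coef_one. Qed.

(** The point y may lie outside I. If it is in J but not in I, the left side is zero, which forces
    the scalar at x to vanish: this is what closes supports in the right direction. *)
Lemma hcoef_nat I J (f : hom (K I) (K J)) (x y : P) : (x <= y)%O ->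
  x \in val I -> hcoef f y = hcoef f x *+ (y \in val J).
Proof.
move=> xy xI; rewrite {1}/hcoef -(hom_one_nat f xy xI) hcoefE rmapZ coefZ.
have [xJ|xJ] := boolP (x \in val J).
  by rewrite rmap_one // coef_one mulr_natr.
by rewrite (hcoef_outr _ xJ) mul0r mul0rn.
Qed.

Lemma int_neq0 I : exists x, x \in val I.
Proof. by case/andP: (valP I) => _ /andP[/set0Pn]. Qed.

Lemma int_connected I (Q : pred P) x0 :
  x0 \in val I -> Q x0 ->
  (forall x y, x \in val I -> y \in val I -> (x >=< y)%O -> Q x -> Q y) ->
  forall x, x \in val I -> Q x.
Proof.
move=> x0I Q0 cl x xI; case/andP: (valP I) => _ /andP[_ /forall_inP/(_ x0 x0I)].
move=> /forall_inP/(_ x xI)/connectP[p + ->].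
elim: p x0 x0I Q0 => [|y p ih] //= a aI Qa /andP[/and3P[_ yI ay] yp].
exact: ih yI (cl _ _ aI yI ay Qa) yp.
Qed.

(** By naturality the scalar of an endomorphism is constant along comparable points, and I is
    connected. Hence every nonzero endomorphism of k_I is invertible. *)
Lemma int_endo I (f : hom (K I) (K I)) : exists a, f = a *: idhom (K I).
Proof.
have [x0 x0I] := int_neq0 I; exists (hcoef f x0); apply: hcoef_ext => x xI.
rewrite hcoefZ hcoef_id xI mulr1; apply/eqP; move: x xI.
apply: (@int_connected I (fun x => hcoef f x == hcoef f x0) x0) => //.
move=> x y xI yI /orP[] xy /eqP<-; last first.
  by rewrite (hcoef_nat f xy yI) xI.
by rewrite (hcoef_nat f xy xI) yI.
Qed.

Lemma idint_neq0 I : idhom (K I) <> 0.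
Proof.
have [x xI] := int_neq0 I; move/(congr1 (fun f : hom (K I) (K I) => hcoef f x)).
by rewrite hcoef_id hcoef0 xI => /eqP; rewrite oner_eq0.
Qed.

(* The support of f is an up-set of J, that of g a down-set of J, and both are
   all of I, so I is a union of components of J. *)
Lemma int_loop I J (f : hom (K I) (K J)) (g : hom (K J) (K I)) :
  comphom g f <> 0 -> I = J.
Proof.
move=> gf0; have [a e] := int_endo (comphom g f).
have a0 : a != 0 by apply: contra_notN gf0 => /eqP a0; rewrite e a0 scale0r.
have supp x : x \in val I -> hcoef g x != 0 /\ hcoef f x != 0.
  move=> xI; apply/andP; rewrite -negb_or -mulf_eq0 -hcoef_comp e hcoefZ.
  by rewrite hcoef_id xI mulr1.
have IJ x : x \in val I -> x \in val J.
  by move=> /supp[_ /hcoef_neq0[]].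
apply: val_inj; apply/eqP; rewrite finset.eqEsubset; apply/andP; split.
  by apply/subsetP.
have [x0 x0I] := int_neq0 I; apply/subsetP => x.
apply: (@int_connected J (fun x => x \in val I) x0) => //; first exact: IJ.
move=> {}x y xJ yJ /orP[] xy xI.
  have [_ fx] := supp x xI.
  have := hcoef_nat f xy xI; rewrite yJ mulr1n => e'.
  by rewrite -e' in fx; case: (hcoef_neq0 fx).
have [gx _] := supp x xI.
have := hcoef_nat g xy yJ; rewrite xI mulr1n => e'.
by rewrite e' in gx; case: (hcoef_neq0 gx).
Qed.

(** Fixing the point x is essential: two nonzero maps may compose to zero, but scalars that are
    nonzero at the same x do not. This makes the relation transitive, and [int_loop] makes it
    antisymmetric, so it orders the intervals through x. *)
Definition int_reach x I J := exists f : hom (K I) (K J), hcoef f x != 0.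

Lemma int_reach_trans x I J L :
  int_reach x I J -> int_reach x J L -> int_reach x I L.
Proof.
move=> [f fx] [g gx]; exists (comphom g f).
by rewrite hcoef_comp mulf_neq0.
Qed.

Lemma int_reach_anti x I J : int_reach x I J -> int_reach x J I -> I = J.
Proof.
move=> [f fx] [g gx]; apply: (@int_loop I J f g).
move/(congr1 (fun h : hom (K I) (K I) => hcoef h x)).
rewrite hcoef_comp hcoef0 => /eqP; rewrite mulf_eq0.
by rewrite (negbTE fx) (negbTE gx).
Qed.

(** The number of intervals strictly beyond I in this order. It drops along every link between
    distinct intervals, and leaving out I itself keeps it strictly below the number of all
    intervals. *)
Definition reach_height x I : nat :=
  #|[set J : Int P | (J != I) && `[< int_reach x I J >]]|.

Lemma reach_height_lt x I J :
  int_reach x I J -> I <> J -> (reach_height x J < reach_height x I)%N.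
Proof.
move=> IJ neq; apply/proper_card/properP; split.
  apply/subsetP => L; rewrite !inE => /andP[LJ /asboolP JL].
  have IL := int_reach_trans IJ JL.
  apply/andP; split; last exact/asboolP.
  by apply: contra_notN neq => /eqP e; rewrite e in JL; apply: int_reach_anti IJ JL.
exists J; rewrite !inE ?eqxx //=.
by apply/andP; split; [apply/eqP => e; apply: neq | apply/asboolP].
Qed.

Lemma reach_height_max x I : (reach_height x I < #|{: Int P}|)%N.
Proof.
rewrite /reach_height -[X in (_ < X)%N]cardsT; apply/proper_card/properP.
by split; [exact/subsetP | exists I; rewrite !inE ?eqxx].
Qed.

End IntervalHoms.

(** * Interval covers *)

Section LinearAlgebra.
Variable k : fieldType.

(** A longest free family of vectors satisfying Q spans all of them, since any further one would
    extend it; lengths are bounded by the dimension. *)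
Lemma vspace_of_pred (V : vectType k) (Q : V -> Prop) :
  Q 0 -> (forall a u v, Q u -> Q v -> Q (a *: u + v)) ->
  exists U : {vspace V}, forall v, v \in U <-> Q v.
Proof.
move=> Q0 Ql.
pose R n := `[< exists2 X : seq V, free X & size X = n /\ forall v, v \in X -> Q v >].
have R0 : exists n, R n.
  by exists 0%N; apply/asboolP; exists [::]; rewrite ?nil_free.
have Rmax n : R n -> (n <= \dim {: V})%N.
  move=> /asboolP[X fX [<- _]]; move: fX; rewrite /free => /eqP<-.
  exact/dimvS/subvf.
case: (ex_maxnP R0 Rmax) => n /asboolP[X fX [sX QX]] maxn.
exists <<X>>%VS => v; split.
  have QX' (i : 'I_(size X)) : Q X`_i by apply/QX/mem_nth.
  move=> /(coord_span (X := in_tuple X)) ->.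
  elim/big_rec: _ => // i u _ Qu; apply: Ql => //; exact: QX'.
move=> Qv; apply: contraT => vX.
suff /maxn : R n.+1 by rewrite ltnn.
apply/asboolP; exists (v :: X); rewrite ?free_cons ?vX //=.
split=> [|u]; first by rewrite sX.
by rewrite inE => /orP[/eqP->//|]; apply: QX.
Qed.

Import VectorInternalTheory.

(** The coordinates of all the spaces V x, indexed by pairs of a point and a coordinate of its
    space, are gathered into one function space. *)
Lemma biproduct_exists (X : finType) (V : X -> vectType k) :
  exists (W : vectType k) (i : forall x, 'Hom(V x, W)) (p : forall x, 'Hom(W, V x)),
    [/\ forall x v, p x (i x v) = v,
        forall x y v, x != y -> p y (i x v) = 0
      & forall w, \sum_x i x (p x w) = w].
Proof.
pose T := {x : X & 'I_(dim (V x))}.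
pose W : vectType k := {ffun T -> k^o}.
pose pf x (w : W) : V x := r2v (\row_(j < dim (V x)) w (Tagged _ j)).
have pl x : linear (pf x).
  move=> a u v; rewrite /pf -linearP; congr r2v.
  by apply/rowP => j; rewrite !mxE !ffunE.
(* The injection compares indices inside the dependent pair and sums over the coordinates, which
   avoids transporting a coordinate along an equality of tags. *)
pose jf x (v : V x) : W :=
  [ffun t : T => \sum_(j < dim (V x)) (t == Tagged _ j)%:R * v2r v ord0 j].
have jl x : linear (jf x).
  move=> a u v; apply/ffunP => t; rewrite !ffunE scaler_sumr -big_split.
  apply: eq_bigr => j _ /=; rewrite linearP !mxE mulrDr; congr (_ + _).
  by rewrite mulrCA.
have jfE x v j : jf x v (Tagged _ j) = v2r v ord0 j.
  rewrite ffunE (bigD1 j) //= eqxx mul1r big1 ?addr0 // => l lj.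
  by rewrite eq_Tagged /= eq_sym (negbTE lj) mul0r.
have jf0 x y v (j : 'I_(dim (V y))) : x != y -> jf x v (Tagged _ j) = 0.
  move=> xy; rewrite ffunE big1 // => l _.
  rewrite (_ : _ == _ = false) ?mul0r //; apply: contraNF xy => /eqP e.
  by rewrite -[x]/(tag (Tagged (fun x => 'I_(dim (V x))) l)) -e.
exists W, (fun x => lfun_of (jl x)), (fun x => lfun_of (pl x)); split.
- move=> x v; rewrite !lfun_ofE /pf -[RHS]v2rK; congr r2v.
  by apply/rowP => j; rewrite mxE jfE.
- move=> x y v xy; rewrite !lfun_ofE /pf -[RHS]v2rK linear0; congr r2v.
  by apply/rowP => j; rewrite !mxE jf0.
- move=> w; apply/ffunP => -[x j]; rewrite sum_ffunE (bigD1 x) //= !lfun_ofE.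
  rewrite jfE r2vK mxE big1 ?addr0 // => y yx.
  by rewrite !lfun_ofE jf0.
Qed.

Lemma product_exists (X : finType) (V : X -> vectType k) :
  exists (W : vectType k) (p : forall x, 'Hom(W, V x)),
    (forall w, (forall x, p x w = 0) -> w = 0) /\
    (forall v : forall x, V x, exists w, forall x, p x w = v x).
Proof.
have [W [i [p [pi1 pi0 ip]]]] := biproduct_exists V.
exists W, p; split=> [w w0|v].
  by rewrite -(ip w) big1 // => x _; rewrite w0 lfun0.
exists (\sum_x i x (v x)) => x; rewrite lfun_sum (bigD1 x) //= pi1.
by rewrite big1 ?addr0 // => y yx; rewrite pi0.
Qed.

(** The quotient is realised inside V as the image of the projection [1 - projv U], whose kernel is
    U; preimages under this projection give the section. *)
Lemma quotient_exists (V : vectType k) (U : {vspace V}) :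
  exists (Q : vectType k) (q : 'Hom(V, Q)) (s : 'Hom(Q, V)),
    lker q = U /\ (q \o s)%VF = \1%VF.
Proof.
pose pr : 'End(V) := (\1 - projv U)%VF.
have prE v : pr v = v - projv U v by rewrite add_lfunE opp_lfunE id_lfunE.
pose Q := limg pr.
pose q := (linfun (vsproj Q) \o pr)%VF.
have qE v : vsval (q v) = pr v.
  by rewrite comp_lfunE lfunE /= vsprojK // memv_img ?memvf.
exists (subvs_of Q), q, (pr^-1 \o linfun (@vsval _ _ Q))%VF; split.
  apply/vspaceP => v; rewrite memv_ker.
  have -> : (q v == 0) = (pr v == 0).
    by rewrite -qE; apply/eqP/eqP => [->|e]; [rewrite linear0|exact/subvs_inj].
  rewrite prE subr_eq0; apply/eqP/idP => [->|vU]; first exact: memv_proj.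
  by rewrite projv_id.
apply/lfunP => u; apply: subvs_inj; rewrite id_lfunE comp_lfunE qE comp_lfunE.
by rewrite [linfun _ u]lfunE limg_lfunVK // subvsP.
Qed.
End LinearAlgebra.

(** * Direct sum decompositions indexed by finite types *)

Section Decompositions.
Variables (k : fieldType) (d : Order.disp_t) (P : finPOrderType d).
Implicit Types (M N C : rep k P) (I : Int P).
Local Notation K := (interval_rep k).

(** Biproducts given by inclusions and projections. Unlike iterated binary sums, this form lets
    summands be reindexed, dropped or compared without associativity isomorphisms. *)
Definition decomposition (T : finType) (X : T -> rep k P) C
    (i : forall t, hom (X t) C) (p : forall t, hom C (X t)) : Prop :=
  [/\ forall t, comphom (p t) (i t) = idhom (X t),
      forall t u, t != u -> comphom (p u) (i t) = 0
    & \sum_t comphom (i t) (p t) = idhom C].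

Definition decomposes C (T : finType) (X : T -> rep k P) : Prop :=
  exists (i : forall t, hom (X t) C) (p : forall t, hom C (X t)),
    decomposition i p.

Lemma decomposition_sum (T : finType) (X : T -> rep k P) C i p N (f : hom N C) :
  @decomposition T X C i p ->
  f = \sum_t comphom (i t) (comphom (p t) f).
Proof.
move=> [_ _ e]; rewrite -[LHS]comphom1l -e comphom_suml.
by apply: eq_bigr => t _; rewrite comphomA.
Qed.

Lemma decomposition_copair (T : finType) (X : T -> rep k P) C i p N
    (f : forall t, hom (X t) N) t :
  @decomposition T X C i p ->
  comphom (\sum_u comphom (f u) (p u)) (i t) = f t.
Proof.
move=> [pi1 pi0 _]; rewrite comphom_suml (bigD1 t) //= -comphomA pi1.
rewrite comphom1r big1 ?addr0 // => u ut.
by rewrite -comphomA pi0 ?comphom0r // eq_sym.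
Qed.

Lemma decomposes_iso (T : finType) (X : T -> rep k P) C C' :
  decomposes C X -> decomposes C' X -> iso C C'.
Proof.
move=> [i [p D]] [i' [p' D']].
exists (\sum_t comphom (i' t) (p t)), (\sum_t comphom (i t) (p' t)); split.
  case: (D) => _ _ <-; rewrite comphom_sumr; apply: eq_bigr => t _.
  by rewrite comphomA (decomposition_copair i t D').
case: (D') => _ _ <-; rewrite comphom_sumr; apply: eq_bigr => t _.
by rewrite comphomA (decomposition_copair i' t D).
Qed.

Lemma decomposes_trans_iso (T : finType) (X : T -> rep k P) C C' :
  iso C C' -> decomposes C X -> decomposes C' X.
Proof.
move=> [f [g [gf fg]]] [i [p [pi1 pi0 s]]].
exists (fun t => comphom f (i t)), (fun t => comphom (p t) g); split.
- by move=> t; rewrite -comphomA (comphomA g) gf comphom1l.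
- by move=> t u tu; rewrite -comphomA (comphomA g) gf comphom1l pi0.
- rewrite -fg -[f in RHS]comphom1r -s comphom_sumr comphom_suml.
  by apply: eq_bigr => t _; rewrite !comphomA.
Qed.

Lemma decomposes_rep0 (T : finType) (X : T -> rep k P) :
  #|T| = 0%N -> decomposes rep0 X.
Proof.
move=> T0; exists (fun t => hom0 _ _), (fun t => hom0 _ _).
have nT t : t \in T -> False by move=> tT; have := card0_eq T0 t; rewrite tT.
split=> [t|t|]; [by case: (nT t)|by case: (nT t)|].
rewrite big1 => [|t _]; last by case: (nT t).
apply: homP => x v; rewrite hom_zeroE hom_idE.
by apply/matrixP => i j; case: j.
Qed.

Lemma decomposes_cons (T : finType) (X : option T -> rep k P) C :
  decomposes C (fun t => X (Some t)) -> decomposes (dsum (X None) C) X.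
Proof.
move=> [i [p [pi1 pi0 s]]].
pose i' (o : option T) : hom (X o) (dsum (X None) C) :=
  match o with
  | None => in1 (X None) C
  | Some t => comphom (in2 (X None) C) (i t)
  end.
pose p' (o : option T) : hom (dsum (X None) C) (X o) :=
  match o with
  | None => pr1 (X None) C
  | Some t => comphom (p t) (pr2 (X None) C)
  end.
exists i', p'; split.
- case=> [t|] /=; last exact: pr1_in1.
  by rewrite -comphomA (comphomA (pr2 _ _)) pr2_in2 comphom1l.
- case=> [t|] [u|] //= tu.
  + by rewrite -comphomA (comphomA (pr2 _ _)) pr2_in2 comphom1l pi0.
  + by rewrite comphomA pr1_in2 comphom0l.
  + by rewrite -comphomA pr2_in1 comphom0r.
- rewrite (bigD1 None) //= -(in_pr (X None) C); congr (_ + _).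
  rewrite -[pr2 _ _ in RHS]comphom1l -s comphom_suml comphom_sumr.
  rewrite (reindex_omap Some id) /=; last by case.
  by apply: eq_big => [t|t _]; rewrite ?eqxx // !comphomA.
Qed.

Lemma decomposes_reindex (T T' : finType) (X : T -> rep k P) C (e : T' -> T) :
  bijective e -> decomposes C X -> decomposes C (fun t => X (e t)).
Proof.
move=> be [i [p [pi1 pi0 s]]].
exists (fun t => i (e t)), (fun t => p (e t)); split=> //.
  by move=> t u tu; apply: pi0; rewrite (inj_eq (bij_inj be)).
by rewrite -s (reindex e) //; apply: onW_bij.
Qed.

Lemma decomposes_ordS n (X : 'I_n.+1 -> rep k P) C :
  decomposes C (fun t => X (lift ord0 t)) -> decomposes (dsum (X ord0) C) X.
Proof.
move=> D.
pose e (o : option 'I_n) : 'I_n.+1 := if o is Some t then lift ord0 t else ord0.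
pose e' (t : 'I_n.+1) : option 'I_n := unlift ord0 t.
have ee' : cancel e' e by move=> t; rewrite /e' /e; case: unliftP.
have e'e : cancel e e' by case=> [t|]; rewrite /e' /e ?liftK ?unlift_none.
have eX : X = (fun t => X (e (e' t))) by apply/funext => t; rewrite ee'.
rewrite [X in decomposes _ X]eX.
apply: (@decomposes_reindex _ _ (fun o => X (e o))); first by exists e.
exact: (@decomposes_cons _ (fun o => X (e o))).
Qed.

Lemma interval_decomposableP C :
  interval_decomposable C <->
  exists n (J : 'I_n -> Int P), decomposes C (fun t => K (J t)).
Proof.
split.
  move=> [s Cs].
  suff [n [J D]] : exists n (J : 'I_n -> Int P),
      decomposes (foldr (fun I N => dsum (K I) N) rep0 s) (fun t => K (J t)).
    by exists n, J; apply: decomposes_trans_iso D; apply: iso_sym.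
  suff [T [J D]] : exists (T : finType) (J : T -> Int P),
      decomposes (foldr (fun I N => dsum (K I) N) rep0 s) (fun t => K (J t)).
    exists #|T|, (fun t => J (enum_val t)).
    exact: (decomposes_reindex (@enum_val_bij T) D).
  elim: s {C Cs} => [|I s [T [J D]]] /=.
    by exists void, (@of_void _); apply: decomposes_rep0; rewrite card_void.
  exists (option T), (fun o => if o is Some t then J t else I).
  exact: (@decomposes_cons T (fun o => K (if o is Some t then J t else I))).
move=> [n [J D]]; suff [s Ds] : exists s : seq (Int P),
    decomposes (foldr (fun I N => dsum (K I) N) rep0 s) (fun t => K (J t)).
  by exists s; apply: decomposes_iso D Ds.
elim: n J {C D} => [|n ih] J.
  by exists [::]; apply: decomposes_rep0; rewrite card_ord.
have [s D] := ih (fun t => J (lift ord0 t)).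
by exists (J ord0 :: s); apply: (@decomposes_ordS n (fun t => K (J t))).
Qed.

Lemma exists_decomposes n (J : 'I_n -> Int P) :
  exists2 C, interval_decomposable C & decomposes C (fun t => K (J t)).
Proof.
suff [C D] : exists C, decomposes C (fun t => K (J t)).
  by exists C => //; apply/interval_decomposableP; exists n, J.
elim: n J => [|n ih] J.
  by exists rep0; apply: decomposes_rep0; rewrite card_ord.
have [C D] := ih (fun t => J (lift ord0 t)).
by exists (dsum (K (J ord0)) C); apply: (@decomposes_ordS n (fun t => K (J t))).
Qed.
End Decompositions.

(** * Existence of interval covers and properties of their summands *)

Section Covers.
Variables (k : fieldType) (d : Order.disp_t) (P : finPOrderType d).
Implicit Types (M N C : rep k P) (I J : Int P).
Local Notation K := (interval_rep k).

(** A map out of k_I is determined by the images of the generators, so Hom(k_I, M) embeds linearly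
    in the product of the spaces of M. A basis of its image there is lifted back. *)
Lemma int_hom_fg I M :
  exists n (f : 'I_n -> hom (K I) M), forall g, exists c : 'I_n -> k,
    g = \sum_t c t *: f t.
Proof.
have [W [p [inj surj]]] := @product_exists k P (fun x => M x).
pose Q w := exists f : hom (K I) M, forall x, p x w = f x (one k I x).
have [|a u v [f fu] [g gv]|U HU] := @vspace_of_pred k W Q.
- by exists 0 => x; rewrite lfun0 hom_zeroE.
- by exists (a *: f + g) => x; rewrite lfunD lfunZ fu gv hom_addE hom_scaleE.
have wit (t : 'I_(\dim U)) :
    {f : hom (K I) M | forall x, p x (vbasis U)`_t = f x (one k I x)}.
  by apply/cid/HU/vbasis_mem/mem_nth; rewrite size_tuple.
exists (\dim U), (fun t => projT1 (wit t)) => g.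
have [w gw] := surj (fun x => g x (one k I x)).
have wU : w \in U by apply/HU; exists g.
exists (fun t => vector.coord (vbasis U) t w); apply: int_hom_ext => x xI.
rewrite -gw (coord_vbasis wU) lfun_sum hom_sumE; apply: eq_bigr => t _.
by rewrite lfunZ hom_scaleE (projT2 (wit t)) -coord_vbasis.
Qed.

(** Lifting is asked for single intervals only; [approximation_lift] extends it to all interval
    decomposable sources. *)
Definition approximation M C (F : hom C M) :=
  forall I (f : hom (K I) M), exists g : hom (K I) C, comphom F g = f.

Lemma approximation_lift M C (F : hom C M) C' (f : hom C' M) :
  approximation F -> interval_decomposable C' ->
  exists g : hom C' C, comphom F g = f.
Proof.
move=> apx /interval_decomposableP[n [J [i [p D]]]].
pose g t := projT1 (cid (apx (J t) (comphom f (i t)))).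
have gE t : comphom F (g t) = comphom f (i t) by rewrite /g; case: cid.
exists (\sum_t comphom (g t) (p t)).
rewrite -[RHS]comphom1r; case: (D) => _ _ <-; rewrite !comphom_sumr.
by apply: eq_bigr => t _; rewrite !comphomA gE.
Qed.

(* The support of f is a down-set of J, hence a disjoint union of intervals,
   through which f factors; one component is split off at a time. *)
Lemma approximation_supp M C (F : hom C M) J (f : hom (K J) M) :
  approximation F -> exists2 g : hom (K J) C, comphom F g = f
    & forall x, f x (one k J x) = 0 -> g x (one k J x) = 0.
Proof.
move=> apx; have [n] := ubnP #|[set x | f x (one k J x) != 0]|.
elim: n f => // n ih f; rewrite ltnS => le_n.
pose A := [set x | f x (one k J x) != 0].
have AE x : (x \in A) = (f x (one k J x) != 0) by rewrite inE.
have [A0|/set0Pn[a aA]] := eqVneq A finset.set0.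
  exists 0 => [|x _]; last by rewrite hom_zeroE.
  apply: int_hom_ext => x _; rewrite comphom0r hom_zeroE.
  by apply/esym/eqP; rewrite -[_ == _]negbK -AE A0 inE.
have AJ x : x \in A -> x \in val J.
  by rewrite AE; apply: contraNT => /hom_one_out->.
have A_down x y : (x <= y)%O -> x \in val J -> y \in A -> x \in A.
  move=> xy xJ; rewrite !AE; apply: contraNneq => fx0.
  by rewrite -(hom_one_nat f xy xJ) fx0 lfun0.
pose rA : rel P := fun x y => [&& x \in A, y \in A & (x >=< y)%O].
have rAC : connect_sym rA.
  apply: sym_connect_sym => x y; rewrite /rA comparable_sym.
  by rewrite !andbA (andbC (x \in A)).
pose B := [set x | (x \in A) && connect rA a x].
have BE x : (x \in B) = (x \in A) && connect rA a x by rewrite inE.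
have B_ext x y : x \in B -> y \in A -> (x >=< y)%O -> y \in B.
  rewrite !BE => /andP[xA ax] yA xy; rewrite yA.
  by apply: connect_trans ax (connect1 _); rewrite /rA xA yA.
have BA x : x \in B -> x \in A by rewrite BE => /andP[].
have aB : a \in B by rewrite BE aA connect0.
have B_int : is_interval B.
  apply/andP; split.
    apply/forall_inP => x xB; apply/forall_inP => z zB; apply/forallP => y.
    apply/implyP => /andP[xy yz].
    have yJ : y \in val J.
      apply: (convexP _ xy yz); rewrite ?AJ ?BA //.
      by case/andP: (valP J).
    apply: (B_ext z) => //; first exact: A_down yz yJ (BA _ zB).
    by apply/orP; right.
  apply/andP; split; first by apply/set0Pn; exists a.
  apply/forall_inP => x xB; apply/forall_inP => z zB.
  have : connect rA x z.
    move: xB zB; rewrite !BE => /andP[_ ax] /andP[_]; apply: connect_trans.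
    by rewrite rAC.
  move=> /connectP[p + zE]; move: zB; rewrite zE => _ {zE}.
  elim: p x xB => [|y p ih'] x xB /=; first by rewrite connect0.
  move=> /andP[/and3P[xA yA xy] yp].
  have yB := B_ext _ _ xB yA xy.
  by apply: connect_trans (ih' y yB yp); apply: connect1; rewrite xB yB.
pose BI : Int P := exist _ B B_int.
(* This family is a map out of k_B: moving up from B, either f becomes zero or the new point belongs
   to A and, being comparable to a point of B, to B itself. *)
pose w x := if x \in B then f x (one k J x) else 0.
have w_out x : x \notin val BI -> w x = 0 by rewrite /w => /negbTE->.
have w_nat (x y : P) (h : (x <= y)%O) :
    x \in val BI -> rmap M h (w x) = w y.
  move=> xB; rewrite /w xB (hom_one_nat f h) ?AJ ?BA //.
  case: ifPn => // yB; apply/eqP; apply: contraNT yB; rewrite -AE => yA.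
  by apply: (B_ext x) => //; rewrite /Order.comparable h.
pose fB := int_hom w_out w_nat.
(* B is a down-set of J, so k_J projects onto k_B, and [fB] after this projection is the part of f
   carried by B. *)
have q_out x : x \notin val J -> one k BI x = 0.
  by move=> xJ; apply: one_notin; apply: contraNN xJ => /BA/AJ.
have q_nat (x y : P) (h : (x <= y)%O) :
    x \in val J -> rmap (K BI) h (one k BI x) = one k BI y.
  move=> xJ; case xB: (x \in B); first by rewrite rmap_one.
  have yB : y \notin B.
    apply/negP => yB; move/negP: xB; apply.
    apply: (B_ext y) => //; first exact: A_down h xJ (BA _ yB).
    by apply/orP; right.
  by rewrite !one_notin ?lfun0 // xB.
pose q := int_hom q_out q_nat.
have fBq x : comphom fB q x (one k J x) = w x.
  by rewrite hom_compE int_homE int_homE.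
have [gB gBE] := apx BI fB.
have sub_le : (#|[set x | ((f - comphom fB q) x (one k J x) != 0)%R]| < n)%N.
  apply: leq_trans le_n; apply: proper_card; apply/properP; split.
    apply/fintype.subsetP => x; rewrite !inE hom_subE fBq /w.
    by case: ifP; rewrite ?subrr ?eqxx ?subr0.
  by exists a => //; rewrite inE hom_subE fBq /w aB subrr eqxx.
have [g gE g0] := ih _ sub_le.
exists (g + comphom gB q).
  by rewrite comphomDr gE comphomA gBE subrK.
move=> x fx; rewrite hom_addE g0 ?hom_subE ?fBq ?/w ?fx; last first.
  by case: ifP; rewrite subrr.
rewrite add0r hom_compE int_homE one_notin ?lfun0 //.
by apply/negP => /BA; rewrite AE fx eqxx.
Qed.

Section MinimalSummands.
Variables (M C : rep k P) (F : hom C M) (n : nat) (J : 'I_n -> Int P).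
Variables (i : forall t, hom (K (J t)) C) (p : forall t, hom C (K (J t))).
Hypothesis D : decomposition i p.
Hypothesis radical : forall t (w : hom (K (J t)) C),
  comphom F w = 0 -> comphom (p t) w = 0.

(** If the two intervals were equal, the hypothesis [radical] would kill the component. So the
    component links distinct intervals and the height drops. *)
Lemma radical_height I (w : hom (K I) C) t x :
  comphom F w = 0 -> hcoef (comphom (p t) w) x != 0 ->
  (reach_height k x (J t) < reach_height k x I)%N.
Proof.
move=> Fw pw; apply: reach_height_lt; first by exists (comphom (p t) w).
move=> e; move: w Fw pw; rewrite e => w Fw.
by rewrite radical // hcoef0 eqxx.
Qed.

Lemma hcoef_component I (w : hom (K I) C) x :
  w x (one k I x) != 0 -> exists t, hcoef (comphom (p t) w) x != 0.
Proof.
move=> w0; apply/existsP; apply: contraNT w0; rewrite negb_exists => /forallP h.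
rewrite (decomposition_sum w D) hom_sumE big1 // => t _.
by rewrite hom_compE hcoefE (eqP (negPn (h t))) scale0r lfun0.
Qed.

(** On the generator of a summand at x, each application of r leaves only components in summands of
    smaller height, and heights stay below the number of intervals. *)
Lemma radical_nilpotent (r : hom C C) :
  comphom F r = 0 ->
  iter #|{: Int P}| (comphom r) (idhom C) = 0.
Proof.
move=> Fr; set R := iter _ _ _.
(* The powers are rebuilt with the new factor on the right, so that the factor peeled off by
   induction is the first one applied to the summand. *)
pose Rn m := iter m (fun h => comphom h r) (idhom C).
have RE : R = Rn #|{: Int P}|.
  have swap m h : comphom (iter m (comphom r) h) r =
                  iter m (comphom r) (comphom h r).
    by elim: m => //= m ih; rewrite -comphomA ih.
  rewrite /R /Rn; elim: #|_| => // m ih.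
  by rewrite [RHS]iterS -ih swap iterSr comphom1l comphom1r.
suff h m t x : (reach_height k x (J t) < m)%N ->
    Rn m x (i t x (one k (J t) x)) = 0.
  rewrite RE -[LHS]comphom1r; case: (D) => _ _ <-; rewrite comphom_sumr big1 //.
  move=> t _; rewrite comphomA [comphom (Rn _) _](_ : _ = 0) ?comphom0l //.
  apply: int_hom_ext => x _; rewrite hom_compE hom_zeroE h //.
  exact: reach_height_max.
elim: m t => // m ih t; rewrite ltnS => le_m.
rewrite /Rn iterS hom_compE -/(Rn m) -(hom_compE r).
set w := comphom r (i t).
rewrite (decomposition_sum w D) hom_sumE lfun_sum big1 // => u _.
rewrite hom_compE hcoefE !lfunZ.
have [->|nz] := eqVneq (hcoef (comphom (p u) w) x) 0; first by rewrite scale0r.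
rewrite ih ?scaler0 //; apply: leq_trans le_m; apply: radical_height nz.
by rewrite comphomA Fr comphom0l.
Qed.

(** A map h that fixes F differs from the identity by some r with F r = 0. Such an r is nilpotent,
    and the geometric series in r inverts h. *)
Lemma radical_minimal (h : hom C C) : comphom F h = F -> is_iso h.
Proof.
move=> Fh; pose r := idhom C - h.
have Fr : comphom F r = 0 by rewrite comphomBr comphom1r Fh subrr.
have hE : h = idhom C - r by rewrite subKr.
pose S m := iter m (fun s => idhom C + comphom r s) 0.
have rS m : comphom r (S m) = comphom (S m) r.
  elim: m => [|m ih]; first by rewrite comphom0r comphom0l.
  by rewrite /S /= -/(S m) comphomDr comphomDl comphom1r comphom1l -comphomA -ih.
have hS m : comphom h (S m) = idhom C - iter m (comphom r) (idhom C).
  elim: m => [|m ih]; first by rewrite comphom0r subrr.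
  rewrite /S /= -/(S m) comphomDr comphom1r comphomA.
  have -> : comphom h r = comphom r h.
    by rewrite hE comphomBl comphomBr comphom1l comphom1r.
  rewrite -comphomA ih comphomBr comphom1r hE.
  by rewrite addrA subrK.
have e : comphom h (S #|{: Int P}|) = idhom C.
  by rewrite hS radical_nilpotent // subr0.
exists (S #|{: Int P}|); split=> //.
by rewrite -[RHS]e {1 2}hE comphomBr comphomBl comphom1l comphom1r rS.
Qed.
End MinimalSummands.

Definition approximated M n := exists (J : 'I_n -> Int P) C (F : hom C M),
  decomposes C (fun t => K (J t)) /\ approximation F.

(** One summand k_I is taken for each interval I and each generator of Hom(k_I, M). *)
Lemma approximated_exists M : exists n, approximated M n.
Proof.
pose m I := projT1 (cid (int_hom_fg I M)).
pose f I : 'I_(m I) -> hom (K I) M := projT1 (cid (projT2 (cid (int_hom_fg I M)))).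
have fP I : forall g, exists c : 'I_(m I) -> k, g = \sum_t c t *: f I t.
  exact: projT2 (cid (projT2 (cid (int_hom_fg I M)))).
pose T := {I : Int P & 'I_(m I)}.
pose J (t : 'I_#|{: T}|) := tag (enum_val t).
have [C _ [i [p D]]] := exists_decomposes k J.
pose F := \sum_t comphom (f (J t) (tagged (enum_val t))) (p t).
exists #|{: T}|, J, C, F; split; first by exists i, p.
have Fi t : comphom F (i t) = f (J t) (tagged (enum_val t)).
  exact: (decomposition_copair (fun t => f (J t) (tagged (enum_val t))) t D).
have lift' (t : 'I_#|{: T}|) (v : T) : enum_val t = v ->
    exists g : hom (K (tag v)) C, comphom F g = f (tag v) (tagged v).
  by move=> <-; exists (i t); apply: Fi.
have lift I (s : 'I_(m I)) : exists g, comphom F g = f I s.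
  exact: lift' (enum_rankK (Tagged _ s)).
move=> I g; have [c ->] := fP I g.
exists (\sum_t c t *: projT1 (cid (lift I t))); rewrite comphom_sumr.
by apply: eq_bigr => t _; rewrite comphomZr (projT2 (cid (lift I t))).
Qed.

(** A nonzero component of w on its own summand is an invertible scalar. Subtracting a suitable map
    through w then clears that coordinate from any lift without changing its image under F, so the
    summand is redundant. *)
Lemma approximated_pred M n (J : 'I_n -> Int P) C (F : hom C M) i p t
    (w : hom (K (J t)) C) :
  @decomposition k d P _ (fun t => K (J t)) C i p -> approximation F ->
  comphom F w = 0 -> comphom (p t) w <> 0 -> approximated M n.-1.
Proof.
case: n J i p t w => [|n] J i p t w; first by case: t w.
move=> D apx Fw pw0; rewrite /=.
have [a pw] := int_endo (comphom (p t) w).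
have a0 : a != 0 by apply: contra_notN pw0 => /eqP a0; rewrite pw a0 scale0r.
pose u := a^-1 *: w.
have Fu : comphom F u = 0 by rewrite comphomZr Fw scaler0.
have pu : comphom (p t) u = idhom _.
  by rewrite comphomZr pw scalerA mulVf // scale1r.
have [C' _ [i' [p' D']]] := exists_decomposes k (fun s => J (lift t s)).
pose inc := \sum_s comphom (i (lift t s)) (p' s).
exists (fun s => J (lift t s)), C', (comphom F inc); split; first by exists i', p'.
move=> I f; have [g Fg] := apx I f.
pose g' := g - comphom u (comphom (p t) g).
have Fg' : comphom F g' = f by rewrite comphomBr comphomA Fu comphom0l subr0.
have pg' : comphom (p t) g' = 0 by rewrite comphomBr comphomA pu comphom1l subrr.
exists (\sum_s comphom (i' s) (comphom (p (lift t s)) g')).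
rewrite -Fg' -comphomA; congr comphom.
rewrite [RHS](decomposition_sum g' D) (bigD1_ord t) //= pg' comphom0r add0r.
rewrite comphom_sumr; apply: eq_bigr => s _.
rewrite comphomA; congr comphom.
exact: (decomposition_copair (fun s => i (lift t s)) s D').
Qed.

(** An approximation with the fewest summands satisfies the hypothesis [radical], since otherwise
    [approximated_pred] would remove a summand. *)
Lemma interval_cover_exists M :
  exists C (F : hom C M), is_interval_cover F.
Proof.
pose R n := `[< approximated M n >].
have R0 : exists n, R n.
  by have [n h] := approximated_exists M; exists n; apply/asboolP.
case: (ex_minnP R0) => n /asboolP[J [C [F [[i [p D]] apx]]]] minn.
exists C, F; split.
- by apply/interval_decomposableP; exists n, J, i, p.
- by move=> C' g C'i; apply: approximation_lift.
- apply: (radical_minimal D) => t w Fw; apply: contrapT => pw.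
  have /asboolP/minn := approximated_pred D apx Fw pw.
  by case: n J i p D t {w Fw pw minn} => [|n] J i p D [t //= _]; rewrite ltnn.
Qed.

Lemma interval_coverP M : is_interval_cover (projT2 (interval_cover M)).
Proof.
have := @theP _ (existT _ rep0 (hom0 rep0 M))
  (fun Cf : {C : rep k P & hom C M} => is_interval_cover (projT2 Cf)).
apply.
by have [C [F FP]] := interval_cover_exists M; exists (existT _ C F).
Qed.

Lemma interval_rep_decomposable I : interval_decomposable (K I).
Proof.
apply/interval_decomposableP; exists 1%N, (fun _ => I).
exists (fun _ => idhom _), (fun _ => idhom _); split=> [t|t u|].
- by rewrite comphom1l.
- by rewrite !ord1 eqxx.
- by rewrite big_ord1 comphom1l.
Qed.

Lemma cover_approximation M C (F : hom C M) :
  is_interval_cover F -> approximation F.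
Proof. by move=> [_ h _] I f; apply/h/interval_rep_decomposable. Qed.

Section CoverSummands.
Variables (M C : rep k P) (F : hom C M) (T : finType) (J : T -> Int P).
Variables (i : forall t, hom (K (J t)) C) (p : forall t, hom C (K (J t))).
Hypotheses (D : decomposition i p) (FC : is_interval_cover F).

Lemma cover_summand_inj t x :
  x \in val (J t) -> F x (i t x (one k (J t) x)) != 0.
Proof.
move=> xJ; apply/negP => /eqP; rewrite -hom_compE => Fi0.
have [g Fg g0] := approximation_supp (comphom F (i t)) (cover_approximation FC).
(* The map h sends the summand t through g and fixes the others. It preserves F, so it is
   invertible, yet g kills the generator at x as soon as F does. *)
pose h := idhom C - comphom (i t) (p t) + comphom g (p t).
have Fh : comphom F h = F.
  by rewrite comphomDr comphomBr comphom1r !comphomA Fg subrK.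
case: FC => _ _ /(_ h Fh)[h' [h'h _]].
have hi : comphom h (i t) = g.
  case: D => pi1 _ _.
  by rewrite comphomDl comphomBl comphom1l -!comphomA pi1 !comphom1r subrr add0r.
have : i t x (one k (J t) x) = 0.
  by rewrite -[LHS]hom_idE -h'h hom_compE -(hom_compE h) hi g0 ?lfun0.
case: D => /(_ t) pi1 _ _ e; have := one_neq0 k xJ.
by rewrite -[one _ _ _]hom_idE -pi1 hom_compE e lfun0 eqxx.
Qed.

(** If w had a nonzero scalar a on its summand, subtracting [a^-1 *: comphom w (p t)] from the
    identity would give a map that fixes F but misses the summand, against minimality. So every
    cover meets the hypothesis [radical]. *)
Lemma cover_radical t (w : hom (K (J t)) C) :
  comphom F w = 0 -> comphom (p t) w = 0.
Proof.
move=> Fw; have [a pw] := int_endo (comphom (p t) w).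
have [a0|a0] := eqVneq a 0; first by rewrite pw a0 scale0r.
pose h := idhom C - a^-1 *: comphom w (p t).
have Fh : comphom F h = F.
  by rewrite comphomBr comphom1r comphomZr comphomA Fw comphom0l scaler0 subr0.
case: FC => _ _ /(_ h Fh)[h' [_ hh']].
have ph : comphom (p t) h = 0.
  rewrite comphomBr comphom1r comphomZr comphomA pw comphomZl comphom1l.
  by rewrite scalerA mulVf // scale1r subrr.
have p0 : p t = 0 by rewrite -[LHS]comphom1r -hh' comphomA ph comphom0l.
case: D => /(_ t) + _ _; rewrite p0 comphom0l => /esym e.
by case: (@idint_neq0 k d P (J t)).
Qed.
End CoverSummands.
End Covers.

(** * Kernels and multiplicities *)

Section Kernels.
Variables (k : fieldType) (d : Order.disp_t) (P : finPOrderType d).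
Implicit Types (L M N C X : rep k P).

Section KernelMaps.
Variables (M N : rep k P) (f : hom M N).

Definition ker_inc_at x : 'Hom(ker f x, M x) := linfun vsval.

Lemma ker_inc_atE x v : ker_inc_at x v = vsval v.
Proof. exact: lfunE. Qed.

Lemma ker_rmapE (x y : P) (h : (x <= y)%O) (v : ker f x) :
  vsval (rmap (ker f) h v) = rmap M h (vsval v).
Proof.
rewrite comp_lfunE [linfun _ v]lfunE comp_lfunE [linfun _ _]lfunE.
exact/vsprojK/ker_stable.
Qed.

Lemma ker_inc_natural (x y : P) (h : (x <= y)%O) :
  (ker_inc_at y \o rmap (ker f) h)%VF = (rmap M h \o ker_inc_at x)%VF.
Proof.
apply/lfunP => v.
rewrite comp_lfunE ker_inc_atE ker_rmapE [RHS]comp_lfunE.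
by rewrite ker_inc_atE.
Qed.

Definition ker_inc : hom (ker f) M := Hom ker_inc_natural.

Lemma ker_incE x v : ker_inc x v = vsval v.
Proof. exact: ker_inc_atE. Qed.

Lemma ker_inc_inj x : injective (ker_inc x).
Proof. by move=> u v; rewrite !ker_incE => /subvs_inj. Qed.

Lemma ker_incK : comphom f ker_inc = 0.
Proof.
apply: homP => x v; rewrite hom_compE ker_incE hom_zeroE.
by apply/eqP; rewrite -memv_ker subvsP.
Qed.

Lemma ker_mem x v : f x v = 0 -> exists u, v = ker_inc x u.
Proof.
move=> fv; exists (vsproj (lker (f x)) v); rewrite ker_incE vsprojK //.
by rewrite memv_ker fv.
Qed.

Lemma ker_mono X (a b : hom X (ker f)) :
  comphom ker_inc a = comphom ker_inc b -> a = b.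
Proof.
move=> ab; apply: homP => x v; apply: (@ker_inc_inj x).
by rewrite -!hom_compE ab.
Qed.

Section KernelLift.
Variables (X : rep k P) (u : hom X M).
Hypothesis fu : comphom f u = 0.

Definition ker_lift_at x : 'Hom(X x, ker f x) :=
  (linfun (vsproj (lker (f x))) \o u x)%VF.

Lemma ker_lift_atE x v : vsval (ker_lift_at x v) = u x v.
Proof.
rewrite comp_lfunE [linfun _ _]lfunE vsprojK // memv_ker.
by rewrite -hom_compE fu hom_zeroE.
Qed.

Lemma ker_lift_natural (x y : P) (h : (x <= y)%O) :
  (ker_lift_at y \o rmap X h)%VF = (rmap (ker f) h \o ker_lift_at x)%VF.
Proof.
apply/lfunP => v; apply: subvs_inj.
rewrite comp_lfunE ker_lift_atE hom_nat [in RHS]comp_lfunE ker_rmapE.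
by rewrite ker_lift_atE.
Qed.

Definition ker_lift : hom X (ker f) := Hom ker_lift_natural.

Lemma ker_liftE : comphom ker_inc ker_lift = u.
Proof. by apply: homP => x v; rewrite hom_compE ker_incE ker_lift_atE. Qed.
End KernelLift.

Lemma ker_dim x :
  (\dim {: ker f x} + \dim (limg (f x)) = \dim {: M x})%N.
Proof.
rewrite -(limg_ker_dim (f x)) capfv; congr (_ + _)%N.
by rewrite dimvf.
Qed.
End KernelMaps.

(** Syzygies of isomorphic representations, or of a direct sum and its terms, rest on covers chosen
    independently; the universal property compares their kernels. *)
Definition is_kernel N M L (j : hom N M) (f : hom M L) :=
  comphom f j = 0 /\ forall X (u : hom X M), comphom f u = 0 ->
    exists2 w : hom X N, comphom j w = u & forall w', comphom j w' = u -> w' = w.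

Lemma ker_is_kernel M N (f : hom M N) : is_kernel (ker_inc f) f.
Proof.
split=> [|X u fu]; first exact: ker_incK.
exists (ker_lift fu); first exact: ker_liftE.
by move=> w' e; apply: ker_mono; rewrite e ker_liftE.
Qed.

Lemma kernel_iso N M L (j : hom N M) (f : hom M L)
    N' M' L' (j' : hom N' M') (f' : hom M' L') (g : hom M M') (h : hom L L') :
  is_kernel j f -> is_kernel j' f' -> is_iso g -> is_iso h ->
  comphom f' g = comphom h f -> iso N N'.
Proof.
move=> [fj univ] [fj' univ'] [g' [g'g gg']] [h' [h'h hh']] sq.
have sq' : comphom f g' = comphom h' f'.
  rewrite -[LHS]comphom1l -h'h -comphomA (comphomA h) -sq.
  by rewrite -comphomA gg' comphom1r.
have [|a ja _] := univ' _ (comphom g j).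
  by rewrite comphomA sq -comphomA fj comphom0r.
have [|b jb _] := univ _ (comphom g' j').
  by rewrite comphomA sq' -comphomA fj' comphom0r.
exists a, b; split.
  have [|w _ uw] := univ _ j => //.
  rewrite [LHS]uw; first by rewrite [RHS]uw ?comphom1r.
  by rewrite comphomA jb -comphomA ja comphomA g'g comphom1l.
have [|w _ uw] := univ' _ j' => //.
rewrite [LHS]uw; first by rewrite [RHS]uw ?comphom1r.
by rewrite comphomA ja -comphomA jb comphomA gg' comphom1l.
Qed.

Lemma pr1_dsum_hom L L' M M' (f : hom L M) (g : hom L' M') :
  comphom (pr1 M M') (dsum_hom f g) = comphom f (pr1 L L').
Proof. by apply: homP => x v; rewrite hom_compE dsum_homE pr1E hom_compE pr1E. Qed.

Lemma pr2_dsum_hom L L' M M' (f : hom L M) (g : hom L' M') :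
  comphom (pr2 M M') (dsum_hom f g) = comphom g (pr2 L L').
Proof. by apply: homP => x v; rewrite hom_compE dsum_homE pr2E hom_compE pr2E. Qed.

Lemma dsum_ext N M M' (a b : hom N (dsum M M')) :
  comphom (pr1 M M') a = comphom (pr1 M M') b ->
  comphom (pr2 M M') a = comphom (pr2 M M') b -> a = b.
Proof.
move=> e1 e2; rewrite -[a]comphom1l -[b]comphom1l -in_pr !comphomDl.
by rewrite -!comphomA e1 e2.
Qed.

Lemma dsum_is_kernel N M L (j : hom N M) (f : hom M L)
    N' M' L' (j' : hom N' M') (f' : hom M' L') :
  is_kernel j f -> is_kernel j' f' -> is_kernel (dsum_hom j j') (dsum_hom f f').
Proof.
move=> [fj univ] [fj' univ']; split.
  apply: dsum_ext; rewrite comphomA comphom0r.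
    by rewrite pr1_dsum_hom -comphomA pr1_dsum_hom comphomA fj comphom0l.
  by rewrite pr2_dsum_hom -comphomA pr2_dsum_hom comphomA fj' comphom0l.
move=> X u fu.
have [|a ja ua] := univ _ (comphom (pr1 _ _) u).
  by rewrite comphomA -(pr1_dsum_hom f f') -comphomA fu comphom0r.
have [|b jb ub] := univ' _ (comphom (pr2 _ _) u).
  by rewrite comphomA -(pr2_dsum_hom f f') -comphomA fu comphom0r.
pose s := comphom (in1 N N') a + comphom (in2 N N') b.
have s1 : comphom (pr1 _ _) s = a.
  exact: pr1_pair.
have s2 : comphom (pr2 _ _) s = b.
  exact: pr2_pair.
exists s => [|w jw]; apply: dsum_ext.
- by rewrite comphomA pr1_dsum_hom -comphomA s1.
- by rewrite comphomA pr2_dsum_hom -comphomA s2.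
- by rewrite s1; apply: ua; rewrite comphomA -(pr1_dsum_hom j j') -comphomA jw.
- by rewrite s2; apply: ub; rewrite comphomA -(pr2_dsum_hom j j') -comphomA jw.
Qed.

Lemma split_mono_summand M N (u : hom N M) (v : hom M N) :
  comphom v u = idhom N -> iso M (dsum N (ker v)).
Proof.
move=> vu; pose r := idhom M - comphom u v.
have vr : comphom v r = 0.
  by rewrite comphomBr comphom1r comphomA vu comphom1l subrr.
pose a := comphom (in1 _ _) v + comphom (in2 _ _) (ker_lift vr).
pose b := comphom u (pr1 _ _) + comphom (ker_inc v) (pr2 N (ker v)).
have a1 : comphom (pr1 _ _) a = v.
  exact: pr1_pair.
have a2 : comphom (pr2 _ _) a = ker_lift vr.
  exact: pr2_pair.
have vb : comphom v b = pr1 _ _.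
  by rewrite comphomDr !comphomA vu ker_incK comphom1l comphom0l addr0.
exists a, b; split.
  by rewrite comphomDl -!comphomA a1 a2 ker_liftE addrC subrK.
apply: dsum_ext; rewrite comphomA comphom1r; first by rewrite a1 vb.
apply: ker_mono; rewrite a2 comphomA ker_liftE comphomBl comphom1l.
by rewrite -comphomA vb addrC addKr.
Qed.
End Kernels.

(** * Multiplicities of interval summands as ranks of a pairing *)

Section Multiplicity.
Variables (k : fieldType) (d : Order.disp_t) (P : finPOrderType d).
Implicit Types (M N C : rep k P) (I J : Int P).
Local Notation K := (interval_rep k).

(* The rank of the composition pairing Hom(k_I, M) x Hom(M, k_I) -> k. *)
Definition pairing_rank M I n := exists (T : finType)
    (u : T -> hom (K I) M) (v : T -> hom M (K I)),
  [/\ #|T| = n,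
      forall s t, comphom (v s) (u t) = (s == t)%:R *: idhom (K I)
    & forall (a : hom (K I) M) (b : hom M (K I)),
        comphom b a = \sum_t comphom (comphom b (u t)) (comphom (v t) a)].

(** Expanding the duality relations of the first family through the second writes the identity
    matrix of size m as a product factoring through size n. *)
Lemma pairing_rank_le M I m n :
  pairing_rank M I m -> pairing_rank M I n -> (m <= n)%N.
Proof.
move=> [T [u [v [<- uv _]]]] [T' [u' [v' [<- _ s]]]].
have [x xI] := int_neq0 I.
pose A : 'M[k]_(#|T|, #|T'|) :=
  \matrix_(i, j) hcoef (comphom (v (enum_val i)) (u' (enum_val j))) x.
pose B : 'M[k]_(#|T'|, #|T|) :=
  \matrix_(i, j) hcoef (comphom (v' (enum_val i)) (u (enum_val j))) x.
have AB : A *m B = 1%:M.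
  apply/matrixP => i j; rewrite !mxE.
  have := congr1 (fun h : hom (K I) (K I) => hcoef h x)
    (s (u (enum_val j)) (v (enum_val i))).
  rewrite uv hcoefZ hcoef_id xI mulr1 (inj_eq enum_val_inj) => ->.
  rewrite hcoef_sum (reindex (@enum_val _ T')) /=; last exact/onW_bij/enum_val_bij.
  by apply: eq_bigr => l _; rewrite !mxE hcoef_comp.
by rewrite -(mxrank1 k #|T|) -AB (leq_trans (mxrankM_maxr _ _)) // rank_leq_row.
Qed.

Lemma pairing_rank_uniq M I m n :
  pairing_rank M I m -> pairing_rank M I n -> m = n.
Proof.
move=> h h'; apply/eqP.
by rewrite eqn_leq (pairing_rank_le h h') (pairing_rank_le h' h).
Qed.

Lemma pairing_rank_iso M N I n :
  iso M N -> pairing_rank M I n -> pairing_rank N I n.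
Proof.
move=> [f [g [gf fg]]] [T [u [v [Tn uv s]]]].
exists T, (fun t => comphom f (u t)), (fun t => comphom (v t) g); split=> //.
  by move=> t t'; rewrite -comphomA (comphomA g) gf comphom1l uv.
move=> a b; rewrite -[a in LHS]comphom1l -fg -comphomA comphomA s.
by apply: eq_bigr => t _; rewrite !comphomA.
Qed.

Lemma pairing_rank_dsum M N I m n : pairing_rank M I m -> pairing_rank N I n ->
  pairing_rank (dsum M N) I (m + n).
Proof.
move=> [T [u [v [Tm uv s]]]] [T' [u' [v' [Tn uv' s']]]].
exists (T + T')%type.
exists (fun t => match t with
  | inl t => comphom (in1 M N) (u t) | inr t => comphom (in2 M N) (u' t) end).
exists (fun t => match t with
  | inl t => comphom (v t) (pr1 M N) | inr t => comphom (v' t) (pr2 M N) end).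
split; first by rewrite card_sum Tm Tn.
  case=> t [] t'; rewrite -comphomA.
  - by rewrite (comphomA (pr1 M N)) pr1_in1 comphom1l uv.
  - by rewrite (comphomA (pr1 M N)) pr1_in2 comphom0l comphom0r scale0r.
  - by rewrite (comphomA (pr2 M N)) pr2_in1 comphom0l comphom0r scale0r.
  - by rewrite (comphomA (pr2 M N)) pr2_in2 comphom1l uv'.
move=> a b; rewrite -[a in LHS]comphom1l -in_pr comphomDl comphomDr.
rewrite -!comphomA !(comphomA b) s s' big_sumType /=.
by congr (_ + _); apply: eq_bigr => t _; rewrite !comphomA.
Qed.

Lemma pairing_rank0 M I :
  (forall (a : hom (K I) M) (b : hom M (K I)), comphom b a = 0) <->
  pairing_rank M I 0.
Proof.
split=> [h|[T [u [v [T0 _ s]]]] a b]; last first.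
  by rewrite s big1 // => t _; have := card0_eq T0 t.
exists void, (@of_void _), (@of_void _); split=> [|[]|a b].
  by rewrite card_void.
by rewrite h big1 // => -[].
Qed.

Lemma pairing_rank_zero M I : is_zero M -> pairing_rank M I 0.
Proof.
move=> M0; apply/pairing_rank0 => a b; apply: homP => x v.
rewrite hom_compE hom_zeroE; suff -> : a x v = 0 by rewrite lfun0.
apply/eqP; rewrite -memv0 (_ : 0%VS = fullv) ?memvf //.
by apply/esym/eqP; rewrite -dimv_eq0 M0.
Qed.

Lemma pairing_rank_interval I J : pairing_rank (K J) I (J == I).
Proof.
have [->|/eqP JI] := eqVneq J I; last first.
  apply/pairing_rank0 => a b; apply: contrapT => ba.
  by apply: JI; rewrite (int_loop ba).
exists unit, (fun _ => idhom _), (fun _ => idhom _); split.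
- exact: card_unit.
- by move=> [] []; rewrite comphom1l eqxx scale1r.
- by move=> a b; rewrite big_const card_unit /= addr0 comphom1l comphom1r.
Qed.

Lemma rep0_is_zero : is_zero (@rep0 k d P).
Proof. by move=> x; rewrite dimvf. Qed.

Lemma pairing_rank_rpow I n : pairing_rank (rpow (K I) n) I n.
Proof.
elim: n => [|n ih]; first exact/pairing_rank_zero/rep0_is_zero.
rewrite -add1n; apply: pairing_rank_dsum ih.
by have := pairing_rank_interval I I; rewrite eqxx.
Qed.

(** A nonzero composite k_I -> M -> k_I is an invertible scalar, which would make k_I a direct
    summand. *)
Lemma pairing_rank_not_summand M I :
  ~ direct_summand (K I) M -> pairing_rank M I 0.
Proof.
move=> nM; apply/pairing_rank0 => a b; apply: contrapT => ba0; apply: nM.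
have [c ba] := int_endo (comphom b a).
have c0 : c != 0 by apply: contra_notN ba0 => /eqP c0; rewrite ba c0 scale0r.
exists (ker (c^-1 *: b)); apply: (@split_mono_summand _ _ _ _ _ a).
by rewrite comphomZl ba scalerA mulVf // scale1r.
Qed.

Definition rep_dim M := (\sum_x \dim {: M x})%N.

Lemma rep_dim_iso M N : iso M N -> rep_dim M = rep_dim N.
Proof. by move=> MN; apply: eq_bigr => x _; apply: iso_dim. Qed.

Lemma dim_dsum M N x : \dim {: dsum M N x} = (\dim {: M x} + \dim {: N x})%N.
Proof. by rewrite !dimvf. Qed.

Lemma rep_dim_dsum M N : rep_dim (dsum M N) = (rep_dim M + rep_dim N)%N.
Proof. by rewrite -big_split; apply: eq_bigr => x _; apply: dim_dsum. Qed.

Lemma dim_interval I x : \dim {: K I x} = (x \in val I).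
Proof. by rewrite dimvf /dim /= mul1n. Qed.

Lemma iso_dsumr L M N : iso M N -> iso (dsum L M) (dsum L N).
Proof.
move=> [f fI]; exists (dsum_hom (idhom L) f); apply: dsum_hom_iso => //.
by exists (idhom L); rewrite comphom1l.
Qed.

Lemma dsum_rep0_iso M : iso M (dsum rep0 M).
Proof.
exists (in2 _ _), (pr2 _ _); rewrite pr2_in2 -in_pr; split=> //.
rewrite (_ : comphom (in1 _ _) _ = 0) ?add0r //.
apply: homP => x v; rewrite hom_compE hom_zeroE in1E pr1E.
by congr pair; apply/matrixP => i j; case: j.
Qed.

Lemma dsumA_iso L M N : iso (dsum L (dsum M N)) (dsum (dsum L M) N).
Proof.
exists (comphom (in1 _ _) (comphom (in1 _ _) (pr1 _ _)) +
  (comphom (in1 _ _) (comphom (in2 _ _) (comphom (pr1 _ _) (pr2 _ _))) +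
   comphom (in2 _ _) (comphom (pr2 _ _) (pr2 _ _)))).
exists (comphom (in1 _ _) (comphom (pr1 _ _) (pr1 _ _)) +
  (comphom (in2 _ _) (comphom (in1 _ _) (comphom (pr2 _ _) (pr1 _ _))) +
   comphom (in2 _ _) (comphom (in2 _ _) (pr2 _ _)))).
split; apply: homP => x.
  move=> [l [m n]]; rewrite !homE !(pr1E, pr2E, in1E, in2E) /=.
  by congr pair; [|congr pair]; rewrite /= ?(addr0, add0r).
move=> [[l m] n]; rewrite !homE !(pr1E, pr2E, in1E, in2E) /=.
by congr pair; [congr pair|]; rewrite /= ?(addr0, add0r).
Qed.

Lemma multiplicity_split M I : exists n N,
  iso M (dsum (rpow (K I) n) N) /\ ~ direct_summand (K I) N.
Proof.
have [m] := ubnP (rep_dim M); elim: m M => // m ih M; rewrite ltnS => le_m.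
have [[B MB]|nM] := pselect (direct_summand (K I) M); last first.
  by exists 0%N, M; split => //; apply: dsum_rep0_iso.
have [|n [N [BN nN]]] := ih B.
  apply: leq_trans le_m; rewrite (rep_dim_iso MB) rep_dim_dsum -addn1 addnC.
  rewrite leq_add2r /rep_dim; have [x xI] := int_neq0 I.
  by rewrite (bigD1 x) //= dim_interval xI.
exists n.+1, N; split=> //; apply: iso_trans MB _.
exact: iso_trans (iso_dsumr _ BN) (dsumA_iso _ _ _).
Qed.

(** The pairing has rank n on the n copies of k_I that were split off and rank 0 on the rest. As
    this rank depends on M alone, every choice of splitting gives the same number. *)
Lemma multiplicity_rank M I : pairing_rank M I (multiplicity M I).
Proof.
have [|N [MN nN]] := @theP _ 0%N (fun n => exists N,
  iso M (dsum (rpow (K I) n) N) /\ ~ direct_summand (K I) N).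
  by have [n [N h]] := multiplicity_split M I; exists n, N.
apply: (pairing_rank_iso (iso_sym MN)); rewrite -[multiplicity _ _]addn0.
exact: pairing_rank_dsum (pairing_rank_rpow _ _) (pairing_rank_not_summand nN).
Qed.

Lemma multiplicityE M I n : pairing_rank M I n -> multiplicity M I = n.
Proof. exact/pairing_rank_uniq/multiplicity_rank. Qed.

Lemma multiplicity_iso M N I : iso M N -> multiplicity M I = multiplicity N I.
Proof.
by move=> MN; apply/multiplicityE/(pairing_rank_iso (iso_sym MN))/multiplicity_rank.
Qed.

Lemma multiplicity_dsum M N I :
  multiplicity (dsum M N) I = (multiplicity M I + multiplicity N I)%N.
Proof. by apply/multiplicityE/pairing_rank_dsum; apply: multiplicity_rank. Qed.

Lemma multiplicity_interval J I : multiplicity (K J) I = (J == I).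
Proof. exact/multiplicityE/pairing_rank_interval. Qed.

Lemma multiplicity_zero M I : is_zero M -> multiplicity M I = 0%N.
Proof. by move=> M0; apply/multiplicityE/pairing_rank_zero. Qed.

Lemma interval_decomposable_dim C x : interval_decomposable C ->
  \dim {: C x} = (\sum_I multiplicity C I * (x \in val I))%N.
Proof.
move=> [s Cs]; rewrite (iso_dim x Cs).
under eq_bigr do rewrite (multiplicity_iso _ Cs).
elim: s {Cs} => [|J s ih].
  rewrite big1 => [|I _]; first by rewrite rep0_is_zero.
  by rewrite multiplicity_zero //; apply: rep0_is_zero.
set N := foldr _ _ s in ih *.
rewrite -[foldr _ _ _]/(dsum (K J) N) dim_dsum ih dim_interval.
under [RHS]eq_bigr do rewrite multiplicity_dsum multiplicity_interval mulnDl.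
rewrite big_split; congr (_ + _)%N.
rewrite (bigD1 J) //= eqxx mul1n big1 ?addn0 // => I IJ.
by rewrite eq_sym (negbTE IJ).
Qed.
End Multiplicity.

(** * Minimal interval resolutions *)

Section IntervalResolutions.
Variables (k : fieldType) (d : Order.disp_t) (P : finPOrderType d).
Implicit Types (L M N C : rep k P) (I J : Int P).
Local Notation K := (interval_rep k).

Lemma hom_bij_iso M N (f : hom M N) :
  (forall x v, f x v = 0 -> v = 0) -> (forall x, limg (f x) = fullv) -> is_iso f.
Proof.
move=> inj surj.
have ker0 x : lker (f x) == 0%VS.
  rewrite -subv0; apply/subvP => v; rewrite memv_ker memv0 => /eqP/inj->.
  exact: eqxx.
have fK x v : (f x)^-1%VF (f x v) = v by apply: lker0_lfunK.
have Kf x w : f x ((f x)^-1%VF w) = w by apply: limg_lfunVK; rewrite surj memvf.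
have nat (x y : P) (h : (x <= y)%O) :
    ((f y)^-1 \o rmap N h)%VF = (rmap M h \o (f x)^-1)%VF.
  apply/lfunP => w; apply: (can_inj (fK y)).
  by rewrite !comp_lfunE Kf hom_nat Kf.
by exists (Hom nat); split; apply: homP => x v; rewrite hom_compE hom_idE ?fK ?Kf.
Qed.

Lemma inj_endo_iso M (f : hom M M) :
  (forall x v, f x v = 0 -> v = 0) -> is_iso f.
Proof.
move=> inj; apply: hom_bij_iso => // x; apply: lker0_limgf.
rewrite -subv0; apply/subvP => v; rewrite memv_ker memv0 => /eqP/inj->.
exact: eqxx.
Qed.

(** Lifting each cover through the other gives maps both ways; the composites fix the cover maps and
    are automorphisms by minimality. *)
Lemma interval_cover_iso M M' C C' (F : hom C M) (F' : hom C' M') (s : hom M M') :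
  is_interval_cover F -> is_interval_cover F' -> is_iso s ->
  exists2 t : hom C C', is_iso t & comphom F' t = comphom s F.
Proof.
move=> [Ci lift min] [Ci' lift' min'] [s' [s's ss']].
have [t tE] := lift' _ (comphom s F) Ci.
have [t' tE'] := lift _ (comphom s' F') Ci'.
exists t => //; apply: (@iso_of_comps _ _ _ _ _ _ t').
  by apply: min; rewrite comphomA tE' -comphomA tE comphomA s's comphom1l.
by apply: min'; rewrite comphomA tE -comphomA tE' comphomA ss' comphom1l.
Qed.

Lemma interval_decomposable_dsum C C' : interval_decomposable C ->
  interval_decomposable C' -> interval_decomposable (dsum C C').
Proof.
move=> [s [f fI]] [s' [f' fI']]; exists (s ++ s').
apply: (@iso_trans _ _ _ _ (dsum (foldr (fun I N => dsum (K I) N) rep0 s)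
    (foldr (fun I N => dsum (K I) N) rep0 s'))).
  by exists (dsum_hom f f'); apply: dsum_hom_iso.
elim: s {f fI} => [|I s ih]; first exact/iso_sym/dsum_rep0_iso.
set A := foldr _ _ s in ih *; set B := foldr _ _ s' in ih *.
set D := foldr _ _ (s ++ s') in ih.
rewrite -[foldr _ _ (I :: s)]/(dsum (K I) A).
rewrite -[foldr _ _ ((I :: s) ++ s')]/(dsum (K I) D).
exact: iso_trans (iso_sym (dsumA_iso _ _ _)) (iso_dsumr _ ih).
Qed.

(* If h = [a b; c e] fixes F (+) G, then a and the Schur complement
   e - c a^-1 b fix F and G respectively. *)
Lemma dsum_interval_cover M C (F : hom C M) M' C' (G : hom C' M') :
  is_interval_cover F -> is_interval_cover G ->
  is_interval_cover (dsum_hom F G).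
Proof.
move=> [Ci lift min] [Ci' lift' min']; split.
- exact: interval_decomposable_dsum.
- move=> D g Di; have [u uE] := lift _ (comphom (pr1 _ _) g) Di.
  have [v vE] := lift' _ (comphom (pr2 _ _) g) Di.
  exists (comphom (in1 _ _) u + comphom (in2 _ _) v).
  apply: dsum_ext; rewrite comphomA.
    by rewrite pr1_dsum_hom -comphomA pr1_pair uE.
  by rewrite pr2_dsum_hom -comphomA pr2_pair vE.
- move=> h hE.
  have hF x v w : F x (h x (v, w)).1 = F x v.
    by have := comphom_at ((v, w) : dsum C C' x) hE; rewrite !dsum_homE => -[].
  have hG x v w : G x (h x (v, w)).2 = G x w.
    by have := comphom_at ((v, w) : dsum C C' x) hE; rewrite !dsum_homE => -[].
  pose a := comphom (pr1 _ _) (comphom h (in1 C C')).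
  pose b := comphom (pr1 _ _) (comphom h (in2 C C')).
  pose c := comphom (pr2 _ _) (comphom h (in1 C C')).
  pose e := comphom (pr2 _ _) (comphom h (in2 C C')).
  have aE x v : a x v = (h x (v, 0)).1 by rewrite !hom_compE in1E pr1E.
  have bE x v : b x v = (h x (0, v)).1 by rewrite !hom_compE in2E pr1E.
  have cE x v : c x v = (h x (v, 0)).2 by rewrite !hom_compE in1E pr2E.
  have eE x v : e x v = (h x (0, v)).2 by rewrite !hom_compE in2E pr2E.
  have [a' [a'a aa']] : is_iso a.
    by apply: min; apply: homP => x v; rewrite hom_compE aE hF.
  pose s := e - comphom c (comphom a' b).
  have [s' [s's _]] : is_iso s.
    apply: min'; apply: homP => x v; rewrite hom_compE hom_subE lfunD lfunN.
    by rewrite eE hG hom_compE cE hG lfun0 subr0.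
  have hD x v w : h x (v, w) = h x (v, 0) + h x (0, w).
    by rewrite -lfunD; congr (h x _); congr pair; rewrite /= ?addr0 ?add0r.
  apply: inj_endo_iso => x [v w]; rewrite hD => hvw.
  have e1 : a x v + b x w = 0 by rewrite aE bE; have := congr1 fst hvw.
  have e2 : c x v + e x w = 0 by rewrite cE eE; have := congr1 snd hvw.
  have vE : v = - a' x (b x w).
    have av : a x v = - b x w by apply/eqP; rewrite -addr_eq0 e1.
    by rewrite -[LHS](hom_idE (M := C)) -a'a hom_compE av lfunN.
  have w0 : w = 0.
    rewrite -[LHS](hom_idE (M := C')) -s's hom_compE.
    rewrite (_ : s x w = 0) ?lfun0 //.
    by rewrite hom_subE (hom_compE c) (hom_compE a') -e2 vE lfunN addrC.
  by rewrite vE w0 !lfun0 oppr0.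
Qed.

Local Notation cov M := (projT2 (interval_cover M)).

Lemma syzygyS n M : syzygy n.+1 M = ker (cov (syzygy n M)).
Proof. by []. Qed.

Lemma syzygy_iso n M N : iso M N -> iso (syzygy n M) (syzygy n N).
Proof.
elim: n => // n ih /ih [s sI].
have [t tI sq] := interval_cover_iso (interval_coverP (syzygy n M))
  (interval_coverP (syzygy n N)) sI.
exact: kernel_iso (ker_is_kernel _) (ker_is_kernel _) tI sI sq.
Qed.

Lemma syzygy_dsum n M N :
  iso (syzygy n (dsum M N)) (dsum (syzygy n M) (syzygy n N)).
Proof.
elim: n => [|n [s sI]]; first exact: iso_refl.
have [t tI sq] := interval_cover_iso (interval_coverP (syzygy n (dsum M N)))
  (dsum_interval_cover (interval_coverP (syzygy n M))
    (interval_coverP (syzygy n N))) sI.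
exact: kernel_iso (ker_is_kernel _)
  (dsum_is_kernel (ker_is_kernel _) (ker_is_kernel _)) tI sI sq.
Qed.

Lemma betti_cover n M C (F : hom C (syzygy n M)) J :
  is_interval_cover F -> betti n M J = (multiplicity C J)%:Z.
Proof.
move=> FC; rewrite ffunE; congr (_%:Z); apply: multiplicity_iso.
have [|t tI _] := interval_cover_iso (interval_coverP (syzygy n M)) FC
  (s := idhom _); last by exists t.
by exists (idhom _); rewrite comphom1l.
Qed.

Lemma betti_iso n M N : iso M N -> betti n M = betti n N.
Proof.
move=> MN; apply/ffunP => J; rewrite !ffunE; congr (_%:Z).
apply: multiplicity_iso; have [s sI] := syzygy_iso n MN.
have [t tI _] := interval_cover_iso (interval_coverP (syzygy n M))
  (interval_coverP (syzygy n N)) sI.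
by exists t.
Qed.

Lemma betti_dsum n M N : betti n (dsum M N) = betti n M + betti n N.
Proof.
apply/ffunP => J; rewrite !ffunE -PoszD -multiplicity_dsum; congr (_%:Z).
apply: multiplicity_iso; have [s sI] := syzygy_dsum n M N.
have [t tI _] := interval_cover_iso (interval_coverP (syzygy n (dsum M N)))
  (dsum_interval_cover (interval_coverP (syzygy n M))
    (interval_coverP (syzygy n N))) sI.
by exists t.
Qed.

(* A summand of the n-th term of a minimal interval resolution meets, over each
   of its points x, a summand of the preceding term along a nonzero map that is
   not an isomorphism. *)
Lemma syzygy_height n M m (J : 'I_m -> Int P)
    (i : forall t, hom (K (J t)) (projT1 (interval_cover (syzygy n M)))) p t x :
  decomposition i p -> x \in val (J t) -> (n <= reach_height k x (J t))%N.
Proof.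
elim: n m J i p t => // n ih m J i p t D xJ.
have covn := interval_coverP (syzygy n M).
have [m' [J' [i' [p' D']]]] : exists m (J : 'I_m -> Int P),
    decomposes (projT1 (interval_cover (syzygy n M))) (fun t => K (J t)).
  by apply/interval_decomposableP; case: covn.
pose w := comphom (ker_inc (cov (syzygy n M)))
  (comphom (cov (syzygy n.+1 M)) (i t)).
have w0 : comphom (cov (syzygy n M)) w = 0.
  by rewrite comphomA ker_incK comphom0l.
have [|u pw] := @hcoef_component k d P _ _ _ _ _ D' _ w x.
  rewrite hom_compE; apply/negP => /eqP.
  rewrite -(lfun0 (ker_inc (cov (syzygy n M)) x)) => /ker_inc_inj/eqP.
  rewrite hom_compE; apply/negP.
  exact: cover_summand_inj D (interval_coverP (syzygy n.+1 M)) _ _ xJ.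
have lt := radical_height (cover_radical D' covn) w0 pw.
apply: leq_ltn_trans lt; apply: ih D' _.
by have [] := hcoef_neq0 pw.
Qed.

Lemma betti_eq0 n M J : (#|{: Int P}| <= n)%N -> betti n M J = 0.
Proof.
move=> le_n; rewrite ffunE.
have [m [J' [i [p D]]]] : exists m (J : 'I_m -> Int P),
    decomposes (projT1 (interval_cover (syzygy n M))) (fun t => K (J t)).
  by apply/interval_decomposableP; case: (interval_coverP (syzygy n M)).
have noT (t : 'I_m) : False.
  have [x xJ] := int_neq0 (J' t).
  have := leq_trans le_n (syzygy_height D xJ).
  by rewrite leqNgt reach_height_max.
congr (_%:Z); apply/multiplicityE/pairing_rank0 => a b.
by rewrite (decomposition_sum a D) big1 ?comphom0r // => t; case: (noT t).
Qed.

(** A vector v at x is the image of the generator of k_U, where U is the set of points above x,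
    under the map that transports v along the structure maps. Lifting this map lifts v. *)
Lemma interval_cover_surj M C (F : hom C M) x :
  is_interval_cover F -> limg (F x) = fullv.
Proof.
move=> FC; apply/eqP; rewrite eqEsubv subvf; apply/subvP => v _.
pose U := [set y | (x <= y)%O].
have U_int : is_interval U.
  apply/andP; split.
    apply/forall_inP => y; rewrite inE => xy; apply/forall_inP => z _.
    apply/forallP => w; apply/implyP => /andP[yw _].
    by rewrite inE (le_trans xy yw).
  apply/andP; split; first by apply/set0Pn; exists x; rewrite inE.
  apply/forall_inP => y; rewrite inE => xy; apply/forall_inP => z.
  rewrite inE => xz; apply: (@connect_trans _ _ x); apply: connect1;
    by rewrite !inE ?lexx ?xy ?xz /Order.comparable ?xy ?xz ?orbT.
pose UI : Int P := exist _ U U_int.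
pose w y := if pselect (x <= y)%O is left h then rmap M h v else 0.
have wE y (h : (x <= y)%O) : w y = rmap M h v.
  rewrite /w; case: pselect => [h'|//].
  by rewrite (bool_irrelevance h h').
have w_out y : y \notin val UI -> w y = 0.
  by rewrite inE /w; case: pselect => [h|//]; rewrite h.
have w_nat (y z : P) (h : (y <= z)%O) : y \in val UI -> rmap M h (w y) = w z.
  rewrite inE => xy; rewrite (wE y xy) (wE z (le_trans xy h)).
  by rewrite (rmap_comp M xy h (le_trans xy h)) comp_lfunE.
have [g gE] := cover_approximation FC (int_hom w_out w_nat).
have := int_homE w_out w_nat x; rewrite -gE hom_compE (wE x (lexx x)) rmap_id.
by rewrite id_lfunE => <-; rewrite memv_img ?memvf.
Qed.

Lemma syzygy_dim n M x :
  (\sum_J betti n M J * (x \in val J)%:Z =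
   (\dim {: syzygy n M x} + \dim {: syzygy n.+1 M x})%:Z).
Proof.
have covn := interval_coverP (syzygy n M).
rewrite syzygyS addnC -(interval_cover_surj x covn) ker_dim.
case: covn => Ci _ _; rewrite (interval_decomposable_dim x Ci).
rewrite (big_morph Posz PoszD (erefl (Posz 0))); apply: eq_bigr => J _.
by rewrite ffunE PoszM.
Qed.

Lemma eulerE M J :
  euler M J = \sum_(i < #|{: Int P}|) (-1) ^+ i * betti i M J.
Proof.
rewrite ffunE.
rewrite (@fsbig_ord _ 0 +%R _ (fun i => (-1) ^+ i * betti i M J)).
apply/esym/fsbig_widen => // i [_ /= /negP]; rewrite -leqNgt => le_i.
by rewrite /= betti_eq0 ?mulr0.
Qed.

Lemma euler_iso M N : iso M N -> euler M = euler N.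
Proof.
move=> MN; apply/ffunP => J; rewrite !eulerE; apply: eq_bigr => i _.
by rewrite (betti_iso i MN).
Qed.

Lemma euler_dsum M N : euler (dsum M N) = euler M + euler N.
Proof.
apply/ffunP => J; rewrite [RHS]ffunE !eulerE -big_split; apply: eq_bigr => i _.
by rewrite betti_dsum ffunE mulrDr.
Qed.

Lemma euler_dim M x :
  \sum_J euler M J * (x \in val J)%:Z = (\dim {: M x})%:Z.
Proof.
under eq_bigr do rewrite eulerE mulr_suml.
rewrite exchange_big /=.
(* Each term of the resolution accounts for two consecutive syzygies, so the alternating sum
   telescopes to M and the last syzygy. *)
have tele n : \sum_(i < n) \sum_J (-1) ^+ i * betti i M J * (x \in val J)%:Z =
    (\dim {: M x})%:Z - (-1) ^+ n * (\dim {: syzygy n M x})%:Z.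
  elim: n => [|n ih]; first by rewrite big_ord0 expr0 mul1r subrr.
  rewrite big_ord_recr /= ih.
  under eq_bigr do rewrite -mulrA.
  rewrite -mulr_sumr syzygy_dim PoszD mulrDr exprS mulN1r mulNr opprK.
  by rewrite addrA subrK.
(* In this degree all Betti numbers vanish, so the cover is zero, and with it the syzygy it
   covers. *)
rewrite tele (_ : \dim {: syzygy #|{: Int P}| M x} = 0%N) ?mulr0 ?subr0 //.
have := syzygy_dim #|{: Int P}| M x.
rewrite big1 => [|J _]; last by rewrite betti_eq0 ?mul0r.
by move=> /esym [] /eqP; rewrite addn_eq0 => /andP[/eqP].
Qed.

Lemma interval_cover_id I : is_interval_cover (idhom (K I)).
Proof.
split=> [|C' g _|h]; first exact: interval_rep_decomposable.
  by exists g; rewrite comphom1l.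
by rewrite comphom1l => ->; exists (idhom _); rewrite comphom1l.
Qed.

Lemma betti0_interval I J : betti 0 (K I) J = (I == J)%:Z.
Proof.
rewrite (@betti_cover 0 (K I) _ (idhom (K I))) ?multiplicity_interval //.
exact: interval_cover_id.
Qed.

Lemma rep_zero_dsum M N : is_zero N -> iso (dsum M N) M.
Proof.
move=> N0; exists (pr1 M N), (in1 M N); rewrite pr1_in1 -in_pr; split=> //.
rewrite [X in _ = _ + X](_ : _ = 0) ?addr0 //.
apply: homP => x v; rewrite hom_compE hom_zeroE.
suff -> : pr2 M N x v = 0 by rewrite lfun0.
apply/eqP; rewrite -memv0 (_ : 0%VS = fullv) ?memvf //.
by apply/esym/eqP; rewrite -dimv_eq0 N0.
Qed.

Lemma dim0_eq0 (V : vectType k) (v : V) : \dim {: V} = 0%N -> v = 0.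
Proof.
move=> /eqP; rewrite dimv_eq0 => /eqP V0.
by apply/eqP; rewrite -memv0 -V0 memvf.
Qed.

Lemma euler_interval I J : euler (K I) J = (I == J)%:Z.
Proof.
have K1 : is_zero (syzygy 1 (K I)).
  move=> x; have := syzygy_dim 0 (K I) x.
  rewrite (bigD1 I) //= betti0_interval eqxx mul1r big1 => [|L LI]; last first.
    by rewrite betti0_interval eq_sym (negbTE LI) mul0r.
  rewrite addr0 dim_interval => -[] /eqP; rewrite -[X in X == _]addn0 eqn_add2l.
  by move=> /eqP.
have Kn n : is_zero (syzygy n.+1 (K I)).
  elim: n => // n ih x; have covn := interval_coverP (syzygy n.+1 (K I)).
  rewrite syzygyS; apply/eqP; rewrite -leqn0.
  (* The zero endomorphism fixes the cover map of a zero representation, and minimality makes it an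
     automorphism; so the cover is zero. *)
  have C0 : \dim {: projT1 (interval_cover (syzygy n.+1 (K I))) x} = 0%N.
    case: covn => [[s [f [g [gf fg]]]] _ min].
    apply/eqP; rewrite dimv_eq0 -subv0; apply/subvP => v _; rewrite memv0.
    have [|h [_ ]] := min 0.
      by apply: homP => y u; rewrite [LHS]dim0_eq0 ?ih // [RHS]dim0_eq0 ?ih.
    by rewrite comphom0l -[v]hom_idE => <-; rewrite hom_zeroE.
  rewrite -C0; have := ker_dim (cov (syzygy n.+1 (K I))) x.
  by move=> <-; rewrite leq_addr.
rewrite eulerE.
have : (0 < #|{: Int P}|)%N by apply/card_gt0P; exists I.
case: #|_| => // n _; rewrite big_ord_recl expr0 mul1r betti0_interval.
rewrite big1 ?addr0 // => i _; rewrite (@betti_cover _ _ rep0 0).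
  by rewrite multiplicity_zero ?mulr0 //; apply: rep0_is_zero.
split=> [|C' g _|h _]; first by exists [::]; apply: iso_refl.
  exists 0; apply: homP => x v; rewrite hom_compE hom_zeroE.
  by rewrite [RHS]dim0_eq0 // Kn.
exists 0; split; apply: homP => x v; rewrite [LHS]dim0_eq0 ?rep0_is_zero //;
  by rewrite [RHS]dim0_eq0 ?rep0_is_zero.
Qed.

Lemma indecomposable_interval M : indecomposable M ->
  interval_decomposable M -> exists I, iso M (K I).
Proof.
move=> [M0 ind] [[|I s] Ms].
  by case: M0 => x; rewrite (iso_dim x Ms) rep0_is_zero.
exists I; pose N := foldr (fun I N => dsum (K I) N) rep0 s.
have {}Ms : iso M (dsum (K I) N) := Ms.
have [K0|N0] := ind _ _ Ms; last exact: iso_trans Ms (rep_zero_dsum _ N0).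
by have [x xI] := int_neq0 I; have := K0 x; rewrite dim_interval xI.
Qed.

Lemma euler_neq_betti0 M : indecomposable M -> (forall I, ~ iso M (K I)) ->
  euler M <> betti 0 M.
Proof.
move=> Mi nK e; have cov0 := interval_coverP M.
have [I KI] : exists I, iso M (K I); last exact: nK KI.
apply: indecomposable_interval => //.
(* The Euler characteristic counts the dimension of M, while beta_0 counts that of its cover, which
   is M plus the first syzygy. *)
have ker0 x : \dim {: syzygy 1 M x} = 0%N.
  have := syzygy_dim 0 M x; rewrite -e euler_dim => -[] /esym/eqP.
  by rewrite -[X in _ == X]addn0 eqn_add2l => /eqP.
have MC : iso (projT1 (interval_cover M)) M.
  exists (cov M); apply: hom_bij_iso => x; last exact: interval_cover_surj.
  move=> v /ker_mem[u ->]; have -> : u = 0 by apply/dim0_eq0/ker0.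
  exact: lfun0.
case: cov0 => [[s Cs] _ _]; exists s; exact: iso_trans (iso_sym MC) Cs.
Qed.

Lemma euler_neq0 M : ~ is_zero M -> euler M <> 0.
Proof.
move=> M0 e; apply: M0 => x; have := euler_dim M x; rewrite e.
by rewrite big1 => [[]//|J _]; rewrite ffunE mul0r.
Qed.

Lemma betti0_neq0 M : ~ is_zero M -> betti 0 M <> 0.
Proof.
move=> M0 e; apply: M0 => x; have := syzygy_dim 0 M x; rewrite e.
rewrite big1 => [|J _]; last by rewrite ffunE mul0r.
by move=> /esym [] /eqP; rewrite addn_eq0 => /andP[/eqP].
Qed.

Lemma multiplicity_indecomposable M I : indecomposable M ->
  (forall I, ~ iso M (K I)) -> multiplicity M I = 0%N.
Proof.
move=> [M0 ind] nK; apply: multiplicityE; apply: pairing_rank_not_summand.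
move=> [B MB]; have [K0|B0] := ind _ _ MB.
  by have [x xI] := int_neq0 I; have := K0 x; rewrite dim_interval xI.
exact: nK (iso_trans MB (rep_zero_dsum _ B0)).
Qed.
End IntervalResolutions.

(** * Generalized ranks and persistence diagrams *)

Section Limits.
Variables (k : fieldType) (d : Order.disp_t) (Q : finPOrderType d).
Variable M : rep k Q.

Lemma limit_exists : exists L : cone M, is_limit L.
Proof.
have [W [p [inj surj]]] := @product_exists k Q (fun x => M x).
pose R w := forall (x y : Q) (h : (x <= y)%O), rmap M h (p x w) = p y w.
have [|a u v Ru Rv x y h|U HU] := @vspace_of_pred k W R.
- by move=> x y h; rewrite !lfun0.
- by rewrite !(lfunD, lfunZ) Ru Rv.
pose leg x : 'Hom(subvs_of U, M x) := (p x \o linfun vsval)%VF.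
have legE x u : leg x u = p x (vsval u) by rewrite comp_lfunE [linfun _ _]lfunE.
have compat (x y : Q) (h : (x <= y)%O) : (rmap M h \o leg x)%VF = leg y.
  apply/lfunP => u; rewrite comp_lfunE !legE.
  by have /HU := subvsP u; apply.
exists (Cone compat) => L'.
pose w l := projT1 (cid (surj (fun x => cone_leg L' x l))).
have wE l x : p x (w l) = cone_leg L' x l by rewrite /w; case: cid.
have w_uniq l u : (forall x, p x u = cone_leg L' x l) -> u = w l.
  move=> e; apply/eqP; rewrite -subr_eq0; apply/eqP/inj => x.
  by rewrite lfunD lfunN e wE subrr.
have w_lin : linear w.
  move=> a l l'; apply/esym/w_uniq => x.
  by rewrite !lfunD !lfunZ !wE.
have wU l : w l \in U.
  by apply/HU => x y h; rewrite !wE -comp_lfunE cone_compat.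
pose u : 'Hom(L', Cone compat) := (linfun (vsproj U) \o lfun_of w_lin)%VF.
have uE l : vsval (u l) = w l.
  by rewrite comp_lfunE [linfun _ _]lfunE lfun_ofE vsprojK.
exists u; split=> [x|u' u'E]; apply/lfunP => l.
  by rewrite comp_lfunE [LHS]legE uE wE.
apply: subvs_inj; rewrite uE; apply/esym/w_uniq => x.
by rewrite -u'E comp_lfunE [RHS]legE.
Qed.

Lemma colimit_exists : exists C : cocone M, is_colimit C.
Proof.
have [W [i [p [pi1 pi0 ip]]]] := @biproduct_exists k Q (fun x => M x).
(* The smallest subspace containing all relations, described as the intersection of the subspaces
   that contain them. *)
pose R w := forall U : {vspace W}, (forall (x y : Q) (h : (x <= y)%O) v,
  i y (rmap M h v) - i x v \in U) -> w \in U.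
have [|a u v Ru Rv U h|U HU] := @vspace_of_pred k W R.
- by move=> U _; apply: mem0v.
- by rewrite memvD ?memvZ ?Ru ?Rv.
have [C [q [s [qU qs]]]] := quotient_exists U.
have q0 w : w \in U -> q w = 0 by rewrite -qU memv_ker => /eqP.
have qsK c : q (s c) = c by rewrite -comp_lfunE qs id_lfunE.
pose leg x : 'Hom(M x, C) := (q \o i x)%VF.
have compat (x y : Q) (h : (x <= y)%O) : (leg y \o rmap M h)%VF = leg x.
  apply/lfunP => v; rewrite !comp_lfunE; apply/eqP; rewrite -subr_eq0 -lfunN -lfunD.
  by apply/eqP/q0/HU => U'; apply.
exists (Cocone compat) => C'.
pose g : 'Hom(W, C') := \sum_x (cocone_leg C' x \o p x)%VF.
have gE w : g w = \sum_x cocone_leg C' x (p x w).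
  by rewrite sum_lfunE; apply: eq_bigr => x _; rewrite comp_lfunE.
have gi x v : g (i x v) = cocone_leg C' x v.
  rewrite gE (bigD1 x) //= pi1 big1 ?addr0 // => y yx.
  by rewrite pi0 ?lfun0 // eq_sym.
have gU w : w \in U -> g w = 0.
  move/HU/(_ (lker g)) => h; apply/eqP; rewrite -memv_ker; apply: h.
  move=> x y h v; rewrite memv_ker lfunD lfunN !gi subr_eq0.
  by rewrite -comp_lfunE cocone_compat.
pose u : 'Hom(Cocone compat, C') := (g \o s)%VF.
exists u; split=> [x|u' u'E]; apply/lfunP => v.
  rewrite !comp_lfunE -gi; apply/eqP; rewrite -subr_eq0 -lfunN -lfunD.
  by apply/eqP/gU; rewrite -qU memv_ker lfunD lfunN qsK subrr.
rewrite -[v in RHS]qsK comp_lfunE -[s v]ip !lfun_sum; apply: eq_bigr => x _.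
by rewrite gi -u'E !comp_lfunE.
Qed.
End Limits.

(** * Generalized ranks through cones and cocones, and their inversion *)

Section GeneralizedRank.
Variables (k : fieldType) (d : Order.disp_t) (P : finPOrderType d).
Implicit Types (M N : rep k P) (I J : Int P).
Local Notation K := (interval_rep k).

Lemma limg_dim_le (V W : vectType k) (f : 'Hom(V, W)) U :
  (\dim (f @: U) <= \dim U)%N.
Proof. by rewrite -(limg_ker_dim f U) leq_addl. Qed.

Lemma limg_dim_comp (V' V W W' : vectType k) (e : 'Hom(W, W'))
    (f : 'Hom(V, W)) (w : 'Hom(V', V)) :
  (\dim (limg (e \o f \o w)) <= \dim (limg f))%N.
Proof.
rewrite !limg_comp (leq_trans (limg_dim_le _ _)) //.
by apply/dimvS/limgS/subvf.
Qed.

Lemma limg_dim_add (V W : vectType k) (f g : 'Hom(V, W)) :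
  (\dim (limg (f + g)%R) <= \dim (limg f) + \dim (limg g))%N.
Proof.
apply: leq_trans (dimv_add_leqif _ _).1; apply/dimvS/subvP => _ /memv_imgP[v _ ->].
by rewrite add_lfunE memv_add ?memv_img ?memvf.
Qed.

Definition cone_on M I (V : vectType k)
    (a : forall x : subposet (val I), 'Hom(V, M (val x))) :=
  forall (x y : subposet (val I)) (h : (val x <= val y)%O),
    (rmap M h \o a x)%VF = a y.

Definition cocone_on M I (W : vectType k)
    (b : forall x : subposet (val I), 'Hom(M (val x), W)) :=
  forall (x y : subposet (val I)) (h : (val x <= val y)%O),
    (b y \o rmap M h)%VF = b x.

Definition int_point I x (xI : x \in val I) : subposet (val I) := exist _ x xI.

(** The composites agree at comparable points, and I is connected. This is why the canonical map
    from limit to colimit does not depend on the point. *)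
Lemma cone_cocone_const M I V a W b : @cone_on M I V a -> @cocone_on M I W b ->
  forall x y, (b x \o a x)%VF = (b y \o a y)%VF.
Proof.
move=> ca cb [x xI] y.
pose R z := `[< forall zI : z \in val I, (b (int_point zI) \o a (int_point zI))%VF
  = (b y \o a y)%VF >].
suff /asboolP/(_ xI) : R x by [].
case: y @R => [y yI] R.
apply: (@int_connected d P I R y) => //.
  by apply/asboolP => zI; rewrite (bool_irrelevance zI yI).
have step z w (zI : z \in val I) (wI : w \in val I) : (z <= w)%O ->
    (b (int_point zI) \o a (int_point zI))%VF =
    (b (int_point wI) \o a (int_point wI))%VF.
  move=> zw; rewrite -(ca (int_point zI) (int_point wI) zw).
  by rewrite -(cb (int_point zI) (int_point wI) zw) comp_lfunA.
move=> z w zI wI /orP[] zw /asboolP h; apply/asboolP => wI'.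
  by rewrite -(step _ _ zI wI' zw) h.
by rewrite (step _ _ wI' zI zw) h.
Qed.

Lemma generalized_rankP M I :
  is_canonical_rank (restrict M (val I)) (generalized_rank M I).
Proof.
apply: (@theP _ 0%N); have [x xI] := int_neq0 I.
have [L Ll] := limit_exists (restrict M (val I)).
have [C Cc] := colimit_exists (restrict M (val I)).
pose phi := (cocone_leg C (int_point xI) \o cone_leg L (int_point xI))%VF.
exists (\dim (limg phi)), L, C, phi; split=> // y.
apply: (@cone_cocone_const M I _ (cone_leg L) _ (cocone_leg C)).
  by move=> z w h; apply: (@cone_compat _ _ _ (restrict M (val I)) L z w h).
by move=> z w h; apply: (@cocone_compat _ _ _ (restrict M (val I)) C z w h).
Qed.

Lemma rank_attained M I : exists (V W : vectType k) a b (phi : 'Hom(V, W)),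
  [/\ @cone_on M I V a, @cocone_on M I W b, forall x, phi = (b x \o a x)%VF
    & generalized_rank M I = \dim (limg phi)].
Proof.
have [L [C [phi [_ _ h rE]]]] := generalized_rankP M I.
exists L, C, (cone_leg L), (cocone_leg C), phi; split=> // x y xy.
  exact: (@cone_compat _ _ _ (restrict M (val I)) L x y xy).
exact: (@cocone_compat _ _ _ (restrict M (val I)) C x y xy).
Qed.

(** Every cone and cocone factors through the limit and the colimit, and rank cannot grow by
    composition. Together with [rank_attained], this makes the generalized rank the largest rank of
    a composite of a cone with a cocone, the form used below. *)
Lemma rank_ge M I V a W b x : @cone_on M I V a -> @cocone_on M I W b ->
  (\dim (limg (b x \o a x)) <= generalized_rank M I)%N.
Proof.
move=> ca cb; have [L [C [phi [Ll Cc h ->]]]] := generalized_rankP M I.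
pose A := @Cone _ _ _ (restrict M (val I)) V a ca.
pose B := @Cocone _ _ _ (restrict M (val I)) W b cb.
have [w [wE _]] := Ll A; have [e [eE _]] := Cc B.
rewrite -[b x](eE x) -[a x](wE x) comp_lfunA -(comp_lfunA e) -(h x).
exact: limg_dim_comp.
Qed.

Lemma rank_iso_le M N I : iso M N ->
  (generalized_rank N I <= generalized_rank M I)%N.
Proof.
move=> [f [g [gf fg]]]; have [V [W [a [b [phi [ca cb h ->]]]]]] := rank_attained N I.
have [x0 x0I] := int_neq0 I; pose x := int_point x0I.
have -> : phi = ((b x \o f (val x)) \o (g (val x) \o a x))%VF.
  apply/lfunP => v; rewrite (h x) !comp_lfunE.
  by rewrite (comphom_at (a x v) fg) hom_idE.
apply: (@rank_ge M I V (fun x => g (val x) \o a x)%VF W (fun x => b x \o f (val x))%VF).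
  by move=> y z h'; rewrite comp_lfunA -hom_natural -comp_lfunA ca.
by move=> y z h'; rewrite -comp_lfunA hom_natural comp_lfunA cb.
Qed.

Lemma rank_iso M N I : iso M N -> generalized_rank M I = generalized_rank N I.
Proof.
move=> MN; apply/eqP.
by rewrite eqn_leq (rank_iso_le I (iso_sym MN)) (rank_iso_le I MN).
Qed.

Lemma limg_dim_prod (V V' W W' : vectType k) (f : 'Hom(V, W)) (g : 'Hom(V', W'))
    (h : 'Hom((V * V')%type, (W * W')%type)) :
  (forall v v', h (v, v') = (f v, g v')) ->
  (\dim (limg f) + \dim (limg g) <= \dim (limg h))%N.
Proof.
move=> hE; pose e (u : subvs_of (limg f) * subvs_of (limg g)) : W * W' :=
  (vsval u.1, vsval u.2).
have el : linear e.
  by move=> a [u u'] [v v']; rewrite /e; congr pair; rewrite /= linearP.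
rewrite (_ : addn _ _ = \dim (limg (lfun_of el))); last first.
  rewrite [RHS]limg_dim_eq; first by rewrite dimvf.
  apply/eqP; rewrite -subv0; apply/subvP => -[u v]; rewrite memv_cap memvf /=.
  rewrite memv_ker lfun_ofE /e /= memv0 => /eqP[u0 v0].
  by apply/eqP; congr pair; apply: subvs_inj.
apply/dimvS/subvP => _ /memv_imgP[[u v] _ ->]; rewrite lfun_ofE /e /=.
have /memv_imgP[u' _ ->] := subvsP u; have /memv_imgP[v' _ ->] := subvsP v.
by rewrite -hE memv_img ?memvf.
Qed.

(** Upper bound: the identity of the sum splits as [in1 pr1 + in2 pr2], and rank is subadditive.
    Lower bound: the products of optimal cones and cocones are again a cone and a cocone. *)
Lemma rank_dsum M N I : generalized_rank (dsum M N) I =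
  (generalized_rank M I + generalized_rank N I)%N.
Proof.
have [x0 x0I] := int_neq0 I; pose x := int_point x0I.
apply/eqP; rewrite eqn_leq; apply/andP; split.
  have [V [W [a [b [phi [ca cb h ->]]]]]] := rank_attained (dsum M N) I.
  have -> : phi = (((b x \o in1 M N (val x)) \o (pr1 M N (val x) \o a x))
      + ((b x \o in2 M N (val x)) \o (pr2 M N (val x) \o a x)))%VF.
    apply/lfunP => v; rewrite (h x) add_lfunE !comp_lfunE -lfunD.
    by rewrite -[in LHS](hom_idE (a x v)) -in_pr hom_addE !hom_compE.
  apply: leq_trans (limg_dim_add _ _) (leq_add _ _).
    apply: (@rank_ge M I V (fun x => pr1 M N (val x) \o a x)%VF
      W (fun x => b x \o in1 M N (val x))%VF).
      by move=> y z h'; rewrite comp_lfunA -hom_natural -comp_lfunA ca.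
    by move=> y z h'; rewrite -comp_lfunA hom_natural comp_lfunA cb.
  apply: (@rank_ge N I V (fun x => pr2 M N (val x) \o a x)%VF
    W (fun x => b x \o in2 M N (val x))%VF).
    by move=> y z h'; rewrite comp_lfunA -hom_natural -comp_lfunA ca.
  by move=> y z h'; rewrite -comp_lfunA hom_natural comp_lfunA cb.
have [V [W [a [b [phi [ca cb h ->]]]]]] := rank_attained M I.
have [V' [W' [a' [b' [phi' [ca' cb' h' ->]]]]]] := rank_attained N I.
have al y : linear (fun v : V * V' => (a y v.1, a' y v.2)).
  by move=> c u v; rewrite /= !lfunD !lfunZ.
have bl y : linear (fun w : M (val y) * N (val y) => (b y w.1, b' y w.2)).
  by move=> c u v; rewrite /= !lfunD !lfunZ.
pose A (y : subposet (val I)) : 'Hom((V * V')%type, dsum M N (val y)) := lfun_of (al y).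
pose B (y : subposet (val I)) : 'Hom(dsum M N (val y), (W * W')%type) := lfun_of (bl y).
have AE y v : A y v = (a y v.1, a' y v.2) by apply: lfun_ofE.
have BE y v : B y v = (b y v.1, b' y v.2) by apply: lfun_ofE.
apply: leq_trans (_ : \dim (limg (B x \o A x)) <= _)%N; last first.
  apply: (@rank_ge (dsum M N) I _ A _ B) => y z yz; apply/lfunP => v.
    by rewrite comp_lfunE AE dsumE AE -(ca _ _ yz) -(ca' _ _ yz) !comp_lfunE.
  by rewrite comp_lfunE BE dsumE BE -(cb _ _ yz) -(cb' _ _ yz) !comp_lfunE.
apply: limg_dim_prod => v v'; rewrite comp_lfunE BE AE /=.
by rewrite (h x) (h' x) !comp_lfunE.
Qed.

Lemma rank_eq0 M I x (xI : x \in val I) :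
  (forall (W : vectType k) (b : forall x : subposet (val I), 'Hom(M (val x), W)),
     @cocone_on M I W b -> b (int_point xI) = 0) ->
  generalized_rank M I = 0%N.
Proof.
move=> h; have [V [W [a [b [phi [ca cb e ->]]]]]] := rank_attained M I.
by rewrite (e (int_point xI)) (h _ _ cb) comp_lfun0l lim0g dimv0.
Qed.

Lemma rank_vanishing M I x : x \in val I -> \dim {: M x} = 0%N ->
  generalized_rank M I = 0%N.
Proof.
move=> xI M0; apply: (@rank_eq0 M I x xI) => W b _; apply/lfunP => v.
by rewrite [v](dim0_eq0 _ M0) !lfun0.
Qed.

(* Every element of M x dies in the colimit, so the map from the limit, which
   factors through M x, is zero. *)
Lemma rank_two_kernels M I x y z (xy : (x <= y)%O) (xz : (x <= z)%O) :
  x \in val I -> y \in val I -> z \in val I ->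
  (forall v : M x, exists u w, [/\ v = u + w, rmap M xy u = 0 & rmap M xz w = 0]) ->
  generalized_rank M I = 0%N.
Proof.
move=> xI yI zI h; apply: (@rank_eq0 M I x xI) => W b cb; apply/lfunP => v.
have [u [w [-> u0 w0]]] := h v; rewrite lfunD lfunE.
rewrite -{1}(cb (int_point xI) (int_point yI) xy) comp_lfunE u0 lfun0.
by rewrite -(cb (int_point xI) (int_point zI) xz) comp_lfunE w0 lfun0 addr0.
Qed.

(** Any composite of a cone and a cocone over I factors through M x -> M y, and the structure maps
    out of x and into y form a cone and a cocone whose composite is that map. *)
Lemma rank_min_max M I x y (xy : (x <= y)%O) : x \in val I -> y \in val I ->
  (forall z, z \in val I -> (x <= z)%O) -> (forall z, z \in val I -> (z <= y)%O) ->
  generalized_rank M I = \dim (limg (rmap M xy)).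
Proof.
move=> xI yI xmin ymax; apply/eqP; rewrite eqn_leq; apply/andP; split.
  have [V [W [a [b [phi [ca cb e ->]]]]]] := rank_attained M I.
  rewrite (e (int_point yI)) -(ca (int_point xI) (int_point yI) xy) comp_lfunA.
  exact: limg_dim_comp.
pose a (z : subposet (val I)) := rmap M (xmin (val z) (valP z)).
pose b (z : subposet (val I)) := rmap M (ymax (val z) (valP z)).
have -> : rmap M xy = (b (int_point xI) \o a (int_point xI))%VF.
  exact: rmap_comp.
apply: (@rank_ge M I _ a _ b) => z w zw.
  exact/esym/rmap_comp.
exact/esym/rmap_comp.
Qed.

Lemma rank_interval I J : generalized_rank (K J) I = (val I \subset val J).
Proof.
have [IJ|/subsetPn[x xI xJ]] := boolP (val I \subset val J); last first.
  by apply: (rank_vanishing xI); rewrite dim_interval (negbTE xJ).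
have [x xI] := int_neq0 I; have IJ' := fintype.subsetP IJ.
apply/eqP; rewrite eqn_leq; apply/andP; split.
  have [V [W [a [b [phi [ca cb e ->]]]]]] := rank_attained (K J) I.
  rewrite (e (int_point xI)) limg_comp; apply: leq_trans (limg_dim_le _ _) _.
  apply: leq_trans (dimvS (subvf _)) _.
  by rewrite dim_interval leq_b1.
have al (z : subposet (val I)) : linear (fun c : k^o => c *: one k J (val z)).
  by move=> c u v; rewrite scalerDl scalerA.
have bl (z : subposet (val I)) : linear (fun v : K J (val z) => coef v : k^o).
  by move=> c u v; rewrite coefD coefZ.
pose a z : 'Hom(k^o : vectType k, K J (val z)) := lfun_of (al z).
pose b z : 'Hom(K J (val z), k^o : vectType k) := lfun_of (bl z).
have aE z c : a z c = c *: one k J (val z) by apply: lfun_ofE.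
have bE z c : b z c = coef c by apply: lfun_ofE.
have zJ (z : subposet (val I)) : val z \in val J by apply/IJ'/valP.
apply: leq_trans (_ : \dim (limg (b (int_point xI) \o a (int_point xI))) <= _)%N.
  rewrite lt0n dimv_eq0; apply/eqP => e0.
  have := memv_img (b (int_point xI) \o a (int_point xI)) (memvf (1 : k^o)).
  rewrite e0 memv0 comp_lfunE aE bE coefZ coef_one zJ mulr1.
  by apply/negP/oner_neq0.
apply: rank_ge => z w zw; apply/lfunP => v; rewrite comp_lfunE.
  by rewrite !aE rmapZ rmap_one.
by rewrite !bE {1}[v]coefK rmapZ rmap_one // coefZ coef_one zJ mulr1.
Qed.

(** Values are assigned from the largest intervals downwards, as the value at I involves only
    strictly larger intervals. *)
Lemma moebius_exists (r : Int P -> int) : exists g : {ffun Int P -> int},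
  forall I, r I = \sum_(J : Int P | val I \subset val J) g J.
Proof.
(* No interval satisfies the bound for n = 0, and all do for n = #|P| + 1; the step from n to n + 1
   settles the intervals with exactly #|P| - n points. *)
suff h n : exists g : {ffun Int P -> int}, forall I,
    (#|P| < #|val I| + n)%N -> r I = \sum_(J : Int P | val I \subset val J) g J.
  by have [g gE] := h #|P|.+1; exists g => I; apply: gE; rewrite addnS ltnS leq_addl.
elim: n => [|n [g gE]].
  exists 0 => I; rewrite addn0 ltnNge => /negP[]; exact: max_card.
pose g' := [ffun I : Int P => if (#|P| == #|val I| + n)%N then
  r I - \sum_(J : Int P | (val I \subset val J) && (J != I)) g J else g I].
have below (I J : Int P) : val I \subset val J -> J != I -> (#|val I| < #|val J|)%N.
  move=> IJ neq; apply: proper_card; rewrite properEneq IJ andbT.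
  by apply: contraNneq neq => /val_inj->.
exists g' => I; rewrite addnS ltnS leq_eqVlt => /orP[|lt].
  move=> eI; rewrite (bigD1 I) //= ffunE eI.
  rewrite [X in _ + X](eq_bigr g) ?subrK // => J /andP[IJ neq].
  rewrite ffunE (eqP eI); case: eqP => // e.
  by have := below _ _ IJ neq; rewrite -(ltn_add2r n) e ltnn.
rewrite (gE _ lt); apply: eq_bigr => J IJ; rewrite ffunE.
case: eqP => // e; have := leq_add (subset_leq_card IJ) (leqnn n).
by rewrite -e leqNgt lt.
Qed.

(** The upward closed family R localises the inversion: to find a diagram on the intervals
    containing a given point, only their own ranks are needed. *)
Lemma moebius_uniq (g h : Int P -> int) (R : pred (Int P)) :
  (forall I J : Int P, R I -> val I \subset val J -> R J) ->
  (forall I, R I -> \sum_(J : Int P | val I \subset val J) g J =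
    \sum_(J : Int P | val I \subset val J) h J) ->
  forall I, R I -> g I = h I.
Proof.
move=> up gh I; have [n] := ubnP (#|P| - #|val I|)%N.
elim: n I => // n ih I; rewrite ltnS => le_n RI; have := gh I RI.
rewrite (bigD1 I) // [RHS](bigD1 I) //=.
rewrite [X in _ + X = _](eq_bigr h) => [|J /andP[IJ neq]]; first by move/addIr.
apply: ih; last exact: up IJ.
apply: leq_trans le_n; apply: ltn_sub2l; last first.
  apply: proper_card; rewrite properEneq IJ andbT.
  by apply: contraNneq neq => /val_inj->.
apply: leq_trans (max_card (mem (val J))); apply: proper_card.
rewrite properEneq IJ andbT.
by apply: contraNneq neq => /val_inj->.
Qed.

Lemma diagramP M I : (generalized_rank M I)%:Z =
  \sum_(J : Int P | val I \subset val J) generalized_diagram M J.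
Proof.
move: I; apply: (@theP _ 0 (fun g : {ffun Int P -> int} => forall I : Int P,
  (generalized_rank M I)%:Z = \sum_(J : Int P | val I \subset val J) g J)).
exact: moebius_exists.
Qed.

Lemma diagram_uniq M (g : {ffun Int P -> int}) :
  (forall I, (generalized_rank M I)%:Z = \sum_(J : Int P | val I \subset val J) g J) ->
  generalized_diagram M = g.
Proof.
move=> gE; apply/ffunP => I; apply: (@moebius_uniq _ _ xpredT) => // J _.
by rewrite -diagramP gE.
Qed.

Lemma diagram_iso M N : iso M N -> generalized_diagram M = generalized_diagram N.
Proof.
by move=> MN; apply: diagram_uniq => I; rewrite (rank_iso I MN) diagramP.
Qed.

Lemma diagram_dsum M N :
  generalized_diagram (dsum M N) = generalized_diagram M + generalized_diagram N.
Proof.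
apply: diagram_uniq => I; rewrite rank_dsum PoszD !diagramP -big_split.
by apply: eq_bigr => J _; rewrite ffunE.
Qed.

Lemma diagram_interval J : generalized_diagram (K J) = [ffun I => (J == I)%:Z].
Proof.
apply: diagram_uniq => I; rewrite rank_interval.
have [IJ|IJ] := boolP (val I \subset val J).
  rewrite (bigD1 J) //= ffunE eqxx big1 ?addr0 // => L /andP[_ LJ].
  by rewrite ffunE eq_sym (negbTE LJ).
rewrite big1 // => L IL; rewrite ffunE; case: eqP => // e.
by rewrite e IL in IJ.
Qed.

Lemma singleton_interval (x : P) : is_interval [set x].
Proof.
apply/andP; split.
  apply/forall_inP => y /set1P->; apply/forall_inP => z /set1P->.
  apply/forallP => w; apply/implyP => /andP[xw wx]; apply/set1P/le_anti.
  by rewrite xw wx.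
apply/andP; split; first by apply/set0Pn; exists x; rewrite inE.
apply/forall_inP => y /set1P->; apply/forall_inP => z /set1P->.
exact: connect0.
Qed.

Lemma diagram_neq0 M : ~ is_zero M -> generalized_diagram M <> 0.
Proof.
move=> M0 e; apply: M0 => x.
pose X : Int P := exist _ [set x] (singleton_interval x).
have := diagramP M X; rewrite e big1 => [|J _]; last by rewrite ffunE.
rewrite (rank_min_max M (lexx x)) ?inE // => [|z|z]; try by rewrite inE => /eqP->.
rewrite rmap_id => -[] /eqP; rewrite dimv_eq0 => /eqP e1.
apply/eqP; rewrite dimv_eq0 -e1; apply/eqP/vspaceP => v; rewrite memvf.
by apply/esym; rewrite -[v]id_lfunE memv_img ?memvf.
Qed.
End GeneralizedRank.

(** * The invariants on the split Grothendieck group *)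

Section Incomparability.
Variables (k : fieldType) (d : Order.disp_t) (P : finPOrderType d).
Implicit Types (M N : rep k P) (I J : Int P).
Local Notation K := (interval_rep k).

Lemma piIntE M : piInt k P (K0class M) = [ffun I => (multiplicity M I)%:Z].
Proof.
apply: K0liftE => [A B AB|A B]; apply/ffunP => I; rewrite !ffunE.
  by rewrite (multiplicity_iso I AB).
by rewrite multiplicity_dsum PoszD.
Qed.

Lemma dgmIntE M : dgmInt k P (K0class M) = generalized_diagram M.
Proof. by apply: K0liftE => [A B|A B]; [apply: diagram_iso|apply: diagram_dsum]. Qed.

Lemma betaIntE n M : betaInt k P n (K0class M) = betti n M.
Proof. by apply: K0liftE => [A B|A B]; [apply: betti_iso|apply: betti_dsum]. Qed.

Lemma chiIntE M : chiInt k P (K0class M) = euler M.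
Proof. by apply: K0liftE => [A B|A B]; [apply: euler_iso|apply: euler_dsum]. Qed.

Definition delta_on_intervals (f : {additive K0sp k P -> {ffun Int P -> int}}) :=
  forall I, f (K0class (K I)) = [ffun J => (I == J)%:Z].

Lemma piInt_delta : delta_on_intervals (piInt k P).
Proof.
by move=> I; rewrite piIntE; apply/ffunP => J; rewrite !ffunE multiplicity_interval.
Qed.

Lemma dgmInt_delta : delta_on_intervals (dgmInt k P).
Proof.
move=> I; rewrite dgmIntE diagram_interval; apply/ffunP => J.
by rewrite !ffunE eq_sym.
Qed.

Lemma betaInt_delta : delta_on_intervals (betaInt k P 0).
Proof.
move=> I; rewrite betaIntE; apply/ffunP => J.
by rewrite betti0_interval ffunE.
Qed.

Lemma chiInt_delta : delta_on_intervals (chiInt k P).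
Proof.
move=> I; rewrite chiIntE; apply/ffunP => J.
by rewrite euler_interval ffunE.
Qed.

Lemma not_finer_of_neq f g M : delta_on_intervals f -> delta_on_intervals g ->
  f (K0class M) <> g (K0class M) -> ~ finer f g.
Proof.
move=> fd gd neq fg.
have expand (h : {additive K0sp k P -> {ffun Int P -> int}}) :
    delta_on_intervals h ->
    h (\sum_J K0class (K J) *~ f (K0class M) J) = f (K0class M).
  move=> hd; rewrite raddf_sum; apply/ffunP => I; rewrite sum_ffunE (bigD1 I) //=.
  rewrite raddfMz hd big1 ?addr0 => [|J JI].
    by rewrite ffunMzE ffunE eqxx intz.
  by rewrite raddfMz hd ffunMzE ffunE (negbTE JI) mul0rz.
have := fg (K0class M - \sum_J K0class (K J) *~ f (K0class M) J).
rewrite !raddfB !expand // subrr => /(_ erefl) /eqP.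
by rewrite subr_eq0 => /eqP e; apply: neq.
Qed.

Lemma incomparable_of_neq f g M : delta_on_intervals f -> delta_on_intervals g ->
  f (K0class M) <> g (K0class M) -> incomparable f g.
Proof.
move=> fd gd neq; split; first exact: (not_finer_of_neq fd gd neq).
by apply: (not_finer_of_neq gd fd (M := M)) => e; apply: neq.
Qed.
End Incomparability.

(** * Indecomposables of type D4 *)

Section Socle.
Variables (k : fieldType) (d : Order.disp_t) (P : finPOrderType d).
Implicit Types (M N : rep k P) (I J : Int P).
Local Notation K := (interval_rep k).

Definition point_int (x : P) : Int P := exist _ [set x] (singleton_interval x).

Variables (c : P) (M : rep k P).
Hypothesis socle0 : forall f : hom (K (point_int c)) M, f = 0.

(* The summands of a cover embed, so the simple representation at c embeds
   neither in the cover nor in its kernel. *)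
Lemma cover_socle0 N C (F : hom C N) : is_interval_cover F ->
  (forall f : hom (K (point_int c)) N, f = 0) ->
  forall f : hom (K (point_int c)) C, f = 0.
Proof.
move=> FC N0 f; have [m [J [i [p D]]]] : exists m (J : 'I_m -> Int P),
    decomposes C (fun t => K (J t)).
  by apply/interval_decomposableP; case: FC.
rewrite (decomposition_sum f D) big1 // => t _.
suff -> : comphom (p t) f = 0 by rewrite comphom0r.
apply: hcoef_ext => x /set1P->; rewrite hcoef0.
have [cJ|cJ] := boolP (c \in val (J t)); last exact: hcoef_outr.
have := N0 (comphom F (comphom (i t) (comphom (p t) f))).
move/(congr1 (fun h : hom (K (point_int c)) N => h c (one k (point_int c) c))).
rewrite hom_zeroE (hom_compE F) (hom_compE (i t)) hcoefE !lfunZ => /eqP.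
by rewrite scaler_eq0 (negbTE (cover_summand_inj D FC cJ)) orbF => /eqP.
Qed.

Lemma syzygy_socle0 n (f : hom (K (point_int c)) (syzygy n M)) : f = 0.
Proof.
elim: n f => // n ih f; apply: ker_mono; rewrite comphom0r.
exact: (cover_socle0 (interval_coverP (syzygy n M)) ih).
Qed.

Lemma betti_socle0 n : betti n M (point_int c) = 0.
Proof.
rewrite ffunE; congr (_%:Z); apply/multiplicityE/pairing_rank0 => a b.
by rewrite (cover_socle0 (interval_coverP _) (@syzygy_socle0 n) a) comphom0r.
Qed.

Lemma euler_socle0 : euler M (point_int c) = 0.
Proof. by rewrite eulerE big1 // => i _; rewrite betti_socle0 mulr0. Qed.
End Socle.

(* The kernel of the sum k_A (+) k_B (+) k_C -> k_E of the maps that are the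
   identity on common points.  With centre c = 3, it is the indecomposable of
   dimension 2 at the centre and 1 at the leaves when
   A = {2,3}, B = {3,4}, C = {1,3}, E = {3} in D_{0,3}, and when
   A = {1,2,3}, B = {1,3,4}, C = {3}, E = {1,3} in D_{1,2}; its generalized
   persistence diagram is [A] + [B] + [C] - [E] on intervals containing c. *)
Section ThreeTermKernel.
Variables (k : fieldType) (d : Order.disp_t) (P : finPOrderType d).
Local Notation K := (interval_rep k).

Lemma limg_rank1 (V W : vectType k) (f : 'Hom(V, W)) (l : V -> k) (w : W) v0 :
  w != 0 -> (forall v, f v = l v *: w) -> f v0 = w -> \dim (limg f) = 1%N.
Proof.
move=> w0 fE fv0; suff -> : limg f = <[w]>%VS by rewrite dim_vline w0.
apply/eqP; rewrite eqEsubv; apply/andP; split.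
  by apply/subvP => _ /memv_imgP[v _ ->]; rewrite fE memvZ ?memv_line.
by rewrite -memvE -fv0 memv_img ?memvf.
Qed.

(** Equivalent to the intersection of X and E being a down-set of X and an up-set of E, the
    condition for the identity on common points, extended by zero, to be a map k_X -> k_E. *)
Definition compatible (X E : Int P) := forall x y : P, (x <= y)%O ->
  x \in val X -> y \in val E -> (y \in val X) = (x \in val E).

Section CanonicalMap.
Variables X E : Int P.
Hypothesis XE : compatible X E.

Let w x : K E x := (x \in val X)%:R *: one k E x.

Lemma canonical_out x : x \notin val X -> w x = 0.
Proof. by rewrite /w => /negbTE->; rewrite scale0r. Qed.

Lemma canonical_nat (x y : P) (h : (x <= y)%O) :
  x \in val X -> rmap (K E) h (w x) = w y.
Proof.
move=> xX; rewrite /w rmapZ xX scale1r.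
have [yE|yE] := boolP (y \in val E); last first.
  rewrite (one_notin _ yE) scaler0; have [xE|xE] := boolP (x \in val E).
    by rewrite rmap_one // one_notin.
  by rewrite (one_notin _ xE) lfun0.
rewrite (XE h xX yE); have [xE|xE] := boolP (x \in val E).
  by rewrite rmap_one // scale1r.
by rewrite (one_notin _ xE) lfun0 scale0r.
Qed.

Definition canonical_map : hom (K X) (K E) := int_hom canonical_out canonical_nat.

Lemma canonical_mapE x v : canonical_map x v = coef v *: one k E x.
Proof.
rewrite hom_coef int_homE /w; have [_|xX] := boolP (x \in val X).
  by rewrite scale1r.
by rewrite [v]coefK one_notin // scaler0 coef0 !scale0r.
Qed.
End CanonicalMap.

Variables A B C E : Int P.
Hypotheses (hA : compatible A E) (hB : compatible B E) (hC : compatible C E).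

Let S := dsum (dsum (K A) (K B)) (K C).

Definition sum_map : hom S (K E) :=
  comphom (canonical_map hA) (comphom (pr1 _ _) (pr1 (dsum (K A) (K B)) (K C))) +
  comphom (canonical_map hB) (comphom (pr2 _ _) (pr1 (dsum (K A) (K B)) (K C))) +
  comphom (canonical_map hC) (pr2 (dsum (K A) (K B)) (K C)).

Lemma sum_mapE x (a : K A x) (b : K B x) (c : K C x) :
  sum_map x ((a, b, c) : S x) = (coef a + coef b + coef c) *: one k E x.
Proof.
rewrite !hom_addE (hom_compE (canonical_map hA)) (hom_compE (canonical_map hB)).
rewrite (hom_compE (canonical_map hC)) !hom_compE !(pr1E, pr2E) /=.
by rewrite (canonical_mapE hA) (canonical_mapE hB) (canonical_mapE hC) -!scalerDl.
Qed.

Definition kernel3 : rep k P := ker sum_map.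

(* The three coordinates of a point; each vanishes where its interval does not
   contain x. *)
Definition ca x (v : kernel3 x) : k := coef (ker_inc sum_map x v : S x).1.1.
Definition cb x (v : kernel3 x) : k := coef (ker_inc sum_map x v : S x).1.2.
Definition cc x (v : kernel3 x) : k := coef (ker_inc sum_map x v : S x).2.

Lemma kernel3_ext x (u v : kernel3 x) :
  ca u = ca v -> cb u = cb v -> cc u = cc v -> u = v.
Proof.
rewrite /ca /cb /cc => ea eb ec; apply: (@ker_inc_inj _ _ _ _ _ sum_map x).
move: (ker_inc _ x u : S x) (ker_inc _ x v : S x) ea eb ec.
move=> [[a b] c] [[a' b'] c'] /= ea eb ec.
by rewrite [a]coefK [b]coefK [c]coefK ea eb ec -!coefK.
Qed.

Lemma kernel3_coord0 x :
  [/\ ca (0 : kernel3 x) = 0, cb (0 : kernel3 x) = 0 & cc (0 : kernel3 x) = 0].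
Proof. by rewrite /ca /cb /cc lfun0 !coef0. Qed.

Lemma kernel3_coordD x (u v : kernel3 x) :
  [/\ ca (u + v) = ca u + ca v, cb (u + v) = cb u + cb v
    & cc (u + v) = cc u + cc v].
Proof. by rewrite /ca /cb /cc lfunD !coefD. Qed.

Lemma kernel3_coordZ x t (v : kernel3 x) :
  [/\ ca (t *: v) = t * ca v, cb (t *: v) = t * cb v & cc (t *: v) = t * cc v].
Proof. by rewrite /ca /cb /cc lfunZ !coefZ. Qed.

Lemma kernel3_sum x (v : kernel3 x) : x \in val E -> ca v + cb v + cc v = 0.
Proof.
move=> xE; have := comphom_at v (ker_incK sum_map); rewrite hom_zeroE.
rewrite /ca /cb /cc; case: (ker_inc _ x v : S x) => [[a b] c].
by rewrite sum_mapE => /eqP; rewrite scaler_eq0 (negbTE (one_neq0 k xE)) orbF => /eqP.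
Qed.

Lemma kernel3_exists x (a b c : k) : (x \notin val A -> a = 0) ->
  (x \notin val B -> b = 0) -> (x \notin val C -> c = 0) ->
  (x \in val E -> a + b + c = 0) ->
  exists v : kernel3 x, [/\ ca v = a, cb v = b & cc v = c].
Proof.
move=> a0 b0 c0 s0.
have cE (X : Int P) (t : k) : (x \notin val X -> t = 0) -> coef (t *: one k X x) = t.
  move=> t0; rewrite coefZ coef_one; have [_|/t0->] := boolP (x \in val X).
    by rewrite mulr1.
  by rewrite mul0r.
have [|v vE] := @ker_mem _ _ _ _ _ sum_map x
    ((a *: one k A x, b *: one k B x, c *: one k C x) : S x).
  rewrite sum_mapE !cE //; have [/s0->|xE] := boolP (x \in val E).
    by rewrite scale0r.
  by rewrite one_notin // scaler0.
by exists v; rewrite /ca /cb /cc -vE /= !cE.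
Qed.

Lemma coef_out (X : Int P) x (v : K X x) : x \notin val X -> coef v = 0.
Proof. by move=> xX; rewrite [v]coefK one_notin // scaler0 coef0. Qed.

Lemma kernel3_out x (v : kernel3 x) :
  [/\ x \notin val A -> ca v = 0, x \notin val B -> cb v = 0
    & x \notin val C -> cc v = 0].
Proof.
rewrite /ca /cb /cc; case: (ker_inc _ x v : S x) => [[a b] c] /=.
by split; apply: coef_out.
Qed.

Lemma coef_rmap (X : Int P) (x y : P) (h : (x <= y)%O) (v : K X x) :
  coef (rmap (K X) h v) = (y \in val X)%:R * coef v.
Proof.
rewrite [v in LHS]coefK rmapZ coefZ; have [xX|xX] := boolP (x \in val X).
  by rewrite rmap_one // coef_one mulrC.
by rewrite (coef_out v xX) mul0r mulr0.
Qed.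

Lemma kernel3_rmap (x y : P) (h : (x <= y)%O) (v : kernel3 x) :
  [/\ ca (rmap kernel3 h v) = (y \in val A)%:R * ca v,
      cb (rmap kernel3 h v) = (y \in val B)%:R * cb v
    & cc (rmap kernel3 h v) = (y \in val C)%:R * cc v].
Proof.
rewrite /ca /cb /cc hom_nat; case: (ker_inc _ x v : S x) => [[a b] c].
by rewrite !dsumE /= !coef_rmap.
Qed.

Lemma kernel3_dim0 x : x \notin val A -> x \notin val B -> x \notin val C ->
  \dim {: kernel3 x} = 0%N.
Proof.
move=> xA xB xC; apply/eqP; rewrite dimv_eq0 -subv0; apply/subvP => v _.
rewrite memv0; apply/eqP.
have [a0 b0 c0] := kernel3_out v; have [a0' b0' c0'] := kernel3_out (0 : kernel3 x).
by apply: kernel3_ext; rewrite ?(a0 xA) ?(b0 xB) ?(c0 xC) ?a0' ?b0' ?c0'.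
Qed.
End ThreeTermKernel.

(** * The kernel at a centre c with two leaves q and r above it *)

Section Star.
Variables (k : fieldType) (d : Order.disp_t) (P : finPOrderType d).
Variables (c q r : P) (A B C E : Int P).
Hypotheses (hA : compatible A E) (hB : compatible B E) (hC : compatible C E).
Let M := kernel3 k hA hB hC.
Hypotheses (cA : c \in val A) (cB : c \in val B) (cC : c \in val C)
  (cE : c \in val E).
Hypotheses (qA : q \in val A) (qB : q \notin val B) (qC : q \notin val C)
  (qE : q \notin val E).
Hypotheses (rA : r \notin val A) (rB : r \in val B) (rC : r \notin val C)
  (rE : r \notin val E).
Hypotheses (cq : (c <= q)%O) (cr : (c <= r)%O).


Lemma kernel3_rank1 (x y : P) (h : (x <= y)%O) (l : M x -> k) (w : M y) v0 :
  w <> 0 -> rmap M h v0 = w ->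
  (forall v, [/\ (y \in val A)%:R * ca v = l v * ca w,
                 (y \in val B)%:R * cb v = l v * cb w
               & (y \in val C)%:R * cc v = l v * cc w]) ->
  \dim (limg (rmap M h)) = 1%N.
Proof.
move=> w0 hv0 lE; apply: (@limg_rank1 _ _ _ _ l w v0) => //; first exact/eqP.
move=> v; have [ea eb ec] := lE v; have [ra rb rc] := kernel3_rmap h v.
have [za zb zc] := kernel3_coordZ (l v) w.
by apply: kernel3_ext; rewrite ?ra ?rb ?rc ?za ?zb ?zc.
Qed.

(** The generator at c goes to a vector that dies at q and at r. These two maps read off the
    coordinates in A and B, and the third one vanishes because the sum is zero. *)
Lemma star_socle0 (f : hom (interval_rep k (point_int c)) M) : f = 0.
Proof.
apply: int_hom_ext => x /set1P->; rewrite hom_zeroE; set v := f c _.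
have killed y (h : (c <= y)%O) : y \notin val E -> rmap M h v = 0.
  move=> yE; rewrite /v (hom_one_nat f h) ?inE ?eqxx // hom_one_out //.
  by rewrite inE; apply: contraNneq yE => ->.
have [a0 b0 c0] := kernel3_coord0 k hA hB hC c.
have va : ca v = 0.
  have [ra _ _] := kernel3_rmap cq v; have [qa0 _ _] := kernel3_coord0 k hA hB hC q.
  by rewrite killed // qa0 qA mul1r in ra.
have vb : cb v = 0.
  have [_ rb _] := kernel3_rmap cr v; have [_ rb0 _] := kernel3_coord0 k hA hB hC r.
  by rewrite killed // rb0 rB mul1r in rb.
have := kernel3_sum v cE; rewrite va vb !add0r => vc.
by apply: kernel3_ext; rewrite ?va ?vb ?vc ?a0 ?b0 ?c0.
Qed.

Lemma star_killed y (h : (c <= y)%O) (v : M c) :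
  (y \in val A -> ca v = 0) -> (y \in val B -> cb v = 0) ->
  (y \in val C -> cc v = 0) -> rmap M h v = 0.
Proof.
move=> va vb vc; have [ra rb rc] := kernel3_rmap h v.
have [a0 b0 c0] := kernel3_coord0 k hA hB hC y.
have z (b : bool) (t : k) : (b -> t = 0) -> b%:R * t = 0.
  by case: b => [->//|_]; rewrite ?mulr0 ?mul0r.
by apply: kernel3_ext; rewrite ?ra ?rb ?rc ?a0 ?b0 ?c0 z.
Qed.

Lemma star_elt (a b c' : k) : a + b + c' = 0 ->
  exists v : M c, [/\ ca v = a, cb v = b & cc v = c'].
Proof. by move=> s; apply: kernel3_exists; rewrite ?cA ?cB ?cC. Qed.

Lemma star_split (v : M c) a b c' : a + b + c' = 0 -> exists u w : M c,
  [/\ v = u + w, [/\ ca u = a, cb u = b & cc u = c'] &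
    [/\ ca w = ca v - a, cb w = cb v - b & cc w = cc v - c']].
Proof.
move=> s; have [u [ua ub uc]] := star_elt s.
have [|w [wa wb wc]] := @star_elt (ca v - a) (cb v - b) (cc v - c').
  by rewrite [X in X + _]addrACA -opprD addrACA -opprD s kernel3_sum // subrr.
exists u, w; split=> //; have [da db dc] := kernel3_coordD u w.
by apply: kernel3_ext; rewrite ?da ?db ?dc ?ua ?ub ?uc ?wa ?wb ?wc addrC subrK.
Qed.

Lemma star_rank_qr (J : Int P) : c \in val J -> q \in val J -> r \in val J ->
  generalized_rank M J = 0%N.
Proof.
move=> cJ qJ rJ; apply: (rank_two_kernels cJ qJ rJ (xy := cq) (xz := cr)) => v.
(* The part (0, cb v, - cb v) dies at q, where only the first coordinate survives; the remainder has
   second coordinate 0 and dies at r. *)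
have [|u [w [vE [ua ub uc] [wa wb wc]]]] := @star_split v 0 (cb v) (- cb v).
  by rewrite add0r subrr.
exists u, w; split=> //; apply: star_killed => //.
- by rewrite (negbTE qB).
- by rewrite (negbTE qC).
- by rewrite (negbTE rA).
- by rewrite wb subrr.
- by rewrite (negbTE rC).
Qed.

Lemma star_limg_q : \dim (limg (rmap M cq)) = 1%N.
Proof.
have [|v0 [v0a v0b v0c]] := @star_elt 1 0 (-1); first by rewrite addr0 subrr.
have [w [wa wb wc]] : exists w : M q, [/\ ca w = 1, cb w = 0 & cc w = 0].
  by apply: kernel3_exists; rewrite ?qA ?(negbTE qE).
have [ra rb rc] := kernel3_rmap cq v0.
apply: (@kernel3_rank1 _ _ _ (fun v => ca v) w v0).
- move=> w0; move: wa; rewrite w0; have [-> _ _] := kernel3_coord0 k hA hB hC q.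
  by move/esym/eqP; rewrite oner_eq0.
- by apply: kernel3_ext; rewrite ?ra ?rb ?rc ?wa ?wb ?wc ?qA ?v0a ?v0b ?(negbTE qC)
    ?mul1r ?mul0r ?mulr0.
- by move=> v; rewrite wa wb wc qA (negbTE qB) (negbTE qC) mul1r !mul0r !mulr0 mulr1.
Qed.

Lemma star_limg_r : \dim (limg (rmap M cr)) = 1%N.
Proof.
have [|v0 [v0a v0b v0c]] := @star_elt 0 1 (-1); first by rewrite add0r subrr.
have [w [wa wb wc]] : exists w : M r, [/\ ca w = 0, cb w = 1 & cc w = 0].
  by apply: kernel3_exists; rewrite ?rB ?(negbTE rE).
have [ra rb rc] := kernel3_rmap cr v0.
apply: (@kernel3_rank1 _ _ _ (fun v => cb v) w v0).
- move=> w0; move: wb; rewrite w0; have [_ -> _] := kernel3_coord0 k hA hB hC r.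
  by move/esym/eqP; rewrite oner_eq0.
- by apply: kernel3_ext; rewrite ?ra ?rb ?rc ?wa ?wb ?wc ?rB ?v0a ?v0b ?(negbTE rC)
    ?mul1r ?mul0r ?mulr0.
- by move=> v; rewrite wa wb wc rB (negbTE rA) (negbTE rC) mul1r !mul0r !mulr0 mulr1.
Qed.

Lemma star_dim_c : \dim {: M c} = 2.
Proof.
have := ker_dim (sum_map k hA hB hC) c; rewrite !dim_dsum !dim_interval cA cB cC.
have -> : \dim (limg (sum_map k hA hB hC c)) = 1%N.
  apply: (@limg_rank1 _ _ _ _ (fun v : dsum (dsum (interval_rep k A)
    (interval_rep k B)) (interval_rep k C) c => coef v.1.1 + coef v.1.2 + coef v.2)
    (one k E c) (one k A c, 0, 0)); first exact: one_neq0.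
    by move=> [[a b] c']; rewrite sum_mapE.
  by rewrite sum_mapE coef_one cA !coef0 !addr0 scale1r.
by move=> e; apply/eqP; rewrite -(eqn_add2r 1) [X in X == _]e.
Qed.
End Star.

(** * Stars embedded in P, with the third leaf p above or below the centre *)

Section StarPosets.
Variables (k : fieldType) (d : Order.disp_t) (P : finPOrderType d).
Variables (c p q r : P).
Let D := [set c; p; q; r].
Hypotheses (uniq_star : uniq [:: c; p; q; r]) (convex_star : convex D).
Hypotheses (cq : (c <= q)%O) (cr : (c <= r)%O).
Hypothesis q_max : forall y, y \in D -> (q <= y)%O -> y = q.
Hypothesis r_max : forall y, y \in D -> (r <= y)%O -> y = r.

Lemma star_neq : (((c == p) = false) * ((p == c) = false) *
  ((c == q) = false) * ((q == c) = false) * ((c == r) = false) *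
  ((r == c) = false) * ((p == q) = false) * ((q == p) = false) *
  ((p == r) = false) * ((r == p) = false) * ((q == r) = false) *
  ((r == q) = false))%type.
Proof.
move: uniq_star; rewrite /= !inE !negb_or => /and3P[/and3P[]].
move=> /negbTE cp /negbTE cq' /negbTE cr' /andP[/negbTE pq /negbTE pr].
move=> /andP[/negbTE qr _].
by rewrite !(eq_sym _ c) !(eq_sym r) (eq_sym q p) cp cq' cr' pq pr qr.
Qed.

Lemma inD x : (x \in D) = [|| x == c, x == p, x == q | x == r].
Proof. by rewrite !inE -!orbA. Qed.

Lemma star_subset (J S : {set P}) : c \in S -> J \subset D ->
  (J \subset S) = [&& (p \in J) ==> (p \in S), (q \in J) ==> (q \in S)
                    & (r \in J) ==> (r \in S)].
Proof.
move=> cS /fintype.subsetP JD; apply/fintype.subsetP/and3P.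
  by move=> JS; split; apply/implyP; apply: JS.
move=> [/implyP pS /implyP qS /implyP rS] x xJ; have := JD x xJ.
by rewrite inD => /or4P[] /eqP xE; move: xJ; rewrite xE; auto.
Qed.

Section Intervals.
Hypothesis pc : (p >=< c)%O.
Hypothesis p_extremal : forall x z, x \in D -> z \in D ->
  (x <= p)%O -> (p <= z)%O -> p = x \/ p = z.

(** A point between two points of S lies in D by convexity. If it is a leaf, it is extremal in D and
    must equal one of the two ends; otherwise it is c. Every point of S is comparable to c, which
    gives connectedness. *)
Lemma star_interval (S : {set P}) : c \in S -> S \subset D -> is_interval S.
Proof.
move=> cS /fintype.subsetP SD; apply/andP; split.
  apply/forall_inP => x xS; apply/forall_inP => z zS; apply/forallP => y.
  apply/implyP => /andP[xy yz].
  have := convexP convex_star xy yz (SD x xS) (SD z zS).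
  rewrite inD => /or4P[] /eqP yE; rewrite yE in xy yz *.
  - by [].
  - by have [->|->] := p_extremal (SD x xS) (SD z zS) xy yz.
  - by rewrite -(q_max (SD z zS) yz).
  - by rewrite -(r_max (SD z zS) yz).
apply/andP; split; first by apply/set0Pn; exists c.
have cmp x : x \in S -> (x >=< c)%O.
  move=> /SD; rewrite inD => /or4P[] /eqP->; rewrite ?comparablexx //.
    by rewrite comparable_sym /Order.comparable cq.
  by rewrite comparable_sym /Order.comparable cr.
apply/forall_inP => x xS; apply/forall_inP => z zS.
apply: (@connect_trans _ _ c); apply: connect1; rewrite cS ?xS ?zS /= ?cmp //.
by rewrite comparable_sym cmp.
Qed.
End Intervals.

Section DiagramAtCentre.
Variables (A B C E : Int P).
Hypotheses (hA : compatible A E) (hB : compatible B E) (hC : compatible C E).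
Let M := kernel3 k hA hB hC.
Hypothesis rankE : forall J : Int P, c \in val J ->
  (generalized_rank M J)%:Z = (val J \subset val A)%:Z + (val J \subset val B)%:Z
    + (val J \subset val C)%:Z - (val J \subset val E)%:Z.

(** The right side satisfies the inversion formula on intervals containing c. These form an upward
    closed family, so uniqueness applies there without knowing any other rank. *)
Lemma diagram_centre (J : Int P) : c \in val J -> generalized_diagram M J =
  (J == A)%:Z + (J == B)%:Z + (J == C)%:Z - (J == E)%:Z.
Proof.
have delta (X J' : Int P) :
    \sum_(L : Int P | val J' \subset val L) (L == X)%:Z = (val J' \subset val X)%:Z.
  have [J'X|J'X] := boolP (val J' \subset val X).
    by rewrite (bigD1 X) //= eqxx big1 ?addr0 // => L /andP[_ /negbTE->].
  by rewrite big1 // => L J'L; case: eqP => // LX; rewrite LX in J'L; rewrite J'L in J'X.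
move: J; apply: (@moebius_uniq _ _ _ (fun J => (J == A)%:Z + (J == B)%:Z +
  (J == C)%:Z - (J == E)%:Z) (fun J => c \in val J)).
  by move=> J L cJ /fintype.subsetP; apply.
move=> J cJ; rewrite -diagramP rankE //.
rewrite -(delta A) -(delta B) -(delta C) -(delta E).
by rewrite big_split big_split big_split sumrN; reflexivity.
Qed.
End DiagramAtCentre.

Lemma star_rank_out (A B C E : Int P) (hA : compatible A E) (hB : compatible B E)
    (hC : compatible C E) (J : Int P) :
  val A \subset D -> val B \subset D -> val C \subset D ->
  ~~ (val J \subset D) -> generalized_rank (kernel3 k hA hB hC) J = 0%N.
Proof.
move=> /fintype.subsetP AD /fintype.subsetP BD /fintype.subsetP CD /subsetPn[x xJ xD].
by apply: (rank_vanishing xJ); apply: kernel3_dim0;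
  apply: contraNN xD; [apply: AD|apply: BD|apply: CD].
Qed.

Lemma star_mem (J : {set P}) z : J \subset D -> z \in J ->
  [\/ z = c, z = p /\ p \in J, z = q /\ q \in J | z = r /\ r \in J].
Proof.
move=> /fintype.subsetP JD zJ; have := JD z zJ.
rewrite inD => /or4P[] /eqP zE; rewrite zE in zJ *; first exact: Or41.
- exact: Or42.
- exact: Or43.
- exact: Or44.
Qed.

Lemma limg_rmap_id (M : rep k P) x : \dim (limg (rmap M (lexx x))) = \dim {: M x}.
Proof.
congr (\dim _); apply/vspaceP => v; rewrite memvf rmap_id.
by rewrite -[v]id_lfunE memv_img ?memvf.
Qed.

Section UpperLeaf.
Hypotheses (cp : (c <= p)%O).
Hypothesis p_max : forall y, y \in D -> (p <= y)%O -> y = p.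
Hypothesis c_min : forall x, x \in D -> (x <= c)%O -> x = c.

Lemma D03_star : exists M : rep k P,
  (forall f : hom (interval_rep k (point_int c)) M, f = 0) /\
  generalized_diagram M (point_int c) != 0.
Proof.
have pc : (p >=< c)%O by rewrite comparable_sym /Order.comparable cp.
have p_ext x z : x \in D -> z \in D -> (x <= p)%O -> (p <= z)%O -> p = x \/ p = z.
  by move=> _ zD _ /(p_max zD)->; right.
have leaf y : y \in D -> {Y : Int P | val Y = [set c; y]}.
  move=> yD; have SD : [set c; y] \subset D.
    by apply/fintype.subsetP => z /set2P[] -> //; rewrite inD eqxx.
  by exists (exist (fun S => is_interval S) [set c; y]
    (star_interval pc p_ext (set21 c y) SD)).
have [A AE] : {Y : Int P | val Y = [set c; q]} by apply: leaf; rewrite inD eqxx !orbT.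
have [B BE] : {Y : Int P | val Y = [set c; r]} by apply: leaf; rewrite inD eqxx !orbT.
have [C CE] : {Y : Int P | val Y = [set c; p]} by apply: leaf; rewrite inD eqxx !orbT.
(* Here {c} is the term with negative sign, so the diagram at {c} will be -1. *)
pose E := point_int c; have EE : val E = [set c] by [].
have cD : c \in D by rewrite inD eqxx.
have AD : val A \subset D.
  by rewrite AE; apply/fintype.subsetP => z /set2P[]->; rewrite inD eqxx ?orbT.
have BD : val B \subset D.
  by rewrite BE; apply/fintype.subsetP => z /set2P[]->; rewrite inD eqxx ?orbT.
have CD : val C \subset D.
  by rewrite CE; apply/fintype.subsetP => z /set2P[]->; rewrite inD eqxx ?orbT.
have ED : val E \subset D by apply/fintype.subsetP => z /set1P->.
have compat (X : Int P) : c \in val X -> val X \subset D -> compatible X E.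
  move=> cX /fintype.subsetP XD x y xy xX /set1P yE; rewrite yE in xy *.
  by rewrite (c_min (XD x xX) xy) cX inE eqxx.
have cA : c \in val A by rewrite AE !inE eqxx.
have cB : c \in val B by rewrite BE !inE eqxx.
have cC : c \in val C by rewrite CE !inE eqxx.
have cE : c \in val E by rewrite EE !inE eqxx.
have memA x : (x \in val A) = (x == c) || (x == q) by rewrite AE !inE.
have memB x : (x \in val B) = (x == c) || (x == r) by rewrite BE !inE.
have memC x : (x \in val C) = (x == c) || (x == p) by rewrite CE !inE.
have memE x : (x \in val E) = (x == c) by rewrite !inE.
pose memX := (memA, memB, memC, memE, star_neq).
have hA := compat A cA AD; have hB := compat B cB BD; have hC := compat C cC CD.
pose M := kernel3 k hA hB hC; exists M; split.
  by apply: star_socle0 cq cr; rewrite ?memX ?eqxx.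
have sum0 := kernel3_sum (k := k) (hA := hA) (hB := hB) (hC := hC) _ cE.
have limg_p : \dim (limg (rmap M cp)) = 1%N.
  have [|v0 [v0a v0b v0c]] := @star_elt k d P c A B C E hA hB hC cA cB cC (-1) 0 1.
    by rewrite addr0 addNr.
  have [w [wa wb wc]] : exists w : M p, [/\ ca w = 0, cb w = 0 & cc w = 1].
    by apply: kernel3_exists; rewrite ?memX ?eqxx ?orbT.
  have [ra rb rc] := kernel3_rmap cp v0.
  apply: (@kernel3_rank1 _ _ _ _ _ _ _ hA hB hC _ _ _ (fun v => cc v) w v0).
  - move=> w0; move: wc; rewrite w0; have [_ _ ->] := kernel3_coord0 k hA hB hC p.
    by move/esym/eqP; rewrite oner_eq0.
  - by apply: kernel3_ext; rewrite ?ra ?rb ?rc ?wa ?wb ?wc ?memX ?eqxx /= ?v0c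
      ?mul0r ?mul1r.
  - by move=> v; rewrite wa wb wc !memX eqxx /= mul1r !mul0r !mulr0 mulr1.
have rankE (J : Int P) : c \in val J -> (generalized_rank M J)%:Z =
    (val J \subset val A)%:Z + (val J \subset val B)%:Z
    + (val J \subset val C)%:Z - (val J \subset val E)%:Z.
  move=> cJ; have [JD|nJD] := boolP (val J \subset D); last first.
    have out (X : Int P) : val X \subset D -> (val J \subset val X) = false.
      by move=> XD; apply: contraNF nJD => /subset_trans; apply.
    by rewrite (star_rank_out hA hB hC AD BD CD nJD) !out.
  have cz z : z \in val J -> (c <= z)%O.
    by move=> /(star_mem JD)[->|[-> _]|[-> _]|[-> _]].
  rewrite !(star_subset _ JD) // !memX !eqxx /=.
  have mem z := @star_mem (val J) z JD.
  (* The cases list the leaves in J. Two or more leaves give rank 0, as M c is the sum of the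
     kernels at two of them; one leaf gives the rank of a structure map, which is 1; none gives dim
     M c = 2. *)
  case pJ: (p \in val J); case qJ: (q \in val J); case rJ: (r \in val J) => /=.
  - by rewrite (@star_rank_qr k d P c q r) ?memX ?eqxx.
  - rewrite (rank_two_kernels cJ qJ pJ (xy := cq) (xz := cp)) // => v.
    (* The triple (0, - cc v, cc v) dies at q and carries the whole third coordinate of v, so the
       remainder dies at p. *)
    have [|u [w [vE [ua ub uc] [wa wb wc]]]] :=
      @star_split k d P c A B C E hA hB hC cA cB cC cE v 0 (- cc v) (cc v).
      by rewrite add0r addNr.
    exists u, w; split=> //; apply: star_killed; rewrite ?memX ?eqxx //.
    by rewrite wc subrr.
  - rewrite (rank_two_kernels cJ rJ pJ (xy := cr) (xz := cp)) // => v.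
    have [|u [w [vE [ua ub uc] [wa wb wc]]]] :=
      @star_split k d P c A B C E hA hB hC cA cB cC cE v (- cc v) 0 (cc v).
      by rewrite addr0 addNr.
    exists u, w; split=> //; apply: star_killed; rewrite ?memX ?eqxx //.
    by rewrite wc subrr.
  - rewrite (rank_min_max M cp cJ pJ) ?limg_p // => z /mem[->|[->]|[_]|[_]] //;
      by rewrite ?qJ ?rJ.
  - by rewrite (@star_rank_qr k d P c q r) ?memX ?eqxx.
  - rewrite (rank_min_max M cq cJ qJ) ?star_limg_q ?memX ?eqxx // => z.
    by move=> /mem[->|[_]|[->]|[_]] //; rewrite ?pJ ?rJ.
  - rewrite (rank_min_max M cr cJ rJ) ?star_limg_r ?memX ?eqxx // => z.
    by move=> /mem[->|[_]|[_]|[->]] //; rewrite ?pJ ?qJ.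
  - rewrite (rank_min_max M (lexx c) cJ cJ) ?limg_rmap_id ?star_dim_c // => z.
    by move=> /mem[->|[_]|[_]|[_]] //; rewrite ?pJ ?qJ ?rJ.
rewrite (diagram_centre rankE) ?inE //.
have neq (X : Int P) y : val X = [set c; y] -> (c == y) = false -> (E == X) = false.
  move=> XE cy; apply/eqP => EX; have : y \in val X by rewrite XE set22.
  by rewrite -EX memE eq_sym cy.
by rewrite (neq A q) ?(neq B r) ?(neq C p) ?star_neq // eqxx.
Qed.
End UpperLeaf.

Section LowerLeaf.
Hypotheses (pc : (p <= c)%O).
Hypothesis p_min : forall x, x \in D -> (x <= p)%O -> x = p.
Hypothesis c_low : forall x, x \in D -> (x <= c)%O -> x = c \/ x = p.

Lemma D12_star : exists M : rep k P,
  (forall f : hom (interval_rep k (point_int c)) M, f = 0) /\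
  generalized_diagram M (point_int c) != 0.
Proof.
have pc' : (p >=< c)%O by rewrite /Order.comparable pc.
have p_ext x z : x \in D -> z \in D -> (x <= p)%O -> (p <= z)%O -> p = x \/ p = z.
  by move=> xD _ /(p_min xD)->; left.
have int (S : {set P}) : c \in S -> S \subset D -> {Y : Int P | val Y = S}.
  move=> cS SD.
  by exists (exist (fun S => is_interval S) S (star_interval pc' p_ext cS SD)).
have cD : c \in D by rewrite inD eqxx.
have sub3 y : y \in D -> [set c; p; y] \subset D.
  move=> yD; apply/fintype.subsetP => z; rewrite in_setU => /orP[|/set1P->//].
  by case/set2P => ->; rewrite inD eqxx ?orbT.
have [A AE] : {Y : Int P | val Y = [set c; p; q]}.
  by apply: int; rewrite ?sub3 ?inE ?eqxx ?orbT.
have [B BE] : {Y : Int P | val Y = [set c; p; r]}.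
  by apply: int; rewrite ?sub3 ?inE ?eqxx ?orbT.
have [E EE] : {Y : Int P | val Y = [set c; p]}.
  apply: int; rewrite ?inE ?eqxx //.
  by apply/fintype.subsetP => z /set2P[]->; rewrite inD eqxx ?orbT.
(* Now {c} is a term with positive sign and A, B, E all contain p, so the diagram at {c} will be
   1. *)
pose C := point_int c.
have AD : val A \subset D by rewrite AE sub3 // inD eqxx !orbT.
have BD : val B \subset D by rewrite BE sub3 // inD eqxx !orbT.
have CD : val C \subset D by apply/fintype.subsetP => z /set1P->.
have ED : val E \subset D.
  by rewrite EE; apply/fintype.subsetP => z /set2P[]->; rewrite inD eqxx ?orbT.
have memA x : (x \in val A) = [|| x == c, x == p | x == q] by rewrite AE !inE orbA.
have memB x : (x \in val B) = [|| x == c, x == p | x == r] by rewrite BE !inE orbA.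
have memC x : (x \in val C) = (x == c) by rewrite !inE.
have memE x : (x \in val E) = (x == c) || (x == p) by rewrite EE !inE.
pose memX := (memA, memB, memC, memE, star_neq).
have compat (X : Int P) : c \in val X -> val X \subset D -> compatible X E.
  move=> cX /fintype.subsetP XD x y xy xX; rewrite memE => /orP[] /eqP yE.
    rewrite yE in xy *; rewrite cX memE.
    by have [->|->] := c_low (XD x xX) xy; rewrite eqxx ?orbT.
  rewrite yE in xy *; have xp := p_min (XD x xX) xy.
  by rewrite xp in xX *; rewrite xX memE eqxx orbT.
have cA : c \in val A by rewrite memA eqxx.
have cB : c \in val B by rewrite memB eqxx.
have cC : c \in val C by rewrite memC eqxx.
have cE : c \in val E by rewrite memE eqxx.
have pE : p \in val E by rewrite memE eqxx orbT.
have hA := compat A cA AD; have hB := compat B cB BD; have hC := compat C cC CD.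
pose M := kernel3 k hA hB hC; exists M; split.
  by apply: star_socle0 cq cr; rewrite ?memX ?eqxx ?orbT.
have neq0 x (w : M x) : (ca w <> 0) -> w <> 0.
  by move=> wa w0; apply: wa; rewrite w0; case: (kernel3_coord0 k hA hB hC x).
have elt_p (s t : k) : s + t = 0 ->
    exists v : M p, [/\ ca v = s, cb v = t & cc v = 0].
  by move=> st; apply: kernel3_exists; rewrite ?memX ?eqxx ?orbT ?addr0.
have limg_pq : \dim (limg (rmap M (le_trans pc cq))) = 1%N.
  (* The line M p is spanned by (1, -1, 0): the third coordinate vanishes off C, and the sum is zero
     on E. *)
  have [v0 [v0a v0b v0c]] := elt_p 1 (-1) (subrr _).
  have [w [wa wb wc]] : exists w : M q, [/\ ca w = 1, cb w = 0 & cc w = 0].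
    by apply: kernel3_exists; rewrite ?memX ?eqxx ?orbT.
  have [ra rb rc] := kernel3_rmap (le_trans pc cq) v0.
  apply: (@kernel3_rank1 _ _ _ _ _ _ _ hA hB hC _ _ _ (fun v => ca v) w v0).
  - by apply: neq0; rewrite wa; apply/eqP/oner_neq0.
  - by apply: kernel3_ext; rewrite ?ra ?rb ?rc ?wa ?wb ?wc ?memX ?eqxx /= ?v0a
      ?mul0r ?mul1r.
  - by move=> v; rewrite wa wb wc !memX eqxx /= mul1r !mul0r !mulr0 mulr1.
have limg_pr : \dim (limg (rmap M (le_trans pc cr))) = 1%N.
  have [v0 [v0a v0b v0c]] := elt_p (-1) 1 (addNr _).
  have [w [wa wb wc]] : exists w : M r, [/\ ca w = 0, cb w = 1 & cc w = 0].
    by apply: kernel3_exists; rewrite ?memX ?eqxx ?orbT.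
  have [ra rb rc] := kernel3_rmap (le_trans pc cr) v0.
  apply: (@kernel3_rank1 _ _ _ _ _ _ _ hA hB hC _ _ _ (fun v => cb v) w v0).
  - move=> w0; move: wb; rewrite w0; have [_ -> _] := kernel3_coord0 k hA hB hC r.
    by move/esym/eqP; rewrite oner_eq0.
  - by apply: kernel3_ext; rewrite ?ra ?rb ?rc ?wa ?wb ?wc ?memX ?eqxx /= ?v0b
      ?mul0r ?mul1r.
  - by move=> v; rewrite wa wb wc !memX eqxx /= mul1r !mul0r !mulr0 mulr1.
have limg_pc : \dim (limg (rmap M pc)) = 1%N.
  have [v0 [v0a v0b v0c]] := elt_p 1 (-1) (subrr _).
  have [|w [wa wb wc]] := @star_elt k d P c A B C E hA hB hC cA cB cC 1 (-1) 0.
    by rewrite addr0 subrr.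
  have [ra rb rc] := kernel3_rmap pc v0.
  apply: (@kernel3_rank1 _ _ _ _ _ _ _ hA hB hC _ _ _ (fun v => ca v) w v0).
  - by apply: neq0; rewrite wa; apply/eqP/oner_neq0.
  - by apply: kernel3_ext; rewrite ?ra ?rb ?rc ?wa ?wb ?wc ?memX ?eqxx /= ?v0a
      ?v0b ?v0c ?mul1r.
  - move=> v; rewrite wa wb wc cA cB cC !mul1r mulr1 mulr0 mulrN1.
    have [_ _ vc] := kernel3_out v; have := kernel3_sum v pE.
    rewrite vc ?memX // addr0 => /eqP; rewrite addrC addr_eq0 => /eqP->.
    by [].
have rankE (J : Int P) : c \in val J -> (generalized_rank M J)%:Z =
    (val J \subset val A)%:Z + (val J \subset val B)%:Z
    + (val J \subset val C)%:Z - (val J \subset val E)%:Z.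
  move=> cJ; have [JD|nJD] := boolP (val J \subset D); last first.
    have out (X : Int P) : val X \subset D -> (val J \subset val X) = false.
      by move=> XD; apply: contraNF nJD => /subset_trans; apply.
    by rewrite (star_rank_out hA hB hC AD BD CD nJD) !out.
  rewrite !(star_subset _ JD) // !memX !eqxx /=.
  have mem z := @star_mem (val J) z JD.
  (* If J contains both q and r, the rank is 0. Otherwise J is a chain and its rank is that of the
     structure map from its least to its greatest point: 2 for J = {c} and 1 in the other cases. *)
  case pJ: (p \in val J); case qJ: (q \in val J); case rJ: (r \in val J) => /=.
  - by rewrite (@star_rank_qr k d P c q r) ?memX ?eqxx.
  - rewrite (rank_min_max M (le_trans pc cq) pJ qJ) ?limg_pq // => z.
      by move=> /mem[->|[->]|[->]|[_]] //; rewrite ?rJ // (le_trans pc cq).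
    by move=> /mem[->|[->]|[->]|[_]] //;
      rewrite ?rJ // (le_trans pc cq).
  - rewrite (rank_min_max M (le_trans pc cr) pJ rJ) ?limg_pr // => z.
      by move=> /mem[->|[->]|[_]|[->]] //; rewrite ?qJ // (le_trans pc cr).
    by move=> /mem[->|[->]|[_]|[->]] //;
      rewrite ?qJ // (le_trans pc cr).
  - rewrite (rank_min_max M pc pJ cJ) ?limg_pc // => z /mem[->|[->]|[_]|[_]] //;
      by rewrite ?qJ ?rJ.
  - by rewrite (@star_rank_qr k d P c q r) ?memX ?eqxx.
  - rewrite (rank_min_max M cq cJ qJ) ?star_limg_q ?memX ?eqxx // => z;
      by move=> /mem[->|[_]|[->]|[_]] //; rewrite ?pJ ?rJ.
  - rewrite (rank_min_max M cr cJ rJ) ?star_limg_r ?memX ?eqxx // => z;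
      by move=> /mem[->|[_]|[_]|[->]] //; rewrite ?pJ ?qJ.
  - rewrite (rank_min_max M (lexx c) cJ cJ) ?limg_rmap_id ?star_dim_c // => z;
      by move=> /mem[->|[_]|[_]|[_]] //; rewrite ?pJ ?qJ ?rJ.
rewrite (diagram_centre rankE) ?inE //.
have neq (X : Int P) : p \in val X -> (C == X) = false.
  by move=> pX; apply/eqP => CX; move: pX; rewrite -CX memC star_neq.
by rewrite (neq A) ?(neq B) ?(neq E) ?memX ?eqxx ?orbT.
Qed.
End LowerLeaf.
End StarPosets.

(** * Recognising the stars in the two posets *)

Section EmbeddedStars.
Variables (k : fieldType) (d : Order.disp_t) (P : finPOrderType d).

(** The tool for refuting a relation in a generated order: a set closed under edges that contains
    the source but not the target. *)
Lemma connect_closed (T : finType) (e : rel T) (S : pred T) x y :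
  connect e x y -> (forall a b, e a b -> S a -> S b) -> S x -> S y.
Proof.
move=> /connectP[s + ->] cl; elim: s x => //= z s ih x /andP[xz zs] Sx.
exact: ih zs (cl _ _ xz Sx).
Qed.

Let i1 : 'I_4 := @Ordinal 4 0 isT.
Let i2 : 'I_4 := @Ordinal 4 1 isT.
Let i3 : 'I_4 := @Ordinal 4 2 isT.
Let i4 : 'I_4 := @Ordinal 4 3 isT.

Lemma I4_cases (i : 'I_4) : [\/ i = i1, i = i2, i = i3 | i = i4].
Proof.
case: i => [[|[|[|[|//]]]] h].
- by apply: Or41; apply: val_inj.
- by apply: Or42; apply: val_inj.
- by apply: Or43; apply: val_inj.
- by apply: Or44; apply: val_inj.
Qed.

Lemma embedding_inj (dQ : Order.disp_t) (Q : finPOrderType dQ) (f : Q -> P) :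
  (forall x y, (f x <= f y)%O = (x <= y)%O) -> injective f.
Proof.
by move=> hf x y e; apply/le_anti; rewrite -!hf e lexx.
Qed.

(** The centre 3 comes first, then the leaf 1, whose position differs in the two posets, then the
    leaves 2 and 4, which lie above the centre in both. *)
Lemma I4_image (f : 'I_4 -> P) :
  f @: [set: 'I_4] = [set f i3; f i1; f i2; f i4].
Proof.
apply/setP => x; apply/imsetP/idP => [[i _ ->]|].
  by rewrite !inE; case: (I4_cases i) => ->; rewrite eqxx ?orbT.
by rewrite !inE -!orbA => /or4P[] /eqP->; [exists i3|exists i1|exists i2|exists i4].
Qed.

Lemma D12_example : convex_embedded D12 P -> exists (M : rep k P) (c : P),
  (forall f : hom (interval_rep k (point_int c)) M, f = 0) /\
  generalized_diagram M (point_int c) != 0.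
Proof.
move=> [f [hf cf]]; have inj := embedding_inj hf.
have le_up (S : pred 'I_4) (i j : D12) : (f i <= f j)%O ->
    (forall a b, edge D12_edges a b -> S a -> S b) -> S i -> S j.
  by rewrite hf; apply: connect_closed.
have inD y : y \in [set f i3; f i1; f i2; f i4] -> exists i, y = f i.
  by rewrite -(I4_image f) => /imsetP[i _ ->]; exists i.
suff [M hM] : exists M : rep k P,
    (forall g : hom (interval_rep k (point_int (f i3))) M, g = 0) /\
    generalized_diagram M (point_int (f i3)) != 0.
  by exists M, (f i3).
apply: (@D12_star k d P (f i3) (f i1) (f i2) (f i4)).
- by rewrite (map_inj_uniq inj [:: i3; i1; i2; i4]).
- by rewrite -(I4_image f).
- by rewrite hf; apply: connect1.
- by rewrite hf; apply: connect1.
- move=> _ /inD[i ->] le_i; congr f; apply/eqP.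
  apply: (le_up (pred1 i2) _ _ le_i) => // a b ab /eqP aE; move: ab.
  by rewrite aE.
- move=> _ /inD[i ->] le_i; congr f; apply/eqP.
  apply: (le_up (pred1 i4) _ _ le_i) => // a b ab /eqP aE; move: ab.
  by rewrite aE.
- by rewrite hf; apply: connect1.
- move=> _ /inD[i ->] le_i; congr f; apply/eqP; apply: contraT => ni.
  (* No edge enters the point 1, so the points other than 1 are closed under edges. *)
  have cl a b : edge D12_edges a b -> a != i1 -> b != i1.
    by case: (I4_cases a) => ->; case: (I4_cases b) => ->.
  by have := le_up (fun j => j != i1) _ _ le_i cl ni.
- move=> _ /inD[i ->] le_i; suff : (i == i3) || (i == i1).
    by case/orP => /eqP->; [left|right].
  apply: contraT => ni.
  have cl a b : edge D12_edges a b -> ~~ ((a == i3) || (a == i1)) ->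
      ~~ ((b == i3) || (b == i1)).
    by case: (I4_cases a) => ->; case: (I4_cases b) => ->.
  by have := le_up (fun j => ~~ ((j == i3) || (j == i1))) _ _ le_i cl ni.
Qed.

Lemma D03_example : convex_embedded D03 P -> exists (M : rep k P) (c : P),
  (forall f : hom (interval_rep k (point_int c)) M, f = 0) /\
  generalized_diagram M (point_int c) != 0.
Proof.
move=> [f [hf cf]]; have inj := embedding_inj hf.
have le_up (S : pred 'I_4) (i j : D03) : (f i <= f j)%O ->
    (forall a b, edge D03_edges a b -> S a -> S b) -> S i -> S j.
  by rewrite hf; apply: connect_closed.
have inD y : y \in [set f i3; f i1; f i2; f i4] -> exists i, y = f i.
  by rewrite -(I4_image f) => /imsetP[i _ ->]; exists i.
(* All edges start at the point 3, so a single leaf is closed under edges. *)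
have leaf (l : 'I_4) : l != i3 ->
    forall y, y \in [set f i3; f i1; f i2; f i4] -> (f l <= y)%O -> y = f l.
  move=> l3 _ /inD[i ->] le_i; congr f; apply/eqP.
  apply: (le_up (pred1 l) _ _ le_i) => [a b ab /eqP aE|]; last exact: eqxx.
  by move: ab l3; rewrite aE; case: (I4_cases l) => ->; case: (I4_cases b) => ->.
suff [M hM] : exists M : rep k P,
    (forall g : hom (interval_rep k (point_int (f i3))) M, g = 0) /\
    generalized_diagram M (point_int (f i3)) != 0.
  by exists M, (f i3).
apply: (@D03_star k d P (f i3) (f i1) (f i2) (f i4)); try exact: leaf.
- by rewrite (map_inj_uniq inj [:: i3; i1; i2; i4]).
- by rewrite -(I4_image f).
- by rewrite hf; apply: connect1.
- by rewrite hf; apply: connect1.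
- by rewrite hf; apply: connect1.
- move=> _ /inD[i ->] le_i; congr f; apply/eqP; apply: contraT => ni.
  have cl a b : edge D03_edges a b -> a != i3 -> b != i3.
    by case: (I4_cases a) => ->; case: (I4_cases b) => ->.
  by have := le_up (fun j => j != i3) _ _ le_i cl ni.
Qed.
End EmbeddedStars.

Local Close Scope ring_scope.

Theorem theorem4p3 (k : fieldType) (d : Order.disp_t) (P : finPOrderType d) :
  (convex_embedded D12 P \/ convex_embedded D03 P ->
     incomparable (dgmInt k P) (chiInt k P) /\
     incomparable (dgmInt k P) (betaInt k P 0))
  /\
  ((exists M : rep k P,
      indecomposable M /\ forall I : Int P, ~ iso M (interval_rep k I)) ->
     [/\ incomparable (piInt k P) (dgmInt k P),
         incomparable (piInt k P) (chiInt k P),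
         incomparable (piInt k P) (betaInt k P 0)
       & incomparable (chiInt k P) (betaInt k P 0)]).
Proof.
split.
  move=> emb; have [M [c [socle0 dgm0]]] : exists (M : rep k P) (c : P),
      (forall f : hom (interval_rep k (point_int c)) M, f = GRing.zero) /\
      generalized_diagram M (point_int c) != GRing.zero.
    by case: emb => [/D12_example|/D03_example].
  split; apply: (incomparable_of_neq (M := M)).
  - exact: dgmInt_delta.
  - exact: chiInt_delta.
  - rewrite dgmIntE chiIntE => e; move: dgm0.
    by rewrite e euler_socle0 ?eqxx.
  - exact: dgmInt_delta.
  - exact: betaInt_delta.
  - rewrite dgmIntE betaIntE => e; move: dgm0.
    by rewrite e betti_socle0 ?eqxx.
move=> [M [Mi nK]]; have M0 : ~ is_zero M by case: Mi.
have pi0 : piInt k P (K0class M) = GRing.zero.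
  rewrite piIntE; apply/ffunP => I.
  by rewrite !ffunE multiplicity_indecomposable.
split; apply: (incomparable_of_neq (M := M)); rewrite ?pi0;
  try by [exact: piInt_delta|exact: dgmInt_delta|exact: chiInt_delta
    |exact: betaInt_delta].
- by rewrite dgmIntE => /esym; apply: diagram_neq0.
- by rewrite chiIntE => /esym; apply: euler_neq0.
- by rewrite betaIntE => /esym; apply: betti0_neq0.
- by rewrite chiIntE betaIntE; apply: euler_neq_betti0.
Qed.
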